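(* Let $N\geq2$. For every $\alpha>\frac12$ there exists a bounded, smooth, uniformly strictly convex domain $\Omega_\alpha\subset\mathbb{R}^N$ such that the unique solution $u$ of $$\Delta u=e^u\ \text{ in }\Omega_\alpha,\qquad u=0\ \text{ on }\partial\Omega_\alpha,$$ has the property that $(-u)^\alpha$ is not concave in $\Omega_\alpha$.
   Context: A bounded smooth domain is uniformly strictly convex if the second fundamental form of its boundary with respect to the exterior unit normal is uniformly positive definite (sign convention in which round balls qualify). Solutions are classical, $u\in C^2(\Omega_\alpha)\cap C^0(\overline{\Omega_\alpha})$; such a solution exists, is unique and satisfies $u<0$ in $\Omega_\alpha$. *)

(* Defs.v *)
From mathcomp Require Import all_boot all_order all_algebra.
From mathcomp Require Import all_classical all_reals all_analysis.

Set Implicit Arguments.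
Unset Strict Implicit.
Unset Printing Implicit Defensive.

Import Order.TTheory GRing.Theory Num.Theory.
Import numFieldNormedType.Exports.

Local Open Scope classical_set_scope.
Local Open Scope ring_scope.

(* R^N is 'rV[R]_N.  Its library norm is the sup norm, which yields the usual
   topology, bounded sets and derivatives; Euclidean lengths and angles are
   taken from the inner product [dot]. *)

Section EuclideanCalculus.
Context {R : realType} {N : nat}.
Implicit Types (A : set 'rV[R]_N) (f : 'rV[R]_N -> R) (x v w : 'rV[R]_N).

Definition dot v w : R := \sum_(i < N) v 0 i * w 0 i.

Definition partial (i : 'I_N) f : 'rV[R]_N -> R :=
  fun x => 'D_(delta_mx 0 i) f x.

Definition grad f x : 'rV[R]_N := \row_(i < N) partial i f x.

Definition laplacian f x : R := \sum_(i < N) partial i (partial i f) x.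

(* C^k on an open set A: all iterated partial derivatives of order at most k
   exist and are continuous at every point of A. *)
Fixpoint Ck (k : nat) A f : Prop :=
  {in A, continuous f} /\
  (if k is k'.+1 then
     forall i : 'I_N,
       (forall x, A x -> derivable f x (delta_mx 0 i)) /\ Ck k' A (partial i f)
   else True).

Definition smooth A f : Prop := forall k, Ck k A f.

Definition boundary A : set 'rV[R]_N := closure A `\` interior A.

Definition concave_function A f : Prop :=
  convex_function A (fun x => - f x).

End EuclideanCalculus.

Section SmoothDomains.
Context {R : realType} {N : nat}.
Implicit Types (Omega U : set 'rV[R]_N) (rho : 'rV[R]_N -> R).
Implicit Types (x v w : 'rV[R]_N).

Definition domain Omega : Prop :=
  [/\ open Omega, Omega !=set0 & connected Omega].

(* As grad rho does not vanish on U, the boundary of Omega in U is the smooth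
   hypersurface {rho = 0}, Omega lies on one side of it, and grad rho points
   out of Omega. *)
Definition local_defining_function Omega x U rho : Prop :=
  [/\ open U, U x, smooth U rho,
      (forall y, U y -> (Omega y <-> rho y < 0)) &
      (forall y, U y -> grad rho y != 0)].

Definition smooth_boundary Omega : Prop :=
  forall x, boundary Omega x ->
    exists U rho, local_defining_function Omega x U rho.

(* If rho is a local defining function of Omega, this restricts to the exterior
   unit normal of Omega on its boundary. *)
Definition unit_normal rho x : 'rV[R]_N :=
  (Num.sqrt (dot (grad rho x) (grad rho x)))^-1 *: grad rho x.

(* II(v, w) = <D_v nu, w> with nu the exterior unit normal, for v and w tangent
   to the boundary at x; unit spheres have II(v, w) = <v, w>.  For tangent v,
   D_v nu only involves nu on the boundary, so that II does not depend on the
   local defining function. *)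
Definition second_fundamental_form rho x v w : R :=
  dot ('D_v (unit_normal rho) x) w.

Definition uniformly_strictly_convex Omega : Prop :=
  exists2 c : R, 0 < c &
    forall x, boundary Omega x ->
      exists U rho, local_defining_function Omega x U rho /\
        forall v, dot v (unit_normal rho x) = 0 ->
          c * dot v v <= second_fundamental_form rho x v v.

(* u is a total function, but only its values on the closure of Omega matter:
   the derivatives are taken at points of the open set Omega. *)
Definition classical_solution Omega (u : 'rV[R]_N -> R) : Prop :=
  [/\ Ck 2 Omega u,
      {within closure Omega, continuous u},
      (forall x, Omega x -> laplacian u x = expR (u x)) &
      (forall x, boundary Omega x -> u x = 0)].

Definition unique_classical_solution Omega (u : 'rV[R]_N -> R) : Prop :=
  classical_solution Omega u /\
  forall u' : 'rV[R]_N -> R,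
    classical_solution Omega u' -> {in closure Omega, u' =1 u}.

End SmoothDomains.

(* Main.v *)
Require Import Defs.
From mathcomp Require Import all_boot all_order all_algebra.
From mathcomp Require Import all_classical all_reals all_analysis.
From mathcomp Require Import ring lra zify.

Set Implicit Arguments.
Unset Strict Implicit.
Unset Printing Implicit Defensive.

Import Order.TTheory GRing.Theory Num.Theory.
Import numFieldNormedType.Exports.

Local Open Scope classical_set_scope.
Local Open Scope ring_scope.

(** Write [d = N - 1] and look for solutions [u x = k U (x_0, |x'|^2 / lam)] with
    [k = lam / (2 d)], [x'] being the last [d] coordinates.  Then [Delta u = e^u] becomes
    [lam U_tt + 4 s U_ss + 2 d U_s = 2 d exp (k U)], which determines a formal
    power series from [U (t, 0) = - g t] where [g t = t^2 - t^3 - delta].  A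
    majorant shows that it converges on a fixed polydisc and that, as [lam]
    tends to 0, it tends to [s - g t] together with its derivatives.

    The domain is the part [0 < x_0 < 1] of [{u < 0}], which for small [lam] is close to
    [|x'|^2 < lam g (x_0)].  It is uniformly convex because [sqrt g] is strictly
    concave, that is [g'^2 > 2 g g''] where [g >= 0].  On the axis [- u = k g],
    and [g t] is about [t^2] for [sqrt delta << t << 1]; comparing the points [e^2],
    [e] and their midpoint, where [delta = e^4 / 4], gives about [(e^2 / 4)^alpha]
    against [(e^2)^alpha / 2], which contradicts concavity when
    [alpha > 1/2].  Uniqueness is the maximum principle. *)

(** No Dirichlet problem is solved: the function comes first and the domain is cut out where it is
    negative, so the boundary condition is automatic and the work lies in the geometry of a level
    set. Expanding in [s] from data on the axis costs two [t] derivatives per power of [s]. The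
    majorant is therefore built from a function of [t + r] with [r^2 = s]: on it the second
    derivatives in [t] and in [r] agree, so the loss is paid for exactly. The cubic [g] reconciles
    two opposite demands. Convexity of the domain only asks for concavity of [sqrt g], which
    tolerates [g] close to [t^2], and [t^(2 alpha)] is strictly convex as soon as [alpha > 1/2]. For
    [delta = 0] one has [sqrt g = t sqrt (1 - t)]: the factor [1 - t] closes the domain at [t = 1]
    and makes the concavity strict, while [delta > 0] rounds off the conical tip at [t = 0]. The
    choices are made in the order [alpha], [theta = 2^(-1/alpha)], [e], [delta], a tolerance
    [delta / 100] for the derivatives of the profile, and last [lam], small enough for that
    tolerance. *)

(** * Sums and Cauchy products of geometrically bounded sequences *)

Section GeometricSums.
Context {R : realType}.
Implicit Types (a b : nat -> R) (r M x y : R).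

Definition geom_bounded r M a := forall n, `|a n| <= M * r ^+ n.

Definition gsum a : R := limn (series a).

Definition conv a b n : R := \sum_(i < n.+1) a i * b (n - i)%N.

(** A linear factor, be it the number of terms of a Cauchy product or the exponent brought down by a
    derivative, is absorbed by any larger ratio. The bound comes from [rho^(n+1) - r^(n+1) = (rho -
    r) * sum of rho^i r^(n-i)], where each of the [n + 1] summands is at least [r^n]. *)
Lemma succ_geom_le r rho n : 0 < r < rho ->
  n.+1%:R * r ^+ n <= rho / (rho - r) * rho ^+ n.
Proof.
move=> /andP[r0 rrho].
have rho0 : 0 < rho by exact: lt_trans rrho.
rewrite [leRHS]mulrAC -exprS ler_pdivlMr ?subr_gt0//.
elim: n => [|n IH]; first by rewrite expr0 !mulr1 mul1r; lra.
rewrite exprS [leRHS]exprS.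
have rn : r ^+ n <= rho ^+ n by rewrite lerXn2r ?nnegrE ?ltW.
have -> : n.+2%:R * (r * r ^+ n) * (rho - r)
  = r * (n.+1%:R * r ^+ n * (rho - r)) + r * r ^+ n * (rho - r).
  by rewrite -[n.+2]addn1 natrD; ring.
apply: (@le_trans _ _ (r * rho ^+ n.+1 + rho * rho ^+ n * (rho - r))).
  apply: lerD; first by rewrite ler_pM2l.
  by rewrite ler_pM2r ?subr_gt0// ler_pM ?exprn_ge0// ltW.
by rewrite exprS; lra.
Qed.

Lemma geom_bounded_ge0 r M a : geom_bounded r M a -> 0 <= M.
Proof. by move=> /(_ 0%N); rewrite expr0 mulr1; apply: le_trans. Qed.

Lemma geom_bounded_cvg r M a : 0 < r < 1 -> geom_bounded r M a ->
  series a @ \oo --> gsum a.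
Proof.
move=> /andP[r0 r1] aM.
suff : cvgn [normed series a] by move/normed_cvg.
apply: (@series_le_cvg _ _ (geometric M r)) => [n|n|n|].
- exact: normr_ge0.
- by rewrite mulr_ge0 ?exprn_ge0 ?(geom_bounded_ge0 aM)// ltW.
- exact: aM.
- by apply: is_cvg_geometric_series; rewrite gtr0_norm.
Qed.

Lemma gsum_le r M a : 0 < r < 1 -> geom_bounded r M a ->
  `|gsum a| <= M / (1 - r).
Proof.
move=> r01 aM; have /andP[r0 r1] := r01.
have ca := geom_bounded_cvg r01 aM.
have M0 := geom_bounded_ge0 aM.
apply: (cvgr_to_le (cvg_norm ca)); near=> n.
apply: (@le_trans _ _ (series (geometric M r) n)); last first.
  by apply: geometric_le_lim => //; rewrite gtr0_norm.
rewrite /series/= (le_trans (ler_norm_sum _ _ _))// ler_sum.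
Unshelve. all: by end_near. Qed.

Lemma gsum_uniq a l : series a @ \oo --> l -> gsum a = l.
Proof. by move=> al; apply: cvg_lim. Qed.

Lemma gsumD r M M' a b : 0 < r < 1 -> geom_bounded r M a ->
  geom_bounded r M' b -> gsum (fun n => a n + b n) = gsum a + gsum b.
Proof.
move=> r01 aM bM; apply: gsum_uniq.
rewrite (_ : (fun n => _) = a + b)// seriesD.
by apply: cvgD; [exact: geom_bounded_cvg aM|exact: geom_bounded_cvg bM].
Qed.

Lemma gsumZ r M a x : 0 < r < 1 -> geom_bounded r M a ->
  gsum (fun n => x * a n) = x * gsum a.
Proof.
move=> r01 aM; apply: gsum_uniq.
rewrite (_ : (fun n => _) = x *: a)// seriesZ.
exact: (@cvgZl_tmp _ R^o _ _ _ _ _ _ (geom_bounded_cvg r01 aM)).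
Qed.

Lemma gsumB r M M' a b : 0 < r < 1 -> geom_bounded r M a ->
  geom_bounded r M' b -> gsum (fun n => a n - b n) = gsum a - gsum b.
Proof.
move=> r01 aM bM.
rewrite -(mulN1r (gsum b)) -(gsumZ _ r01 bM) -(gsumD r01 aM (M' := M')).
  by congr gsum; apply/funext => n; rewrite mulN1r.
by move=> n; rewrite mulN1r normrN.
Qed.

Lemma gsum_sum r (M : nat -> R) (a : nat -> nat -> R) n : 0 < r < 1 ->
  (forall i, geom_bounded r (M i) (a i)) ->
  gsum (fun k => \sum_(i < n) a i k) = \sum_(i < n) gsum (a i).
Proof.
move=> r01 aM; apply: gsum_uniq.
rewrite (_ : series _ = fun m => \sum_(i < n) series (a i) m); last first.
  by apply/funext => m; rewrite /series/= exchange_big.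
apply: (@cvg_big R 'I_n +%R 0 xpredT add_continuous) => i _.
exact: geom_bounded_cvg (aM i).
Qed.

Lemma gsum_split r M a n : 0 < r < 1 -> geom_bounded r M a ->
  gsum a = series a n + gsum (fun i => a (i + n)%N).
Proof.
move=> r01 aM; apply/eqP; rewrite addrC -subr_eq; apply/eqP/esym.
apply: gsum_uniq.
rewrite (_ : series _ = (fun m => series a (m + n)%N - series a n)).
  apply: cvgB; last exact: cvg_cst.
  by rewrite (cvg_shiftn n (series a)); exact: geom_bounded_cvg aM.
apply/funext => m; rewrite sub_series_geq ?leq_addl//.
rewrite -{2}(add0n n) big_addn addnK /series/=.
by [].
Qed.

Lemma gsumS r M a : 0 < r < 1 -> geom_bounded r M a ->
  gsum a = a 0%N + gsum (fun i => a i.+1).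
Proof.
move=> r01 aM; rewrite (gsum_split 1 r01 aM) /series/= big_nat1.
by under [in LHS]eq_fun do rewrite addn1.
Qed.

Lemma gsum_tail r M a n : 0 < r < 1 -> geom_bounded r M a ->
  `|gsum a - series a n| <= M * r ^+ n / (1 - r).
Proof.
move=> r01 aM; rewrite (gsum_split n r01 aM) addrAC subrr add0r.
by apply: gsum_le => // i; rewrite -mulrA -exprD addnC; apply: aM.
Qed.

Lemma conv_bounded r rho M M' a b : 0 < r < rho -> geom_bounded r M a ->
  geom_bounded r M' b ->
  geom_bounded rho (M * M' * (rho / (rho - r))) (conv a b).
Proof.
move=> rr aM bM n; have M0 := geom_bounded_ge0 aM.
have M0' := geom_bounded_ge0 bM; have /andP[r0 r1] := rr.
rewrite (le_trans (ler_norm_sum _ _ _))//.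
apply: (@le_trans _ _ (\sum_(i < n.+1) M * M' * r ^+ n)).
  apply: ler_sum => i _; rewrite normrM.
  have -> : r ^+ n = r ^+ i * r ^+ (n - i).
    by rewrite -exprD subnKC// -ltnS.
  by rewrite mulrACA ler_pM.
rewrite sumr_const card_ord -mulr_natl mulrCA -[leRHS]mulrA.
by rewrite ler_wpM2l ?mulr_ge0//; exact: succ_geom_le.
Qed.

Lemma series_conv a b n :
  series (conv a b) n = \sum_(i < n) a i * series b (n - i)%N.
Proof.
elim: n => [|n IH]; first by rewrite /series/= big_geq// big_ord0.
rewrite seriesSr IH /conv big_ord_recr/= [in RHS]big_ord_recr/=.
rewrite subnn subSn// subnn addrA -big_split/=; congr (_ + _).
  apply: eq_bigr => i _; rewrite -mulrDr; congr (_ * _).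
  by rewrite subSn 1?ltnW// seriesSr.
by rewrite /series/= big_nat1.
Qed.

(** By [series_conv], the error after [n] terms is the sum over [i < n] of [a i] times the tail of
    [b] from [n - i] on. Each summand is of order [r^n], so the error is of order [n r^n] and
    vanishes. *)
Lemma gsum_conv r M M' a b : 0 < r < 1 -> geom_bounded r M a ->
  geom_bounded r M' b -> gsum (conv a b) = gsum a * gsum b.
Proof.
move=> r01 aM bM; have /andP[r0 r1] := r01; apply: gsum_uniq.
have M0 := geom_bounded_ge0 aM; have M0' := geom_bounded_ge0 bM.
pose rho := (1 + r) / 2.
have rr : 0 < r < rho by rewrite r0/= /rho; lra.
have rho1 : rho < 1 by rewrite /rho; lra.
have rho0 : 0 < rho by rewrite /rho; lra.
pose C := M * M' / (1 - r) * (rho / (rho - r)).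
have main n : `|series a n * gsum b - series (conv a b) n| <= C * rho ^+ n.
  rewrite series_conv /series/= big_mkord mulr_suml -sumrB.
  rewrite (le_trans (ler_norm_sum _ _ _))//.
  apply: (@le_trans _ _ (\sum_(i < n) M * M' / (1 - r) * r ^+ n)).
    apply: ler_sum => i _; rewrite -mulrBr normrM.
    have -> : M * M' / (1 - r) * r ^+ n =
        (M * r ^+ i) * (M' * r ^+ (n - i) / (1 - r)).
      by rewrite -{1}(subnKC (ltnW (ltn_ord i))) exprD; ring.
    by rewrite ler_pM//; exact: gsum_tail.
  rewrite sumr_const card_ord -mulr_natl mulrCA /C -[leRHS]mulrA ler_wpM2l//.
    by rewrite mulr_ge0 ?mulr_ge0// invr_ge0; lra.
  rewrite (le_trans _ (succ_geom_le n rr))// ler_wpM2r ?exprn_ge0 1?ltW//.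
  by rewrite ltr_nat.
have c0 : (fun n => series a n * gsum b - series (conv a b) n) @ \oo --> 0.
  apply/norm_cvg0P.
  apply: (@squeeze_cvgr _ _ _ _ (fun=> 0) (geometric C rho)).
  - by near=> n; rewrite normr_ge0 main.
  - exact: cvg_cst.
  - by apply: cvg_geometric; rewrite gtr0_norm.
rewrite (_ : series _ = (fun n => series a n * gsum b -
  (series a n * gsum b - series (conv a b) n))); last first.
  by apply/funext => n; ring.
rewrite -[X in _ --> X]subr0; apply: cvgB => //.
by apply: cvgMr_tmp; exact: geom_bounded_cvg aM.
Unshelve. all: by end_near. Qed.

End GeometricSums.

(** * Iterated double sums *)

Section DoubleSums.
Context {R : realType}.
Implicit Types (a b : nat -> nat -> R) (r M x y : R).

Definition bounded2 r M a := forall j k, `|a j k| <= M * r ^+ j * r ^+ k.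

Definition dsum a : R := gsum (fun j => gsum (a j)).

Definition conv2 a b j k : R :=
  \sum_(i < j.+1) \sum_(m < k.+1) a i m * b (j - i)%N (k - m)%N.

Lemma bounded2_ge0 r M a : bounded2 r M a -> 0 <= M.
Proof. by move=> /(_ 0 0)%N; rewrite !expr0 !mulr1; apply: le_trans. Qed.

Lemma bounded2_le r r' M a : 0 < r <= r' -> bounded2 r M a -> bounded2 r' M a.
Proof.
move=> /andP[r0 rr'] aM j k; apply: (le_trans (aM j k)).
have M0 := bounded2_ge0 aM; have r0' := le_trans (ltW r0) rr'.
have h n : r ^+ n <= r' ^+ n by rewrite lerXn2r ?nnegrE// ltW.
by rewrite !ler_pM// ?mulr_ge0// exprn_ge0// ltW.
Qed.

Lemma bounded2B r M M' a b : bounded2 r M a -> bounded2 r M' b ->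
  bounded2 r (M + M') (fun j k => a j k - b j k).
Proof.
move=> aM bM j k; rewrite (le_trans (ler_normB _ _))// -mulrA mulrDl.
by apply: lerD; rewrite mulrA; [exact: aM|exact: bM].
Qed.

Lemma bounded2Z r M x a : bounded2 r M a ->
  bounded2 r (`|x| * M) (fun j k => x * a j k).
Proof.
by move=> aM j k; rewrite normrM -!mulrA ler_wpM2l// mulrA; exact: aM.
Qed.

Lemma bounded2_inner r M a j : bounded2 r M a ->
  geom_bounded r (M * r ^+ j) (a j).
Proof. by move=> aM k; exact: aM. Qed.

Lemma bounded2_outer r M a : 0 < r < 1 -> bounded2 r M a ->
  geom_bounded r (M / (1 - r)) (fun j => gsum (a j)).
Proof.
by move=> r01 aM j; rewrite mulrAC; apply: gsum_le => // k; exact: aM.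
Qed.

Lemma dsum_le r M a : 0 < r < 1 -> bounded2 r M a ->
  `|dsum a| <= M / (1 - r) / (1 - r).
Proof. by move=> r01 aM; apply: gsum_le => //; exact: bounded2_outer. Qed.

Lemma dsumD r M M' a b : 0 < r < 1 -> bounded2 r M a -> bounded2 r M' b ->
  dsum (fun j k => a j k + b j k) = dsum a + dsum b.
Proof.
move=> r01 aM bM.
rewrite -(gsumD r01 (bounded2_outer r01 aM) (bounded2_outer r01 bM)).
congr gsum; apply/funext => j.
by rewrite -(gsumD r01 (bounded2_inner j aM) (bounded2_inner j bM)).
Qed.

Lemma dsumB r M M' a b : 0 < r < 1 -> bounded2 r M a -> bounded2 r M' b ->
  dsum (fun j k => a j k - b j k) = dsum a - dsum b.
Proof.
move=> r01 aM bM.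
rewrite -(gsumB r01 (bounded2_outer r01 aM) (bounded2_outer r01 bM)).
congr gsum; apply/funext => j.
by rewrite -(gsumB r01 (bounded2_inner j aM) (bounded2_inner j bM)).
Qed.

Lemma dsumZ r M a x : 0 < r < 1 -> bounded2 r M a ->
  dsum (fun j k => x * a j k) = x * dsum a.
Proof.
move=> r01 aM; rewrite -(gsumZ _ r01 (bounded2_outer r01 aM)).
congr gsum; apply/funext => j.
by rewrite -(gsumZ _ r01 (bounded2_inner j aM)).
Qed.

Lemma gsum0 : gsum (fun=> 0 : R) = 0.
Proof.
apply: gsum_uniq; rewrite (_ : series _ = cst 0); first exact: cvg_cst.
by apply/funext => n; rewrite /series/= big1.
Qed.

Lemma dsumSl r M a : 0 < r < 1 -> bounded2 r M a -> (forall k, a 0%N k = 0) ->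
  dsum (fun j k => a j.+1 k) = dsum a.
Proof.
move=> r01 aM a0; rewrite [RHS](gsumS r01 (bounded2_outer r01 aM)).
by rewrite (_ : a 0%N = fun=> 0) ?gsum0 ?add0r//; exact/funext.
Qed.

Lemma dsumSr r M a : 0 < r < 1 -> bounded2 r M a -> (forall j, a j 0%N = 0) ->
  dsum (fun j k => a j k.+1) = dsum a.
Proof.
move=> r01 aM a0; congr gsum; apply/funext => j.
by rewrite [RHS](gsumS r01 (bounded2_inner j aM)) a0 add0r.
Qed.

Lemma dsum_conv2 r M M' a b : 0 < r < 1 -> bounded2 r M a -> bounded2 r M' b ->
  dsum (conv2 a b) = dsum a * dsum b.
Proof.
move=> r01 aM bM; have /andP[r0 r1] := r01.
rewrite -(gsum_conv r01 (bounded2_outer r01 aM) (bounded2_outer r01 bM)).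
congr gsum; apply/funext => j; rewrite [RHS]/conv.
(* The convolved rows are bounded only for ratios larger than [r]; the finite sum over [i] is
   exchanged with [gsum] at the intermediate ratio [rho < 1]. *)
pose rho := (1 + r) / 2.
have rr : 0 < r < rho by rewrite r0/= /rho; lra.
have rho01 : 0 < rho < 1 by rewrite /rho; lra.
rewrite /conv2 (@gsum_sum _ rho _ (fun i => conv (a i) (b (j - i)%N)) j.+1 rho01
  (fun i => conv_bounded rr (bounded2_inner i aM) (bounded2_inner (j - i) bM))).
apply: eq_bigr => i _.
exact: (gsum_conv r01 (bounded2_inner i aM) (bounded2_inner (j - i) bM)).
Qed.

End DoubleSums.

(** * Power series in two variables on a closed square *)

Section PowerSeries.
Context {R : realType}.
Implicit Types (c : nat -> nat -> R) (t s : R).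

Definition mono c t s j k : R := c j k * t ^+ j * s ^+ k.

Definition ps c t s : R := dsum (mono c t s).

(* Coefficient bounds that make [ps c] converge on [|t|, |s| <= 2]. *)
Definition ps_ok c := exists M q, 0 < q < 2^-1 /\ bounded2 q M c.

(** [D1] and [D2] give the coefficients of the partial derivatives in [t] and [s], [W1] and [W2]
    those of [t d/dt] and [s d/ds]. The latter do not shift indices, so bounds are proved for them
    and then transferred by a shift. *)
Definition D1 c j k : R := j.+1%:R * c j.+1 k.
Definition D2 c j k : R := k.+1%:R * c j k.+1.
Definition W1 c j k : R := j%:R * c j k.
Definition W2 c j k : R := k%:R * c j k.

Lemma le_exp2 t n : `|t| <= 2 -> `|t ^+ n| <= 2 ^+ n.
Proof. by move=> t2; rewrite normrX lerXn2r// nnegrE. Qed.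

Lemma mono_bounded q M c t s : 0 < q < 2^-1 -> bounded2 q M c ->
  `|t| <= 2 -> `|s| <= 2 -> bounded2 (2 * q) M (mono c t s).
Proof.
move=> /andP[q0 q1] cM t2 s2 j k; rewrite /mono !normrM !exprMn.
have -> : M * (2 ^+ j * q ^+ j) * (2 ^+ k * q ^+ k) =
  M * q ^+ j * q ^+ k * 2 ^+ j * 2 ^+ k by ring.
by rewrite !ler_pM ?mulr_ge0//; apply: le_exp2.
Qed.

Lemma ps_bound q M c t s : 0 < q < 2^-1 -> bounded2 q M c ->
  `|t| <= 2 -> `|s| <= 2 ->
  `|ps c t s| <= M / (1 - 2 * q) / (1 - 2 * q).
Proof.
move=> q01 cM t2 s2; apply: dsum_le; last exact: mono_bounded.
by move: q01; lra.
Qed.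

Lemma W1_bounded q rho M c : 0 < q < rho -> bounded2 q M c ->
  bounded2 rho (M * (rho / (rho - q))) (W1 c).
Proof.
move=> qr cM j k; have M0 := bounded2_ge0 cM; have /andP[q0 q1] := qr.
rewrite /W1 normrM normr_nat.
apply: (@le_trans _ _ (M * (j.+1%:R * q ^+ j) * q ^+ k)).
  rewrite (_ : M * _ * _ = j.+1%:R * (M * q ^+ j * q ^+ k)); last by ring.
  by rewrite ler_pM// ler_nat.
rewrite -(mulrA M (_ / _)) ler_pM//.
- by rewrite !mulr_ge0// exprn_ge0// ltW.
- by rewrite exprn_ge0// ltW.
- by rewrite ler_wpM2l//; exact: succ_geom_le.
- by rewrite lerXn2r ?nnegrE; lra.
Qed.

Lemma W2_bounded q rho M c : 0 < q < rho -> bounded2 q M c ->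
  bounded2 rho (M * (rho / (rho - q))) (W2 c).
Proof.
move=> qr cM j k.
have := @W1_bounded q rho M (fun k j => c j k) qr _ k j.
rewrite /W1 /W2 mulrAC; apply => k' j'.
by rewrite mulrAC; exact: cM.
Qed.

(** The inequality [q < 1/2] is strict, so the midpoint of [q] and [1/2] is again an admissible
    ratio and absorbs the factor [j]. This can be repeated forever, whence smoothness of all
    orders. *)
Lemma ps_ok_W1 c : ps_ok c -> ps_ok (W1 c).
Proof.
move=> [M [q [/andP[q0 q1] cM]]]; exists (M * ((q + 2^-1) / 2 / ((q + 2^-1) / 2 - q))).
exists ((q + 2^-1) / 2); split; first lra.
by apply: W1_bounded => //; lra.
Qed.

Lemma ps_ok_W2 c : ps_ok c -> ps_ok (W2 c).
Proof.
move=> [M [q [/andP[q0 q1] cM]]]; exists (M * ((q + 2^-1) / 2 / ((q + 2^-1) / 2 - q))).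
exists ((q + 2^-1) / 2); split; first lra.
by apply: W2_bounded => //; lra.
Qed.

Lemma ps_ok_shift1 c : ps_ok c -> ps_ok (fun j k => c j.+1 k).
Proof.
move=> [M [q [q01 cM]]]; exists (M * q), q; split=> // j k.
by rewrite -(mulrA M) -exprS; exact: cM.
Qed.

Lemma ps_ok_shift2 c : ps_ok c -> ps_ok (fun j k => c j k.+1).
Proof.
move=> [M [q [q01 cM]]]; exists (M * q), q; split=> // j k.
by rewrite (mulrAC M) -(mulrA (M * q ^+ j)) -exprS; exact: cM.
Qed.

Lemma ps_ok_D1 c : ps_ok c -> ps_ok (D1 c).
Proof. by move=> /ps_ok_W1/ps_ok_shift1. Qed.

Lemma ps_ok_D2 c : ps_ok c -> ps_ok (D2 c).
Proof. by move=> /ps_ok_W2/ps_ok_shift2. Qed.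

Lemma psD c c' t s : ps_ok c -> ps_ok c' -> `|t| <= 2 -> `|s| <= 2 ->
  ps (fun j k => c j k + c' j k) t s = ps c t s + ps c' t s.
Proof.
move=> [M [q [q01 cM]]] [M' [q' [q01' cM']]] t2 s2.
pose r := Num.max q q'.
have r01 : 0 < r < 2^-1 by rewrite /r; case: (leP q q').
have qr : 0 < q <= r by rewrite (andP q01).1 /r le_max lexx.
have qr' : 0 < q' <= r by rewrite (andP q01').1 /r le_max lexx orbT.
have r2 : 0 < 2 * r < 1 by lra.
have b1 := mono_bounded r01 (bounded2_le qr cM) t2 s2.
have b2 := mono_bounded r01 (bounded2_le qr' cM') t2 s2.
rewrite /ps -(dsumD r2 b1 b2); congr dsum.
by apply/funext => j; apply/funext => k; rewrite /mono; ring.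
Qed.

Lemma ps_okZ c x : ps_ok c -> ps_ok (fun j k => x * c j k).
Proof.
move=> [M [q [q01 cM]]]; exists (`|x| * M), q; split=> //.
exact: bounded2Z.
Qed.

Lemma psZ c x t s : ps_ok c -> `|t| <= 2 -> `|s| <= 2 ->
  ps (fun j k => x * c j k) t s = x * ps c t s.
Proof.
move=> [M [q [q01 cM]]] t2 s2.
have r2 : 0 < 2 * q < 1 by lra.
rewrite /ps -(dsumZ _ r2 (mono_bounded q01 cM t2 s2)); congr dsum.
by apply/funext => j; apply/funext => k; rewrite /mono; ring.
Qed.

Lemma ps_W1 c t s : ps_ok c -> `|t| <= 2 -> `|s| <= 2 ->
  ps (W1 c) t s = t * ps (D1 c) t s.
Proof.
move=> cok t2 s2; have [M [q [q01 cM]]] := ps_ok_D1 cok.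
have r2 : 0 < 2 * q < 1 by lra.
have [M' [q' [q01' cM']]] := ps_ok_W1 cok.
have r2' : 0 < 2 * q' < 1 by lra.
rewrite /ps -(dsumZ _ r2 (mono_bounded q01 cM t2 s2)).
rewrite -(dsumSl r2' (mono_bounded q01' cM' t2 s2)); last first.
  by move=> k; rewrite /mono /W1 !mul0r.
congr dsum.
by apply/funext => j; apply/funext => k; rewrite /mono /W1 /D1 exprS; ring.
Qed.

Lemma ps_W2 c t s : ps_ok c -> `|t| <= 2 -> `|s| <= 2 ->
  ps (W2 c) t s = s * ps (D2 c) t s.
Proof.
move=> cok t2 s2; have [M [q [q01 cM]]] := ps_ok_D2 cok.
have r2 : 0 < 2 * q < 1 by lra.
have [M' [q' [q01' cM']]] := ps_ok_W2 cok.
have r2' : 0 < 2 * q' < 1 by lra.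
rewrite /ps -(dsumZ _ r2 (mono_bounded q01 cM t2 s2)).
rewrite -(dsumSr r2' (mono_bounded q01' cM' t2 s2)); last first.
  by move=> k; rewrite /mono /W2 !mul0r.
congr dsum.
by apply/funext => j; apply/funext => k; rewrite /mono /W2 /D2 exprS; ring.
Qed.

Lemma ps_conv2 c c' t s : ps_ok c -> ps_ok c' -> `|t| <= 2 -> `|s| <= 2 ->
  ps (conv2 c c') t s = ps c t s * ps c' t s.
Proof.
move=> [M [q [q01 cM]]] [M' [q' [q01' cM']]] t2 s2.
pose r := Num.max q q'.
have r01 : 0 < r < 2^-1 by rewrite /r; case: (leP q q').
have qr : 0 < q <= r by rewrite (andP q01).1 /r le_max lexx.
have qr' : 0 < q' <= r by rewrite (andP q01').1 /r le_max lexx orbT.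
have r2 : 0 < 2 * r < 1 by lra.
have b1 := mono_bounded r01 (bounded2_le qr cM) t2 s2.
have b2 := mono_bounded r01 (bounded2_le qr' cM') t2 s2.
rewrite /ps -(dsum_conv2 r2 b1 b2); congr dsum.
apply/funext => j; apply/funext => k; rewrite /mono /conv2 -mulrA mulr_suml.
apply: eq_bigr => i _; rewrite mulr_suml; apply: eq_bigr => m _.
have -> : t ^+ j = t ^+ i * t ^+ (j - i) by rewrite -exprD subnKC// -ltnS.
have -> : s ^+ k = s ^+ m * s ^+ (k - m) by rewrite -exprD subnKC// -ltnS.
by ring.
Qed.

End PowerSeries.

(** * Uniform first-order Taylor estimates *)

Section Taylor.
Context {R : realType}.
Implicit Types (c : nat -> nat -> R) (t s x y : R).

(** The remainders satisfy [R_(n+1) = x R_n + n (x - y)^2 y^(n-1)]. The bound is shaped for termwise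
    use: [n^2] is absorbed by two Euler operators and [2^n] by the size of the square. *)
Lemma pow_taylor x y n : `|x| <= 2 -> `|y| <= 2 ->
  `|x ^+ n - y ^+ n - n%:R * (x - y) * y ^+ n.-1|
    <= n%:R ^+ 2 * (x - y) ^+ 2 * 2 ^+ n.
Proof.
move=> x2 y2; elim: n => [|n IH].
  by rewrite !expr0 subrr !mul0r subr0 normr0 expr0n !mul0r.
have -> : x ^+ n.+1 - y ^+ n.+1 - n.+1%:R * (x - y) * y ^+ n =
   x * (x ^+ n - y ^+ n - n%:R * (x - y) * y ^+ n.-1) +
   n%:R * (x - y) ^+ 2 * y ^+ n.-1.
  case: n {IH} => [|n]; first by rewrite !expr0 !expr1; ring.
  by rewrite /= -(natr1 n.+1) !exprS; ring.
have y2n : `|y ^+ n.-1| <= 2 ^+ n.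
  rewrite (le_trans (le_exp2 _ y2))// ler_weXn2l ?ler1n//.
  exact: leq_pred.
apply: (@le_trans _ _ (2 * (n%:R ^+ 2 * (x - y) ^+ 2 * 2 ^+ n) +
    n%:R * (x - y) ^+ 2 * 2 ^+ n)).
  rewrite (le_trans (ler_normD _ _))// lerD//.
    by rewrite normrM ler_pM.
  have p0 : 0 <= n%:R * (x - y) ^+ 2 by rewrite mulr_ge0 ?sqr_ge0.
  by rewrite normrM (ger0_norm p0) ler_wpM2l.
have -> : n.+1%:R = n%:R + 1 :> R by rewrite -addn1 natrD.
have n0 : 0 <= n%:R :> R by [].
have h : 0 <= (x - y) ^+ 2 * 2 ^+ n by rewrite mulr_ge0 ?sqr_ge0 ?exprn_ge0.
rewrite [2 ^+ n.+1]exprS -subr_ge0.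
have -> : (n%:R + 1) ^+ 2 * (x - y) ^+ 2 * (2 * 2 ^+ n) -
   (2 * (n%:R ^+ 2 * (x - y) ^+ 2 * 2 ^+ n) + n%:R * (x - y) ^+ 2 * 2 ^+ n) =
   (3 * n%:R + 2) * ((x - y) ^+ 2 * 2 ^+ n) by ring.
by apply: mulr_ge0 => //; lra.
Qed.

Lemma ps_taylor1 c : ps_ok c -> exists2 K, 0 <= K & forall t t' s,
  `|t| <= 2 -> `|t'| <= 2 -> `|s| <= 2 ->
  `|ps c t' s - ps c t s - (t' - t) * ps (D1 c) t s| <= K * (t' - t) ^+ 2.
Proof.
move=> cok; have [M [q [q01 cM]]] := cok.
have [M1 [q1 [q101 cM1]]] := ps_ok_W1 cok.
have [M2 [q2 [q201 cM2]]] := ps_ok_W1 (ps_ok_W1 cok).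
have [M3 [q3 [q301 cM3]]] := ps_ok_D1 cok.
have M20 := bounded2_ge0 cM2.
have r2 : 0 < 2 * q < 1 by lra.
have r21 : 0 < 2 * q1 < 1 by lra.
have r22 : 0 < 2 * q2 < 1 by lra.
have r23 : 0 < 2 * q3 < 1 by lra.
exists (M2 / (1 - 2 * q2) / (1 - 2 * q2)).
  by rewrite !divr_ge0//; lra.
move=> t t' s t2 t'2 s2.
(* [a] collects the termwise remainders, dominated through [W1 (W1 c)]. [b] is the series of [D1 c]
   before its index shift; its row [j = 0] vanishes, so the truncated predecessor is harmless. *)
pose a j k := c j k * (t' ^+ j - t ^+ j - j%:R * (t' - t) * t ^+ j.-1) * s ^+ k.
pose b j k := W1 c j k * t ^+ j.-1 * s ^+ k.
have bb : bounded2 (2 * q1) M1 b.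
  have /andP[q10 _] := q101.
  move=> j k; rewrite /b; move: (cM1 j k); move: (_ c j k) => w wM.
  rewrite !normrM !exprMn.
  have -> : M1 * (2 ^+ j * q1 ^+ j) * (2 ^+ k * q1 ^+ k) =
    M1 * q1 ^+ j * q1 ^+ k * 2 ^+ j * 2 ^+ k by ring.
  apply: ler_pM; rewrite ?mulr_ge0//; last exact: le_exp2.
  apply: ler_pM => //.
  by rewrite (le_trans (le_exp2 _ t2))// ler_weXn2l ?ler1n// leq_pred.
have ab : bounded2 (2 * q2) (M2 * (t' - t) ^+ 2) a.
  have /andP[q20 _] := q201.
  move=> j k; rewrite /a normrM (normrM (c j k)) !exprMn.
  apply: (@le_trans _ _ (`|c j k| * (j%:R ^+ 2 * (t' - t) ^+ 2 * 2 ^+ j) * 2 ^+ k)).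
    rewrite ler_pM// ?mulr_ge0//; last exact: le_exp2.
    by rewrite ler_wpM2l//; exact: pow_taylor.
  have -> : `|c j k| * (j%:R ^+ 2 * (t' - t) ^+ 2 * 2 ^+ j) * 2 ^+ k =
    `|W1 (W1 c) j k| * ((t' - t) ^+ 2 * 2 ^+ j * 2 ^+ k).
    by rewrite /W1 !normrM normr_nat; ring.
  have -> : M2 * (t' - t) ^+ 2 * (2 ^+ j * q2 ^+ j) * (2 ^+ k * q2 ^+ k) =
    M2 * q2 ^+ j * q2 ^+ k * ((t' - t) ^+ 2 * 2 ^+ j * 2 ^+ k) by ring.
  by rewrite ler_wpM2r// 2?mulr_ge0 ?sqr_ge0 ?exprn_ge0.
have -> : ps c t' s - ps c t s - (t' - t) * ps (D1 c) t s = dsum a.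
  have B1 := mono_bounded q01 cM t'2 s2.
  have B2 := mono_bounded q01 cM t2 s2.
  pose r := Num.max q q1.
  have qr : 0 < 2 * q <= 2 * r.
    by rewrite (andP r2).1 ler_pM2l// /r le_max lexx.
  have qr1 : 0 < 2 * q1 <= 2 * r.
    by rewrite (andP r21).1 ler_pM2l// /r le_max lexx orbT.
  have B3 := bounded2_le qr1 (bounded2Z (t' - t) bb).
  have B4 := bounded2_le qr (bounded2B B1 B2).
  have r24 : 0 < 2 * r < 1 by rewrite /r; case: (leP q q1).
  have -> : ps (D1 c) t s = dsum b.
    rewrite -(dsumSl r21 bb); last by move=> k; rewrite /b /W1 !mul0r.
    by [].
  rewrite -(dsumZ _ r21 bb) /ps -(dsumB r2 B1 B2) -(dsumB r24 B4 B3).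
  congr dsum; apply/funext => j; apply/funext => k.
  by rewrite /a /b /mono /W1; ring.
rewrite (le_trans (dsum_le r22 ab))//.
by rewrite le_eqVlt; apply/orP; left; apply/eqP; ring.
Qed.

Lemma ps_taylor2 c : ps_ok c -> exists2 K, 0 <= K & forall t s s',
  `|t| <= 2 -> `|s| <= 2 -> `|s'| <= 2 ->
  `|ps c t s' - ps c t s - (s' - s) * ps (D2 c) t s| <= K * (s' - s) ^+ 2.
Proof.
move=> cok; have [M [q [q01 cM]]] := cok.
have [M1 [q1 [q101 cM1]]] := ps_ok_W2 cok.
have [M2 [q2 [q201 cM2]]] := ps_ok_W2 (ps_ok_W2 cok).
have [M3 [q3 [q301 cM3]]] := ps_ok_D2 cok.
have M20 := bounded2_ge0 cM2.
have r2 : 0 < 2 * q < 1 by lra.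
have r21 : 0 < 2 * q1 < 1 by lra.
have r22 : 0 < 2 * q2 < 1 by lra.
have r23 : 0 < 2 * q3 < 1 by lra.
exists (M2 / (1 - 2 * q2) / (1 - 2 * q2)).
  by rewrite !divr_ge0//; lra.
move=> t s s' t2 s2 s'2.
pose a j k := c j k * t ^+ j * (s' ^+ k - s ^+ k - k%:R * (s' - s) * s ^+ k.-1).
pose b j k := W2 c j k * t ^+ j * s ^+ k.-1.
have bb : bounded2 (2 * q1) M1 b.
  have /andP[q10 _] := q101.
  move=> j k; rewrite /b; move: (cM1 j k); move: (_ c j k) => w wM.
  rewrite !normrM !exprMn.
  have -> : M1 * (2 ^+ j * q1 ^+ j) * (2 ^+ k * q1 ^+ k) =
    M1 * q1 ^+ j * q1 ^+ k * 2 ^+ j * 2 ^+ k by ring.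
  apply: ler_pM; rewrite ?mulr_ge0//.
    by apply: ler_pM => //; exact: le_exp2.
  by rewrite (le_trans (le_exp2 _ s2))// ler_weXn2l ?ler1n// leq_pred.
have ab : bounded2 (2 * q2) (M2 * (s' - s) ^+ 2) a.
  have /andP[q20 _] := q201.
  move=> j k; rewrite /a normrM (normrM (c j k)) !exprMn.
  apply: (@le_trans _ _ (`|c j k| * 2 ^+ j * (k%:R ^+ 2 * (s' - s) ^+ 2 * 2 ^+ k))).
    rewrite ler_pM// ?mulr_ge0//; last exact: pow_taylor.
    by rewrite ler_wpM2l//; exact: le_exp2.
  have -> : `|c j k| * 2 ^+ j * (k%:R ^+ 2 * (s' - s) ^+ 2 * 2 ^+ k) =
    `|W2 (W2 c) j k| * ((s' - s) ^+ 2 * 2 ^+ j * 2 ^+ k).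
    by rewrite /W2 !normrM normr_nat; ring.
  have -> : M2 * (s' - s) ^+ 2 * (2 ^+ j * q2 ^+ j) * (2 ^+ k * q2 ^+ k) =
    M2 * q2 ^+ j * q2 ^+ k * ((s' - s) ^+ 2 * 2 ^+ j * 2 ^+ k) by ring.
  by rewrite ler_wpM2r// 2?mulr_ge0 ?sqr_ge0 ?exprn_ge0.
have -> : ps c t s' - ps c t s - (s' - s) * ps (D2 c) t s = dsum a.
  have B1 := mono_bounded q01 cM t2 s'2.
  have B2 := mono_bounded q01 cM t2 s2.
  pose r := Num.max q q1.
  have qr : 0 < 2 * q <= 2 * r.
    by rewrite (andP r2).1 ler_pM2l// /r le_max lexx.
  have qr1 : 0 < 2 * q1 <= 2 * r.
    by rewrite (andP r21).1 ler_pM2l// /r le_max lexx orbT.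
  have B3 := bounded2_le qr1 (bounded2Z (s' - s) bb).
  have B4 := bounded2_le qr (bounded2B B1 B2).
  have r24 : 0 < 2 * r < 1 by rewrite /r; case: (leP q q1).
  have -> : ps (D2 c) t s = dsum b.
    rewrite -(dsumSr r21 bb); last by move=> k; rewrite /b /W2 !mul0r.
    by [].
  rewrite -(dsumZ _ r21 bb) /ps -(dsumB r2 B1 B2) -(dsumB r24 B4 B3).
  congr dsum; apply/funext => j; apply/funext => k.
  by rewrite /a /b /mono /W2; ring.
rewrite (le_trans (dsum_le r22 ab))//.
by rewrite le_eqVlt; apply/orP; left; apply/eqP; ring.
Qed.

Lemma ps_bounded_box c : ps_ok c -> exists2 K, 0 <= K & forall t s,
  `|t| <= 2 -> `|s| <= 2 -> `|ps c t s| <= K.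
Proof.
move=> [M [q [q01 cM]]]; exists (M / (1 - 2 * q) / (1 - 2 * q)).
  by rewrite !divr_ge0 ?(bounded2_ge0 cM)//; lra.
by move=> t s t2 s2; exact: ps_bound.
Qed.

(** Moving first in [t] and then in [s] produces the [s] derivative at [t']. Replacing it by the one
    at [t] costs a mixed term [|t' - t| |s' - s|], whose Lipschitz constant is [4 * K3 + K4] because
    [|t' - t| <= 4]. *)
Lemma ps_taylor c : ps_ok c -> exists2 K, 0 <= K & forall t t' s s',
  `|t| <= 2 -> `|t'| <= 2 -> `|s| <= 2 -> `|s'| <= 2 ->
  `|ps c t' s' - ps c t s - (t' - t) * ps (D1 c) t s
      - (s' - s) * ps (D2 c) t s| <= K * (`|t' - t| + `|s' - s|) ^+ 2.
Proof.
move=> cok.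
have [K1 K10 T1] := ps_taylor1 cok.
have [K2 K20 T2] := ps_taylor2 cok.
have [K3 K30 T3] := ps_taylor1 (ps_ok_D2 cok).
have [K4 K40 T4] := ps_bounded_box (ps_ok_D1 (ps_ok_D2 cok)).
exists (K1 + K2 + (4 * K3 + K4)) => [|t t' s s' t2 t'2 s2 s'2]; first lra.
have h1 := T1 t t' s t2 t'2 s2.
have h2 := T2 t' s s' t'2 s2 s'2.
have h3 := T3 t t' s t2 t'2 s2.
have h4 := T4 t s t2 s2.
have h5 : `|ps (D2 c) t' s - ps (D2 c) t s| <= (4 * K3 + K4) * `|t' - t|.
  have -> : ps (D2 c) t' s - ps (D2 c) t s =
    (ps (D2 c) t' s - ps (D2 c) t s - (t' - t) * ps (D1 (D2 c)) t s)
    + (t' - t) * ps (D1 (D2 c)) t s by ring.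
  rewrite (le_trans (ler_normD _ _))// [leRHS]mulrDl lerD//; last first.
    by rewrite normrM mulrC ler_wpM2r.
  apply: (le_trans h3).
  rewrite -real_normK ?num_real// expr2 mulrA ler_wpM2r//.
  rewrite mulrC ler_wpM2r//.
  rewrite (le_trans (ler_normB _ _))//; lra.
set A := `|t' - t|; set B := `|s' - s|.
have A0 : 0 <= A by rewrite /A.
have B0 : 0 <= B by rewrite /B.
have -> : ps c t' s' - ps c t s - (t' - t) * ps (D1 c) t s
      - (s' - s) * ps (D2 c) t s =
  (ps c t' s - ps c t s - (t' - t) * ps (D1 c) t s) +
  (ps c t' s' - ps c t' s - (s' - s) * ps (D2 c) t' s) +
  (s' - s) * (ps (D2 c) t' s - ps (D2 c) t s) by ring.
have e1 : (t' - t) ^+ 2 = A ^+ 2 by rewrite /A real_normK ?num_real.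
have e2 : (s' - s) ^+ 2 = B ^+ 2 by rewrite /B real_normK ?num_real.
rewrite e1 in h1; rewrite e2 in h2; rewrite -/A in h5.
have h6 : `|(s' - s) * (ps (D2 c) t' s - ps (D2 c) t s)| <=
   B * ((4 * K3 + K4) * A) by rewrite normrM ler_wpM2l.
rewrite (le_trans (ler_normD _ _))//.
rewrite (le_trans (lerD (ler_normD _ _) (lexx _)))//.
apply: (le_trans (lerD (lerD h1 h2) h6)).
have AB : 0 <= A * B by rewrite mulr_ge0.
have A2 := sqr_ge0 A; have B2 := sqr_ge0 B.
set K5 := 4 * K3 + K4.
have K50 : 0 <= K5 by rewrite addr_ge0 ?mulr_ge0.
rewrite -subr_ge0.
have -> : (K1 + K2 + K5) * (A + B) ^+ 2 -
  (K1 * A ^+ 2 + K2 * B ^+ 2 + B * (K5 * A)) =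
  K1 * (B ^+ 2 + 2 * (A * B)) + K2 * (A ^+ 2 + 2 * (A * B)) +
  K5 * (A ^+ 2 + B ^+ 2 + A * B) by ring.
by rewrite !addr_ge0 // mulr_ge0 ?addr_ge0 ?mulr_ge0.
Qed.

End Taylor.

(** Lets the Taylor estimates be used along any line or curve directly, in place of a chain rule for
    functions of two variables. *)
Lemma is_derive_quadratic (R : realType) (V : normedModType R) (f : V -> R)
    (x v : V) (L K : R) :
  (\forall h \near (0 : R), `|f (h *: v + x) - f x - h * L| <= K * h ^+ 2) ->
  is_derive x v f L.
Proof.
move=> H.
suff fL : h^-1 *: (f (h *: v + x) - f x) @[h --> 0^'] --> L.
  by apply: DeriveDef; [apply/cvg_ex; exists L|apply: cvg_lim].
apply/cvgrPdist_le => e e0.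
have K1 : 0 < `|K| + 1 by rewrite ltr_wpDl.
have Hn : \forall h \near 0^', `|f (h *: v + x) - f x - h * L| <= K * h ^+ 2.
  exact: nbhs_dnbhs.
near=> h.
have h0 : h != 0 by near: h; exact: nbhs_dnbhs_neq.
have h1 : `|f (h *: v + x) - f x - h * L| <= K * h ^+ 2 by near: h.
have h2 : `|h| <= e / (`|K| + 1).
  by near: h; apply: dnbhs0_le; rewrite divr_gt0.
have -> : L - h^-1 *: (f (h *: v + x) - f x) =
   - (h^-1 * (f (h *: v + x) - f x - h * L)).
  by rewrite mulrBr mulKf// opprB.
rewrite normrN normrM normfV mulrC ler_pdivrMr ?normr_gt0//.
rewrite (le_trans h1)// -real_normK ?num_real// expr2 mulrA ler_wpM2r//.
apply: (@le_trans _ _ ((`|K| + 1) * `|h|)).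
  by rewrite ler_wpM2r// (le_trans (ler_norm _))// lerDl.
by rewrite mulrC -ler_pdivlMr.
Unshelve. all: by end_near. Qed.

(** * Algebra of C^k functions on open sets *)

Section CkTheory.
Context {R : realType} {N : nat}.
Implicit Types (A : set 'rV[R]_N) (f g : 'rV[R]_N -> R).

Lemma partial_eq A f g i x : open A -> A x -> (forall y, A y -> f y = g y) ->
  partial i f x = partial i g x.
Proof.
move=> oA Ax fg; apply: near_eq_derive.
by apply: filterS (open_nbhs_nbhs (conj oA Ax)) => y /fg.
Qed.

Lemma derivable_eq A f g v x : open A -> A x -> (forall y, A y -> f y = g y) ->
  derivable f x v -> derivable g x v.
Proof.
move=> oA Ax fg; apply: near_eq_derivable.
by apply: filterS (open_nbhs_nbhs (conj oA Ax)) => y /fg.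
Qed.

Lemma continuous_eq A f g : open A -> (forall y, A y -> f y = g y) ->
  {in A, continuous f} -> {in A, continuous g}.
Proof.
move=> oA fg cf x /[dup] xA; rewrite inE => Ax; rewrite /prop_for/continuous_at -fg//.
apply: (cvg_trans _ (cf x xA)).
have nA : nbhs x A by exact: open_nbhs_nbhs.
by apply: (@near_eq_cvg _ _ (nbhs x)); apply: filterS nA => y /fg.
Qed.

(** Closed forms of partial derivatives hold only on [A], so each closure property below passes
    through a replacement valid on the open set alone. *)
Lemma Ck_eq k A f g : open A -> (forall y, A y -> f y = g y) ->
  Ck k A f -> Ck k A g.
Proof.
move=> oA; elim: k f g => [|k IH] f g fg /= [cf df]; split=> //.
- exact: (continuous_eq oA fg cf).
- exact: (continuous_eq oA fg cf).
move=> i; have [dfi cki] := df i; split=> [x Ax|].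
  exact: (derivable_eq oA Ax fg (dfi x Ax)).
by apply: IH cki => y Ay; exact: (partial_eq i oA Ay fg).
Qed.

Lemma CkS k A f : Ck k.+1 A f -> Ck k A f.
Proof.
elim: k f => [|k IH] f [cf df]; split=> //.
by move=> i; have [dfi cki] := df i; split=> //; exact: IH.
Qed.

Lemma CkD k A f g : open A -> Ck k A f -> Ck k A g ->
  Ck k A (fun x => f x + g x).
Proof.
move=> oA; elim: k f g => [|k IH] f g [cf df] [cg dg]; split=> //.
- by move=> x xA; exact: (cvgD (cf x xA) (cg x xA)).
- by move=> x xA; exact: (cvgD (cf x xA) (cg x xA)).
move=> i; have [dfi cfi] := df i; have [dgi cgi] := dg i; split.
  by move=> x Ax; apply: derivableD; [exact: dfi|exact: dgi].
apply: (Ck_eq oA _ (IH _ _ cfi cgi)) => x Ax /=.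
by rewrite /partial -deriveD; [|exact: dfi|exact: dgi].
Qed.

Lemma CkM k A f g : open A -> Ck k A f -> Ck k A g ->
  Ck k A (fun x => f x * g x).
Proof.
move=> oA; elim: k f g => [|k IH] f g /[dup] fk [cf df] /[dup] gk [cg dg].
  by split=> // x xA; exact: (cvgM (cf x xA) (cg x xA)).
split; first by move=> x xA; exact: (cvgM (cf x xA) (cg x xA)).
move=> i; have [dfi cfi] := df i; have [dgi cgi] := dg i; split.
  by move=> x Ax; apply: derivableM; [exact: dfi|exact: dgi].
apply: (Ck_eq oA _ (CkD oA (IH _ _ (CkS fk) cgi) (IH _ _ (CkS gk) cfi))).
move=> x Ax /=.
exact: (esym (deriveM (dfi x Ax) (dgi x Ax))).
Qed.

Lemma Ck_cst k A (a : R) : open A -> Ck k A (fun=> a).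
Proof.
move=> oA; elim: k a => [|k IH] a; split=> //; try by move=> x _; exact: cst_continuous.
move=> i; split=> [x Ax|]; first exact: derivable_cst.
by apply: (Ck_eq oA _ (IH 0)) => x Ax; rewrite /partial; exact/esym/derive_cst.
Qed.

Lemma is_derive_coord (i : 'I_N) (x v : 'rV[R]_N) :
  is_derive x v (fun y : 'rV[R]_N => y 0 i) (v 0 i).
Proof.
apply: (@is_derive_quadratic _ _ _ _ _ _ 0); near=> h.
by rewrite !mxE addrK subrr normr0 mul0r.
Unshelve. all: by end_near. Qed.

Lemma continuous_coord (i : 'I_N) : continuous (fun y : 'rV[R]_N => y 0 i).
Proof. by move=> x; exact: (differentiable_continuous (differentiable_coord _ _ _)). Qed.

Lemma Ck_coord k A (i : 'I_N) : open A -> Ck k A (fun y : 'rV[R]_N => y 0 i).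
Proof.
move=> oA; case: k => [|k]; split=> //; try by move=> x _; exact: continuous_coord.
move=> j.
split=> [x Ax|]; first by have [] := is_derive_coord i x (delta_mx 0 j).
apply: (Ck_eq oA _ (Ck_cst k (delta_mx 0 j 0 i : R) oA)) => x Ax.
by rewrite /partial; have [_ ->] := is_derive_coord i x (delta_mx 0 j).
Qed.

End CkTheory.

(** * Axially symmetric functions defined by power series *)

Section AxialFields.
Context {R : realType} {d : nat}.
Implicit Types (c : nat -> nat -> R) (x y v : 'rV[R]_d.+1).

Definition rdot x y : R :=
  \sum_(i < d) x 0 (lift ord0 i) * y 0 (lift ord0 i).

Lemma rdot_ge0 x : 0 <= rdot x x.
Proof. by apply: sumr_ge0 => i _; rewrite -expr2 sqr_ge0. Qed.

Lemma dotE x y : dot x y = x 0 ord0 * y 0 ord0 + rdot x y.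
Proof. by rewrite /dot big_ord_recl. Qed.

Lemma rdot_move x v (h : R) : rdot (h *: v + x) (h *: v + x) =
  rdot x x + 2 * h * rdot x v + h ^+ 2 * rdot v v.
Proof.
rewrite /rdot !mulr_sumr -!big_split/=; apply: eq_bigr => i _.
by rewrite !mxE; ring.
Qed.

Lemma rdot_CauchySchwarz x y : rdot x y ^+ 2 <= rdot x x * rdot y y.
Proof.
have h (e : R) : 0 <= rdot x x + 2 * e * rdot x y + e ^+ 2 * rdot y y.
  by rewrite -rdot_move rdot_ge0.
have [y0|y0] := eqVneq (rdot y y) 0.
  rewrite y0 mulr0; have [->|xy0] := eqVneq (rdot x y) 0; first by rewrite expr0n.
  (* When [rdot y y = 0] the nonnegative quadratic is affine in [e]; this argument gives it the
     value [-1]. *)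
  have := h (- (rdot x x + 1) / (2 * rdot x y)).
  rewrite y0 mulr0 addr0.
  have -> : 2 * (- (rdot x x + 1) / (2 * rdot x y)) * rdot x y =
    - (rdot x x + 1) by field; rewrite xy0.
  lra.
have y1 : 0 < rdot y y by rewrite lt_def y0 rdot_ge0.
have := h (- rdot x y / rdot y y).
have -> : rdot x x + 2 * (- rdot x y / rdot y y) * rdot x y +
  (- rdot x y / rdot y y) ^+ 2 * rdot y y =
  (rdot x x * rdot y y - rdot x y ^+ 2) / rdot y y by field.
by rewrite pmulr_lge0 ?invr_gt0// subr_ge0.
Qed.

Lemma Ck_rdot k (A : set 'rV[R]_d.+1) : open A -> Ck k A (fun x => rdot x x).
Proof.
move=> oA; rewrite /rdot.
have -> : (fun x : 'rV[R]_d.+1 => \sum_(i < d) x 0 (lift ord0 i) * x 0 (lift ord0 i)) =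
    (fun x => \sum_(j <- enum 'I_d) x 0 (lift ord0 j) * x 0 (lift ord0 j)).
  by apply/funext => x; rewrite big_enum.
elim: (enum 'I_d) => [|j s IH].
  apply: (Ck_eq oA _ (Ck_cst k 0 oA)) => x _; by rewrite big_nil.
have cj := Ck_coord k (lift ord0 j) oA.
apply: (Ck_eq oA _ (CkD oA (CkM oA cj cj) IH)) => x _.
by rewrite big_cons.
Qed.

Lemma continuous_rdot : continuous (fun x => rdot x x).
Proof.
have [H _] := Ck_rdot 0 (openT : open [set: 'rV[R]_d.+1]).
by move=> x; apply: H; rewrite inE.
Qed.

Variable lam : R.
Hypothesis lam0 : 0 < lam.

Definition rad x : R := lam^-1 * rdot x x.

Definition field c x : R := ps c (x 0 ord0) (rad x).

Definition cyl : set 'rV[R]_d.+1 := [set x : 'rV[R]_d.+1 | `|x 0 ord0| < 2 /\ rad x < 2].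

Lemma rad_ge0 x : 0 <= rad x.
Proof. by rewrite mulr_ge0 ?rdot_ge0 ?invr_ge0 ?ltW. Qed.

Lemma continuous_rad : continuous rad.
Proof. by move=> x; exact: (cvgMl_tmp (@continuous_rdot x)). Qed.

Lemma cyl_le x : cyl x -> `|x 0 ord0| <= 2 /\ `|rad x| <= 2.
Proof. by move=> [h1 h2]; rewrite (ger0_norm (rad_ge0 _)) !ltW. Qed.

Lemma open_cyl : open cyl.
Proof.
have -> : cyl = (fun x : 'rV[R]_d.+1 => `|x 0 ord0|) @^-1` [set t | t < 2]
   `&` rad @^-1` [set t | t < 2] by [].
apply: openI; apply: open_comp; try exact: open_lt.
- by move=> x _; exact: (cvg_norm (@continuous_coord _ _ ord0 x)).
- by move=> x _; exact: (@continuous_rad x).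
Qed.

Lemma is_derive_field c x v : ps_ok c -> cyl x ->
  is_derive x v (field c)
    (v 0 ord0 * field (D1 c) x + 2 * lam^-1 * rdot x v * field (D2 c) x).
Proof.
move=> cok cx; have [K K0 T] := ps_taylor cok.
have [x1 x2] := cyl_le cx.
(* For [|h| <= 1], moving by [h *: v] changes [x 0 ord0] and [rad x] by at most [m * |h|] together.
   The second summand of the constant below pays for the part of [rad] quadratic in [h]. *)
pose m := `|v 0 ord0| + lam^-1 * (2 * `|rdot x v| + rdot v v).
have il : 0 <= lam^-1 by rewrite invr_ge0 ltW.
have vv := rdot_ge0 v.
apply: (@is_derive_quadratic _ _ _ _ _ _
  (K * m ^+ 2 + lam^-1 * rdot v v * `|field (D2 c) x|)).
have nc : \forall h \near (0 : R), cyl (h *: v + x).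
  have cc : {for 0, continuous (fun h : R => h *: v + x)}.
    by move=> ?; apply: cvgD; [apply: cvgZr_tmp; exact: cvg_id|exact: cvg_cst].
  apply: cc; rewrite scale0r add0r.
  by apply: open_nbhs_nbhs; split=> //; exact: open_cyl.
near=> h.
have ch : cyl (h *: v + x) by near: h.
have h1 : `|h| <= 1 by near: h; exact: (@nbhs0_le _ R 1 ltr01).
have [y1 y2] := cyl_le ch.
have := T _ _ _ _ x1 y1 x2 y2.
have -> : (h *: v + x) 0 ord0 - x 0 ord0 = h * v 0 ord0.
  by rewrite !mxE addrK.
have -> : rad (h *: v + x) - rad x =
    h * (lam^-1 * (2 * rdot x v + h * rdot v v)).
  by rewrite /rad rdot_move; ring.
move=> Th.
rewrite /field.
set p1 := ps (D1 c) _ _ in Th *; set p2 := ps (D2 c) _ _ in Th *.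
set a := ps c _ _ in Th *; set b := ps c _ _ in Th *.
have -> : a - b - h * (v 0 ord0 * p1 + 2 / lam * rdot x v * p2) =
  (a - b - h * v 0 ord0 * p1 - h * (lam^-1 * (2 * rdot x v + h * rdot v v)) * p2)
   + h ^+ 2 * (lam^-1 * rdot v v * p2) by ring.
rewrite (le_trans (ler_normD _ _))// [leRHS]mulrDl lerD//.
  apply: (le_trans Th).
  have m0 : 0 <= m by rewrite addr_ge0// mulr_ge0// addr_ge0// mulr_ge0.
  have hm : `|h * v 0 ord0| + `|h * (lam^-1 * (2 * rdot x v + h * rdot v v))|
      <= m * `|h|.
    rewrite !normrM (ger0_norm il) /m [leRHS]mulrDl (mulrC `|h|) lerD//.
    rewrite (mulrC `|h|) ler_wpM2r// ler_wpM2l//.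
    rewrite (le_trans (ler_normD _ _))// !normrM (ger0_norm vv) ger0_norm//.
    by rewrite lerD// ler_piMl.
  rewrite -(real_normK (num_real h)) -mulrA ler_wpM2l// -exprMn.
  by rewrite lerXn2r// nnegrE ?addr_ge0// mulr_ge0.
rewrite normrM (ger0_norm (sqr_ge0 _)) mulrC ler_wpM2r ?sqr_ge0//.
by rewrite !normrM (ger0_norm il) (ger0_norm vv).
Unshelve. all: by end_near. Qed.

(** Directional derivatives do not yield continuity, so it is read off from the same two-variable
    Taylor estimate. *)
Lemma cvg_field c x : ps_ok c -> cyl x -> field c y @[y --> x] --> field c x.
Proof.
move=> cok cx; have [K K0 T] := ps_taylor cok.
have [x1 x2] := cyl_le cx.
pose g y := K * (`|y 0 ord0 - x 0 ord0| + `|rad y - rad x|) ^+ 2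
  + `|y 0 ord0 - x 0 ord0| * `|field (D1 c) x| +
    `|rad y - rad x| * `|field (D2 c) x|.
have c1 : (fun y : 'rV[R]_d.+1 => `|y 0 ord0 - x 0 ord0|) @ x --> `|x 0 ord0 - x 0 ord0|.
  exact: (cvg_norm (cvgB (@continuous_coord _ _ ord0 x) (cvg_cst _))).
have c2 : (fun y : 'rV[R]_d.+1 => `|rad y - rad x|) @ x --> `|rad x - rad x|.
  exact: (cvg_norm (cvgB (@continuous_rad x) (cvg_cst _))).
have cg : g @ x --> (0 : R).
  have F := nbhs_filter x.
  have c3 := @cvgD _ _ _ _ F _ _ _ _ c1 c2.
  have c4 := cvgMl_tmp (a := K) (FF := F) (@cvgM _ _ _ F _ _ _ _ c3 c3).
  have c5 := cvgMr_tmp (b := `|field (D1 c) x|) (FF := F) c1.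
  have c6 := cvgMr_tmp (b := `|field (D2 c) x|) (FF := F) c2.
  have := @cvgD _ _ _ _ F _ _ _ _ (@cvgD _ _ _ _ F _ _ _ _ c4 c5) c6.
  rewrite !subrr normr0 addr0 !mul0r mulr0 !addr0; exact.
apply/(@cvgrPdist_le _ _ _ (nbhs x) (nbhs_filter x)) => e e0; near=> y.
have cy : cyl y.
  by near: y; apply: open_nbhs_nbhs; split=> //; exact: open_cyl.
have [y1 y2] := cyl_le cy.
have gy : g y <= e by near: y; exact: (cvgr_le _ cg).
apply: le_trans gy; rewrite distrC.
have -> : field c y - field c x = (field c y - field c x
   - (y 0 ord0 - x 0 ord0) * field (D1 c) x - (rad y - rad x) * field (D2 c) x)
   + (y 0 ord0 - x 0 ord0) * field (D1 c) x + (rad y - rad x) * field (D2 c) x.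
  by ring.
rewrite (le_trans (ler_normD _ _))// /g -!normrM lerD//.
rewrite (le_trans (ler_normD _ _))// lerD//.
exact: T.
Unshelve. all: by end_near. Qed.

Lemma continuous_field c : ps_ok c -> {in cyl, continuous (field c)}.
Proof. by move=> cok x; rewrite inE; exact: cvg_field. Qed.

Lemma partial_field0 c x : ps_ok c -> cyl x ->
  partial ord0 (field c) x = field (D1 c) x.
Proof.
move=> cok cx; rewrite /partial.
have [_ ->] := is_derive_field (delta_mx 0 ord0) cok cx.
rewrite mxE !eqxx mul1r (_ : rdot _ _ = 0) ?mulr0 ?mul0r ?addr0//.
by apply: big1 => i _; rewrite mxE eqxx/= mulr0.
Qed.

Lemma partial_field_lift c x i : ps_ok c -> cyl x ->
  partial (lift ord0 i) (field c) x =
  2 * lam^-1 * x 0 (lift ord0 i) * field (D2 c) x.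
Proof.
move=> cok cx; rewrite /partial.
have [_ ->] := is_derive_field (delta_mx 0 (lift ord0 i)) cok cx.
rewrite mxE eqxx/= mul0r add0r (_ : rdot _ _ = x 0 (lift ord0 i))//.
rewrite /rdot (bigD1 i)//= mxE !eqxx mulr1 big1 ?addr0// => j ji.
by rewrite mxE eqxx/= (inj_eq lift_inj) (negbTE ji) mulr0.
Qed.

Lemma smooth_field c : ps_ok c -> smooth cyl (field c).
Proof.
move=> cok k; elim: k c cok => [|k IH] c cok; split=> //; try exact: continuous_field.
move=> i; split=> [x cx|].
  by have [] := is_derive_field (delta_mx 0 i) cok cx.
have oc := open_cyl.
case: (unliftP ord0 i) => [j|] ->.
  apply: (Ck_eq oc _ (CkM oc (CkM oc (Ck_cst k (2 * lam^-1) oc)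
    (Ck_coord k (lift ord0 j) oc)) (IH _ (ps_ok_D2 cok)))) => x cx.
  by rewrite partial_field_lift.
by apply: (Ck_eq oc _ (IH _ (ps_ok_D1 cok))) => x cx; rewrite partial_field0.
Qed.

(** With [s = |x'|^2 / lam], each transverse second derivative equals
    [(2 / lam) U_s + (4 x_i^2 / lam^2) U_ss], and the [x_i^2] add up to [lam s]. *)
Lemma laplacian_field c x : ps_ok c -> cyl x ->
  laplacian (field c) x = field (D1 (D1 c)) x +
   lam^-1 * (2 * d%:R * field (D2 c) x + 4 * rad x * field (D2 (D2 c)) x).
Proof.
move=> cok cx; have oc := open_cyl; rewrite /laplacian big_ord_recl; congr (_ + _).
  rewrite (partial_eq ord0 oc cx (g := field (D1 c))) ?partial_field0//.
    exact: ps_ok_D1.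
  by move=> y cy; rewrite partial_field0.
have H (i : 'I_d) : partial (lift ord0 i) (partial (lift ord0 i) (field c)) x =
    2 * lam^-1 * field (D2 c) x + 4 * lam^-1 ^+ 2 * field (D2 (D2 c)) x *
    (x 0 (lift ord0 i) * x 0 (lift ord0 i)).
  have h1 := is_derive_coord (lift ord0 i) x (delta_mx 0 (lift ord0 i)).
  have h2 := is_derive_field (delta_mx 0 (lift ord0 i)) (ps_ok_D2 cok) cx.
  have [h3 h3'] := h1; have [h4 _] := h2.
  have h5 := @derivableZ _ _ _ _ (2 * lam^-1) _ _ h4.
  rewrite (partial_eq _ oc cx (g := fun y => y 0 (lift ord0 i) *
     (2 * lam^-1 * field (D2 c) y))); last first.
    by move=> y cy; rewrite partial_field_lift//; ring.
  apply: (etrans (deriveM h3 h5)); rewrite (deriveZ _ h4).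
  have := partial_field_lift i (ps_ok_D2 cok) cx; rewrite /partial => ->.
  rewrite h3' mxE !eqxx /=.
  transitivity (x 0 (lift ord0 i) *
    (2 * lam^-1 * (2 * lam^-1 * x 0 (lift ord0 i) * field (D2 (D2 c)) x)) +
    2 * lam^-1 * field (D2 c) x * 1); last by ring.
  by [].
rewrite (eq_bigr _ (fun i _ => H i)) big_split/= sumr_const card_ord -mulr_natl.
by rewrite -mulr_sumr -/(rdot x x) /rad; ring.
Qed.

End AxialFields.

(** * Recursion along a rank and binomial identities *)

(** After more than [rank i] iterations the entry at [i] has stopped changing, so the diagonal of
    the iterates is a fixed point. This serves a coupled recursion that is not structural in any
    single index. *)
Lemma fixpoint_of_rank (I T : Type) (rank : I -> nat) (Phi : (I -> T) -> I -> T)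
    (X0 : I -> T) :
  (forall X Y i, (forall j, (rank j < rank i)%N -> X j = Y j) ->
     Phi X i = Phi Y i) ->
  exists X, forall i, X i = Phi X i.
Proof.
move=> H.
have stab n m i : (rank i < n)%N -> (rank i < m)%N ->
    iter n Phi X0 i = iter m Phi X0 i.
  elim: n m i => // n IH [//|m] i; rewrite !ltnS => h1 h2 /=.
  by apply: H => j ji; apply: IH; exact: leq_trans ji _.
exists (fun i => iter (rank i).+1 Phi X0 i) => i /=.
by apply: H => j ji; exact: (stab _ (rank j).+1).
Qed.

(** Coefficient of [x^j] in [(1-x)^-(p+1) (1-x)^-(q+1) = (1-x)^-(p+q+2)]. The value depends on
    [p + q] only, which is what makes the convolution of two majorants computable. *)
Lemma sum_bin_conv p q j :
  (\sum_(i < j.+1) 'C(i + p, i) * 'C(j - i + q, j - i) = 'C((j + p + q).+1, j))%N.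
Proof.
elim: p j => [|p IHp].
  elim=> [|j IHj]; first by rewrite big_ord1 !bin0.
  rewrite big_ord_recl/= bin0 mul1n subn0 addn0 addSn.
  rewrite (eq_bigr (fun i : 'I_j.+1 => 'C(i + 0, i) * 'C(j - i + q, j - i)))%N.
    by rewrite IHj addn0 [RHS]binS.
  by move=> i _; rewrite /bump leq0n add1n !addn0 !binn subSS.
elim=> [|j IHj]; first by rewrite big_ord1 !bin0.
rewrite big_ord_recl/= bin0 mul1n subn0.
rewrite (eq_bigr (fun i : 'I_j.+1 => 'C(i.+1 + p, i.+1) * 'C(j - i + q, j - i)
    + 'C(i + p.+1, i) * 'C(j - i + q, j - i)))%N; last first.
  move=> i _; rewrite /bump leq0n add1n subSS -mulnDl; congr (_ * _)%N.
  by rewrite addSn binS addSnnS.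
rewrite big_split/= IHj addnA.
have := IHp j.+1; rewrite big_ord_recl/= bin0 mul1n subn0.
under eq_bigr do rewrite /bump leq0n add1n subSS.
move=> ->; have -> : (j + p.+1 + q).+1 = (j.+1 + p + q).+1 by rewrite addnS addSn.
have -> : (j.+1 + p.+1 + q).+1 = (j.+1 + p + q).+2 by rewrite addnS addSn.
exact/esym/binS.
Qed.

(** The right-hand side is shared with [bin_diag2]. For a power series in [t + r] this lemma
    computes the second derivative in [r] and [bin_diag2] the one in [t], both at [t^j r^(2k)]. *)
Lemma bin_down2 (j k : nat) :
  ((k.*2).+2 * (k.*2).+1 * 'C((j + k.*2).+2, j) =
    (j + k.*2).+2 * (j + k.*2).+1 * 'C(j + k.*2, j))%N.
Proof.
have h1 := mul_bin_down (j + k.*2).+2 j.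
have h2 := mul_bin_down (j + k.*2).+1 j.
have e1 : ((j + k.*2).+2 - j = (k.*2).+2)%N by rewrite -!addnS addKn.
have e2 : ((j + k.*2).+1 - j = (k.*2).+1)%N by rewrite -addnS addKn.
rewrite e1 /= in h1; rewrite e2 /= in h2.
by rewrite mulnAC -h1 -mulnA (mulnC 'C(_, _)) -h2 mulnA.
Qed.

Lemma bin_diag2 (j k : nat) :
  (j.+2 * j.+1 * 'C((j + k.*2).+2, j.+2) =
    (j + k.*2).+2 * (j + k.*2).+1 * 'C(j + k.*2, j))%N.
Proof.
have h1 := mul_bin_diag (j + k.*2).+2 j.+1.
have h2 := mul_bin_diag (j + k.*2).+1 j.
rewrite /= in h1 h2.
by rewrite mulnAC -h1 -mulnA (mulnC 'C(_, _)) -h2 mulnA.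
Qed.

Lemma bin_down_le (j k : nat) :
  (k.+1 * 'C((j + k.*2).+1, j) <= (j + k.*2).+1 * 'C(j + k.*2, j))%N.
Proof.
have := mul_bin_down (j + k.*2).+1 j; rewrite /= -addnS addKn addnS => ->.
by rewrite leq_mul2r ltnS -addnn leq_addr orbT.
Qed.

Lemma bin_le_exp2 n j : ('C(n, j) <= 2 ^ n)%N.
Proof.
elim: n j => [|n IH] [|j]; rewrite ?bin0 ?expn_gt0//.
by rewrite binS expnS mul2n -addnn leq_add.
Qed.

(** * The formal solution and its majorant *)

Section Coefficients.
Context {R : realType}.
Implicit Types (c e : nat -> nat -> R).

Definition Wt c j k : R := (j + k.*2)%:R * c j k.

(* The equation [lam c_tt + 4 s c_ss + 2 d c_s = 2 d e] together with
   [e = exp (mu c)], encoded as [W e = mu e W c] for the Euler field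
   [W = t d/dt + 2 s d/ds]. *)
Definition solves_recurrences (d : nat) (lam mu e0 : R) (b : nat -> R) c e :=
  [/\ forall j, c j 0%N = b j,
      forall j k, lam * (j.+2%:R * j.+1%:R) * c j.+2 k +
        k.+1%:R * (4 * k%:R + 2 * d%:R) * c j k.+1 = 2 * d%:R * e j k,
      e 0%N 0%N = e0 &
      forall j k, Wt e j k = mu * conv2 (Wt c) e j k].

Lemma recurrences_solvable (d : nat) (lam mu e0 : R) (b : nat -> R) : (0 < d)%N ->
  exists c e, solves_recurrences d lam mu e0 b c e.
Proof.
move=> d0.
(* [c j k.+1] requires [c j.+2 k], so [k] must weigh more than twice [j]. *)
pose rank (i : bool * (nat * nat)) : nat :=
  ((i.2.1 + 3 * i.2.2).*2 + (~~ i.1))%N.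
(* The tag [true] stands for [c] and [false] for [e]; at equal indices [e] ranks just above [c],
   since [e j k] involves [c j k]. *)
pose Phi (X : bool * (nat * nat) -> R) (i : bool * (nat * nat)) : R :=
  let j := i.2.1 in let k := i.2.2 in
  if i.1 then
    if k is k'.+1 then
      (2 * d%:R * X (false, (j, k')) -
         lam * (j.+2%:R * j.+1%:R) * X (true, (j.+2, k'))) /
      (k'.+1%:R * (4 * k'%:R + 2 * d%:R))
    else b j
  else if (j + k.*2 == 0)%N then e0 else
    (j + k.*2)%:R^-1 * (mu *
      conv2 (fun i m => (i + m.*2)%:R * X (true, (i, m)))
            (fun i m => X (false, (i, m))) j k).
have [|X HX] := @fixpoint_of_rank _ R rank Phi (fun=> 0).
  move=> X Y [[] [j [|k]]] H; rewrite /Phi//=.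
  - by rewrite !H// /rank/=; lia.
  - case: ifPn => // jk0; congr (_ * (_ * _)); apply: eq_bigr => i _.
    (* The term [i = m = 0] is the only one in which [e j k] itself occurs on the right, and its
       Euler weight is 0. *)
    apply: eq_bigr => m _; have [im0|im0] := eqVneq (i + m.*2)%N 0%N.
      by rewrite im0 !mul0r.
    have i1 := ltn_ord i; have m1 := ltn_ord m.
    by rewrite !H// /rank/=; lia.
  - case: ifPn => // jk0; congr (_ * (_ * _)); apply: eq_bigr => i _.
    apply: eq_bigr => m _; have [im0|im0] := eqVneq (i + m.*2)%N 0%N.
      by rewrite im0 !mul0r.
    have i1 := ltn_ord i; have m1 := ltn_ord m.
    by rewrite !H// /rank/=; lia.
exists (fun j k => X (true, (j, k))), (fun j k => X (false, (j, k))); split.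
- by move=> j; rewrite HX.
- move=> j k; rewrite [X (true, (j, k.+1))]HX /Phi/=.
  have K0 : k.+1%:R * (4 * k%:R + 2 * d%:R) != 0 :> R.
    rewrite mulf_neq0 ?pnatr_eq0// -!natrM -natrD pnatr_eq0.
    by rewrite addn_eq0 !muln_eq0/= negb_and orbC -lt0n d0.
  by rewrite [X in _ + X]mulrC (divfK K0); ring.
- by rewrite HX.
- move=> j k; rewrite /Wt [X (false, (j, k))]HX /Phi/=.
  have [jk0|jk0] := eqVneq (j + k.*2)%N 0%N; last first.
    by rewrite mulrA mulfV ?mul1r// pnatr_eq0.
  rewrite jk0 mul0r.
  have -> : j = 0%N by lia.
  have -> : k = 0%N by lia.
  by rewrite /conv2 !big_ord1 !mul0r mulr0.
Qed.

(* The coefficient of [t^j s^k] in the part of [1 / (1 - gam (t + r))] even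
   in [r], where [s = r^2]. *)
Definition majorant (gam : R) j k : R := 'C(j + k.*2, j)%:R * gam ^+ (j + k.*2).

Lemma majorant_ge0 gam j k : 0 <= gam -> 0 <= majorant gam j k.
Proof. by move=> g0; rewrite mulr_ge0 ?exprn_ge0. Qed.

(** Put [n = j + 2k]. By [sum_bin_conv] the sum over [i] is ['C(n.+1, j)] for each of the [k + 1]
    values of [m], and [bin_down_le] trades [k + 1] for [n + 1]. That factor is later cancelled
    against the Euler weight [n]. The bound on [e] is required only below [(j, k)], ready for an
    induction. *)
Lemma conv2_majorant c e (M gam : R) j k : 0 <= M -> 0 <= gam ->
  (forall i m, (m <= k)%N -> `|Wt c i m| <= M * majorant gam i m) ->
  (forall i m, (m <= k)%N -> (i + m < j + k)%N ->
     `|e i m| <= 2 * majorant gam i m) ->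
  `|conv2 (Wt c) e j k| <= 2 * M * (j + k.*2).+1%:R * majorant gam j k.
Proof.
move=> M0 g0 cM eM.
pose T i m : nat := ('C(i + m.*2, i) * 'C(j - i + (k - m).*2, j - i))%N.
pose n := (j + k.*2)%N.
have H (i : 'I_j.+1) (m : 'I_k.+1) : `|Wt c i m * e (j - i)%N (k - m)%N| <=
    2 * M * gam ^+ n * (T i m)%:R.
  have i1 := ltn_ord i; have m1 := ltn_ord m.
  have [im0|im0] := eqVneq (i + m.*2)%N 0%N.
    by rewrite {1}/Wt im0 !mul0r normr0 !mulr_ge0// exprn_ge0.
  rewrite normrM.
  have -> : 2 * M * gam ^+ n * (T i m)%:R =
    (M * majorant gam i m) * (2 * majorant gam (j - i) (k - m)).
    rewrite /majorant /T natrM.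
    have -> : n = ((i + m.*2) + (j - i + (k - m).*2))%N by rewrite /n; lia.
    by rewrite exprD; ring.
  apply: ler_pM => //; first by apply: cM; lia.
  by apply: eM; lia.
rewrite /conv2 (le_trans (ler_norm_sum _ _ _))//.
apply: (@le_trans _ _ (\sum_(i < j.+1) \sum_(m < k.+1)
    2 * M * gam ^+ n * (T i m)%:R)).
  by apply: ler_sum => i _; rewrite (le_trans (ler_norm_sum _ _ _))// ler_sum.
under eq_bigr do rewrite -mulr_sumr.
rewrite -mulr_sumr exchange_big/=.
have HT (m : 'I_k.+1) : \sum_(i < j.+1) (T i m)%:R = 'C(n.+1, j)%:R :> R.
  rewrite -natr_sum sum_bin_conv; congr ('C(_, _)%:R).
  by have m1 := ltn_ord m; rewrite /n; lia.
rewrite (eq_bigr _ (fun m _ => HT m)) sumr_const card_ord.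
rewrite -[X in _ * X]mulr_natl -natrM /majorant -/n.
have -> : 2 * M * n.+1%:R * ('C(n, j)%:R * gam ^+ n) =
  2 * M * gam ^+ n * (n.+1 * 'C(n, j))%:R by rewrite natrM; ring.
rewrite ler_wpM2l ?mulr_ge0 ?exprn_ge0// ler_nat.
exact: bin_down_le.
Qed.

Section Bounds.
Variables (d : nat) (lam mu e0 gam M : R) (b : nat -> R).
Variables (c e : nat -> nat -> R).
Hypotheses (d0 : (0 < d)%N) (gam0 : 0 < gam) (lam0 : 0 < lam <= 2^-1).
Hypotheses (mu0 : 0 <= mu) (muM : 2 * mu * M <= 1) (e02 : `|e0| <= 2).
Hypothesis (dM : 8 * d%:R <= M * gam ^+ 2).
Hypothesis (bM : forall j, `|j%:R * b j| <= M * gam ^+ j).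
Hypothesis sol : solves_recurrences d lam mu e0 b c e.

Let g0 : 0 <= gam. Proof. exact: ltW. Qed.

Let M0 : 0 <= M.
Proof.
have g2 : 0 < gam ^+ 2 by rewrite exprn_gt0.
by rewrite -(pmulr_lge0 _ g2) (le_trans _ dM)// mulr_ge0.
Qed.

(** In [W e = mu e W c], dividing by the weight [n >= 1] turns [2 (n + 1) / n] into at most 4. The
    resulting [4 * mu * M] is small with [mu], and [2 * mu * M <= 1] brings it below 2, which closes
    the induction on [i + m]. *)
Lemma exp_coef_bound_of k :
  (forall i m, (m <= k)%N -> `|Wt c i m| <= M * majorant gam i m) ->
  (forall i m, (m <= k)%N -> `|e i m| <= 2 * majorant gam i m)
  /\ (forall i m, (m <= k)%N -> (0 < i + m)%N ->
     `|e i m| <= 4 * mu * M * majorant gam i m).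
Proof.
move=> cM; have [_ _ e00 eW] := sol.
have step j m : (m <= k)%N -> (0 < j + m)%N ->
    (forall i l, (l <= m)%N -> (i + l < j + m)%N -> `|e i l| <= 2 * majorant gam i l) ->
    `|e j m| <= 4 * mu * M * majorant gam j m.
  move=> mk jm0 IH.
  have n1 : (0 < j + m.*2)%N by rewrite addn_gt0 double_gt0 -addn_gt0.
  have n0 : 0 < (j + m.*2)%:R :> R by rewrite ltr0n.
  have := @conv2_majorant c e M gam j m M0 g0 _ IH.
  move=> /(_ (fun i l lm => cM i l (leq_trans lm mk))) Hc.
  have h : (j + m.*2)%:R * `|e j m| <=
     mu * (2 * M * (j + m.*2).+1%:R * majorant gam j m).
    rewrite -[X in X * _]ger0_norm// -normrM -/(Wt e j m) eW normrM ger0_norm//.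
    by rewrite ler_wpM2l.
  rewrite -(ler_pM2l n0) (le_trans h)//.
  have -> : (j + m.*2)%:R * (4 * mu * M * majorant gam j m) =
    mu * M * majorant gam j m * ((j + m.*2)%:R * 4) by ring.
  have -> : mu * (2 * M * (j + m.*2).+1%:R * majorant gam j m) =
    mu * M * majorant gam j m * ((j + m.*2).+1%:R * 2) by ring.
  have z0 : 0 <= mu * M * majorant gam j m.
    by apply: mulr_ge0; [exact: mulr_ge0|exact: majorant_ge0].
  rewrite ler_wpM2l// -natr1.
  have : 1 <= (j + m.*2)%:R :> R by rewrite ler1n.
  lra.
have main n : forall j m, (m <= k)%N -> (j + m <= n)%N ->
    `|e j m| <= 2 * majorant gam j m.
  elim: n => [|n IH] j m mk jm.
    move: jm; rewrite leqn0 addn_eq0 => /andP[/eqP-> /eqP->].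
    by rewrite e00 /majorant bin0 expr0 !mulr1.
  have [jm0|jm0] := posnP (j + m)%N; first by apply: IH => //; rewrite jm0.
  have := step j m mk jm0; move/(_ _)/le_trans; apply.
    move=> i l lm il; apply: IH; first exact: leq_trans lm mk.
    by rewrite -ltnS (leq_trans il jm).
  rewrite ler_wpM2r ?majorant_ge0//.
  by have := muM; lra.
split.
  by move=> i m mk; exact: (main _ i m mk (leqnn _)).
move=> i m mk im0; apply: step => // i' l lm il.
by apply: (main (i' + l)%N) => //; exact: leq_trans lm mk.
Qed.

(** As [d >= 1], the multiplier [(k+1)(4k+2d)] is at least [(2k+2)(2k+1)], that of the second
    derivative in [r]; [bin_down2] and [bin_diag2] then compare the two majorants. The source
    [2 d e] uses up one half of the bound by [8 * d <= M * gam ^+ 2], the term in [lam] the other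
    half by [lam <= 1/2]. *)
Lemma coef_step j k :
  (`|Wt c j.+2 k| <= M * majorant gam j.+2 k) ->
  `|e j k| <= 2 * majorant gam j k ->
  `|Wt c j k.+1| <= M * majorant gam j k.+1.
Proof.
move=> cM eM; have [_ cR _ _] := sol.
have /andP[l0 l2] := lam0.
set n := (j + k.*2)%N.
have e1 : (j.+2 + k.*2 = n.+2)%N by rewrite !addSn.
have e2 : (j + k.+1.*2 = n.+2)%N by rewrite doubleS !addnS.
move: cM eM; rewrite /Wt /majorant e1 e2 -/n !normrM normr_nat.
set X := `|c j k.+1|; set Y := `|c j.+2 k|; set E := `|e j k|.
set B := 'C(n, j)%:R; set B1 := 'C(n.+2, j)%:R; set B2 := 'C(n.+2, j.+2)%:R.
set g := gam ^+ n => cM eM.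
have gE : gam ^+ n.+2 = g * gam ^+ 2 by rewrite -addn2 exprD.
rewrite gE in cM *.
set a : R := k%:R; set p : R := j.+2%:R * j.+1%:R.
have a0 : 0 <= a by rewrite /a.
have p0 : 0 <= p by rewrite /p.
have X0 : 0 <= X by rewrite /X.
have Y0 : 0 <= Y by rewrite /Y.
have E0 : 0 <= E by rewrite /E.
have B0 : 0 <= B by rewrite /B.
have gg : 0 <= g by rewrite exprn_ge0.
have kS : k.+1%:R = a + 1 by rewrite -natr1.
have d1 : 1 <= d%:R :> R by rewrite ler1n.
have hX : (2 * a + 2) * (2 * a + 1) * X <= 2 * d%:R * E + lam * p * Y.
  have h : (a + 1) * (4 * a + 2 * d%:R) * X <= 2 * d%:R * E + lam * p * Y.
    have -> : (a + 1) * (4 * a + 2 * d%:R) * X =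
        `|(a + 1) * (4 * a + 2 * d%:R) * c j k.+1|.
      by rewrite normrM ger0_norm// mulr_ge0 ?addr_ge0 ?mulr_ge0.
    have := cR j k; rewrite kS -/a -/p => cRj.
    have -> : (a + 1) * (4 * a + 2 * d%:R) * c j k.+1 =
      2 * d%:R * e j k - lam * p * c j.+2 k by rewrite -cRj; ring.
    rewrite (le_trans (ler_normB _ _))// !normrM -/E -/Y.
    by rewrite normr_nat !ger0_norm// ltW.
  apply: le_trans h; rewrite ler_wpM2r//.
  rewrite -subr_ge0.
  have -> : (a + 1) * (4 * a + 2 * d%:R) - (2 * a + 2) * (2 * a + 1) =
    2 * (a + 1) * (d%:R - 1) by ring.
  apply: mulr_ge0; last by rewrite subr_ge0.
  by apply: mulr_ge0 => //; apply: addr_ge0.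
have hB1 : (2 * a + 2) * (2 * a + 1) * B1 = (n.+2)%:R * (n.+1)%:R * B.
  have := congr1 (fun m => m%:R : R) (bin_down2 j k).
  rewrite !natrM -/n -/B -/B1 => <-; congr (_ * _ * _).
    by rewrite -[(k.*2).+2]addn2 -muln2 natrD natrM /a; ring.
  by rewrite -[(k.*2).+1]addn1 -muln2 natrD natrM /a; ring.
have hB2 : p * B2 = (n.+2)%:R * (n.+1)%:R * B.
  by have := congr1 (fun m => m%:R : R) (bin_diag2 j k); rewrite !natrM.
set N2 : R := n.+2%:R in cM hB1 hB2 *; set N1 : R := n.+1%:R in hB1 hB2.
have N10 : 1 <= N1 by rewrite /N1 ler1n.
have N20 : 0 <= N2 by rewrite /N2.
have q0 : 0 < (2 * a + 2) * (2 * a + 1) by apply: mulr_gt0; lra.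
rewrite -(ler_pM2l q0).
have -> : (2 * a + 2) * (2 * a + 1) * (M * (B1 * (g * gam ^+ 2))) =
  N2 * N1 * B * (M * (g * gam ^+ 2)) by rewrite -hB1; ring.
apply: (@le_trans _ _ (N2 * (2 * d%:R * E + lam * p * Y))).
  have -> : (2 * a + 2) * (2 * a + 1) * (N2 * X) =
    N2 * ((2 * a + 2) * (2 * a + 1) * X) by ring.
  by rewrite ler_wpM2l.
have -> : N2 * (2 * d%:R * E + lam * p * Y) =
   N2 * (2 * d%:R) * E + lam * p * (N2 * Y) by ring.
have h1 : N2 * (2 * d%:R) * E <= N2 * (2 * d%:R) * (2 * (B * g)).
  by rewrite ler_wpM2l ?mulr_ge0.
have h2 : lam * p * (N2 * Y) <= lam * p * (M * (B2 * (g * gam ^+ 2))).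
  by rewrite ler_wpM2l// mulr_ge0// ltW.
apply: (le_trans (lerD h1 h2)).
have -> : lam * p * (M * (B2 * (g * gam ^+ 2))) =
   lam * (p * B2) * (M * (g * gam ^+ 2)) by ring.
rewrite hB2.
have k1 : N2 * (2 * d%:R) * (2 * (B * g)) <= 2^-1 * (N2 * B * g * (M * gam ^+ 2)).
  have -> : N2 * (2 * d%:R) * (2 * (B * g)) = 2^-1 * (N2 * B * g * (8 * d%:R)) by field.
  by rewrite ler_pM2l// ler_wpM2l// !mulr_ge0.
have k2 : N2 * B * g * (M * gam ^+ 2) <= N1 * (N2 * B * g * (M * gam ^+ 2)).
  by rewrite ler_peMl// !mulr_ge0// exprn_ge0.
have k3 : lam * (N2 * N1 * B) * (M * (g * gam ^+ 2)) <=
  2^-1 * (N1 * (N2 * B * g * (M * gam ^+ 2))).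
  have -> : lam * (N2 * N1 * B) * (M * (g * gam ^+ 2)) =
   lam * (N1 * (N2 * B * g * (M * gam ^+ 2))) by ring.
  by rewrite ler_wpM2r// !mulr_ge0// ?exprn_ge0//; lra.
have -> : N2 * N1 * B * (M * (g * gam ^+ 2)) = N1 * (N2 * B * g * (M * gam ^+ 2)) by ring.
move: k1 k2 k3; set Z := N1 * _; set Z2 := N2 * B * g * _; lra.
Qed.

Lemma coef_bound j k : `|Wt c j k| <= M * majorant gam j k.
Proof.
have [c0 _ _ _] := sol.
suff H n : forall i m, (m <= n)%N -> `|Wt c i m| <= M * majorant gam i m.
  exact: (H k).
elim: n => [|n IH] i m mn.
  move: mn; rewrite leqn0 => /eqP->.
  by rewrite /Wt /majorant c0 addn0 binn mul1r; exact: bM.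
have [mn'|mn'] := leqP m n; first exact: IH.
have -> : m = n.+1 by apply/eqP; rewrite eqn_leq mn mn'.
apply: coef_step; first exact: IH.
by have [H _] := exp_coef_bound_of IH; exact: H.
Qed.

Lemma exp_coef_bound j k : `|e j k| <= 2 * majorant gam j k.
Proof.
have [H _] := @exp_coef_bound_of k (fun i m _ => coef_bound i m).
exact: H.
Qed.

Lemma exp_coef_small j k : (0 < j + k)%N ->
  `|e j k| <= 4 * mu * M * majorant gam j k.
Proof.
have [_ H] := @exp_coef_bound_of k (fun i m _ => coef_bound i m).
exact: H.
Qed.

End Bounds.

End Coefficients.

(** * The exponential of a power series *)

Section ExponentialIdentity.
Context {R : realType}.
Implicit Types (c e : nat -> nat -> R) (t s r : R).

Lemma gsum_finite (a : nat -> R) n : (forall i, (n <= i)%N -> a i = 0) ->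
  gsum a = series a n.
Proof.
move=> an; apply: gsum_uniq; apply: cvg_near_cst.
near=> m; have nm : (n <= m)%N by near: m; exact: nbhs_infty_ge.
rewrite /series/= (big_cat_nat (leq0n n) nm)/= [X in _ + X]big_nat_cond.
by rewrite [X in _ + X]big1 ?addr0// => i /andP[/andP[ni _] _]; exact: an.
Unshelve. all: by end_near. Qed.

Lemma ps_at0 c : ps c 0 0 = c 0%N 0%N.
Proof.
rewrite /ps /dsum (@gsum_finite _ 1%N); last first.
  move=> i i0; rewrite (@gsum_finite _ 0%N) ?/series/= ?big_geq// => k _.
  by rewrite /mono expr0n gtn_eqF// mulr0 mul0r.
rewrite /series/= big_nat1 (@gsum_finite _ 1%N); last first.
  by move=> k k0; rewrite /mono (expr0n _ k) gtn_eqF// mulr0.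
by rewrite /series/= big_nat1 /mono !expr0 !mulr1.
Qed.

(* The curve [r |-> (r t, r^2 s)] carries the Euler field of weights 1 and 2. *)
Lemma is_derive_ps_curve c t s r : ps_ok c -> `|t| < 2 -> `|s| < 2 ->
  0 <= r <= 1 ->
  is_derive r 1 (fun r => ps c (r * t) (r ^+ 2 * s))
    (t * ps (D1 c) (r * t) (r ^+ 2 * s) +
     2 * r * s * ps (D2 c) (r * t) (r ^+ 2 * s)).
Proof.
move=> cok t2 s2 /andP[r0 r1]; have [K K0 T] := ps_taylor cok.
set F1 := ps (D1 c) _ _; set F2 := ps (D2 c) _ _.
have rt : `|r * t| < 2.
  by rewrite normrM ger0_norm// (le_lt_trans _ t2)// ler_piMl.
have rs : `|r ^+ 2 * s| < 2.
  rewrite normrM ger0_norm ?sqr_ge0// (le_lt_trans _ s2)// ler_piMl//.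
  exact: exprn_ile1.
apply: (@is_derive_quadratic _ _ _ _ _ _
  (K * (`|t| + 3 * `|s|) ^+ 2 + `|s * F2|)).
have c1 : (h + r) * t @[h --> (0 : R)] --> (0 + r) * t.
  by apply: cvgMr_tmp; apply: cvgD; [exact: cvg_id|exact: cvg_cst].
have c2 : (h + r) ^+ 2 * s @[h --> (0 : R)] --> (0 + r) ^+ 2 * s.
  apply: cvgMr_tmp; rewrite expr2.
  under eq_fun do rewrite expr2.
  by apply: cvgM; (apply: cvgD; [exact: cvg_id|exact: cvg_cst]).
have n1 : \forall h \near (0 : R), `|(h + r) * t| < 2.
  by apply: (cvgr_lt _ (cvg_norm c1)); rewrite add0r.
have n2 : \forall h \near (0 : R), `|(h + r) ^+ 2 * s| < 2.
  by apply: (cvgr_lt _ (cvg_norm c2)); rewrite add0r.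
near=> h.
have h1 : `|h| <= 1 by near: h; exact: (@nbhs0_le _ R 1 ltr01).
have m1 : `|(h + r) * t| < 2 by near: h.
have m2 : `|(h + r) ^+ 2 * s| < 2 by near: h.
rewrite [h *: 1]mulr1.
have := T _ _ _ _ (ltW rt) (ltW m1) (ltW rs) (ltW m2).
rewrite -/F1 -/F2.
have -> : (h + r) * t - r * t = h * t by ring.
have -> : (h + r) ^+ 2 * s - r ^+ 2 * s = h * ((h + 2 * r) * s) by ring.
set a := ps c _ _; set b := ps c _ _ => Th.
have -> : a - b - h * (t * F1 + 2 * r * s * F2) =
  (a - b - h * t * F1 - h * ((h + 2 * r) * s) * F2) + h ^+ 2 * (s * F2) by ring.
rewrite (le_trans (ler_normD _ _))// [leRHS]mulrDl lerD//.
  apply: (le_trans Th).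
  rewrite -(real_normK (num_real h)) -mulrA ler_wpM2l// -exprMn.
  have hs : `|h * t| + `|h * ((h + 2 * r) * s)| <= (`|t| + 3 * `|s|) * `|h|.
    rewrite !normrM [leRHS]mulrDl (mulrC `|h|) lerD// (mulrC `|h|) ler_wpM2r//.
    rewrite ler_wpM2r// (le_trans (ler_normD _ _))// normrM normr_nat (ger0_norm r0).
    by have := h1; lra.
  by rewrite lerXn2r// nnegrE ?addr_ge0// !mulr_ge0// addr_ge0// mulr_ge0.
by rewrite normrM (ger0_norm (sqr_ge0 _)) mulrC.
Unshelve. all: by end_near. Qed.

Lemma ps_Wt c t s : ps_ok c -> `|t| <= 2 -> `|s| <= 2 ->
  ps (Wt c) t s = t * ps (D1 c) t s + 2 * (s * ps (D2 c) t s).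
Proof.
move=> cok t2 s2.
rewrite -(ps_W1 cok t2 s2) -(ps_W2 cok t2 s2).
rewrite -(psZ 2 (ps_ok_W2 cok) t2 s2).
rewrite -(psD (ps_ok_W1 cok) (ps_okZ 2 (ps_ok_W2 cok)) t2 s2).
congr (ps _ t s); apply/funext => j; apply/funext => k.
by rewrite /Wt /W1 /W2 -muln2 natrD natrM; ring.
Qed.

Lemma ps_okD c c' : ps_ok c -> ps_ok c' -> ps_ok (fun j k => c j k + c' j k).
Proof.
move=> [M [q [q01 cM]]] [M' [q' [q01' cM']]].
have qr : 0 < q <= Num.max q q' by rewrite (andP q01).1 le_max lexx.
have qr' : 0 < q' <= Num.max q q' by rewrite (andP q01').1 le_max lexx orbT.
exists (M + M'), (Num.max q q'); split; first by case: (leP q q').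
have b1 := bounded2_le qr cM; have b2 := bounded2_le qr' cM'.
move=> j k; rewrite (le_trans (ler_normD _ _))// -mulrA mulrDl.
by apply: lerD; rewrite mulrA; [exact: b1|exact: b2].
Qed.

Lemma ps_ok_Wt c : ps_ok c -> ps_ok (Wt c).
Proof.
move=> cok; have -> : Wt c = fun j k => W1 c j k + 2 * W2 c j k.
  apply/funext => j; apply/funext => k.
  by rewrite /Wt /W1 /W2 -muln2 natrD natrM; ring.
exact: (ps_okD (ps_ok_W1 cok) (ps_okZ 2 (ps_ok_W2 cok))).
Qed.

Lemma ps_ok_conv2 c e : ps_ok c -> ps_ok e -> ps_ok (conv2 c e).
Proof.
move=> [A [q [q01 cA]]] [B [q' [q01' eB]]].
pose m := Num.max q q'.
have m01 : 0 < m < 2^-1 by rewrite /m; case: (leP q q').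
have qm : 0 < q <= m by rewrite (andP q01).1 /m le_max lexx.
have qm' : 0 < q' <= m by rewrite (andP q01').1 /m le_max lexx orbT.
have b1 := bounded2_le qm cA; have b2 := bounded2_le qm' eB.
have A0 := bounded2_ge0 cA; have B0 := bounded2_ge0 eB.
have /andP[m0 m2] := m01.
pose r := (m + 2^-1) / 2.
have mr : 0 < m < r by rewrite m0 /r; lra.
have r01 : 0 < r < 2^-1 by rewrite /r; lra.
have r0 : 0 <= r by rewrite ltW// (andP r01).1.
pose C := r / (r - m).
have C0 : 0 <= C by rewrite divr_ge0// subr_ge0 ltW// (andP mr).2.
exists (A * B * C * C), r; split=> // j k.
rewrite /conv2 (le_trans (ler_norm_sum _ _ _))//.
apply: (@le_trans _ _ (\sum_(i < j.+1) (A * m ^+ i * (B * m ^+ (j - i)) *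
    C * r ^+ k))).
  apply: ler_sum => i _.
  exact: (conv_bounded mr (bounded2_inner i b1) (bounded2_inner (j - i) b2) k).
rewrite (eq_bigr (fun=> A * B * C * r ^+ k * m ^+ j)); last first.
  move=> i _; have ij : (i <= j)%N by rewrite -ltnS.
  by rewrite -[in RHS](subnKC ij) exprD; ring.
rewrite sumr_const card_ord -mulr_natl.
have -> : j.+1%:R * (A * B * C * r ^+ k * m ^+ j) =
  A * B * C * r ^+ k * (j.+1%:R * m ^+ j) by ring.
have -> : A * B * C * C * r ^+ j * r ^+ k = A * B * C * r ^+ k * (C * r ^+ j) by ring.
rewrite ler_wpM2l//; last exact: succ_geom_le.
by apply: mulr_ge0; [apply: mulr_ge0 => //; exact: mulr_ge0|exact: exprn_ge0].
Qed.

(** Along the weighted curve, [r d/dr] is the Euler field, so the recurrence reads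
    [r f' = mu r g' f]. Hence [f * exp (- mu * g)] has zero derivative for [0 < r < 1], where [r]
    can be cancelled, and the mean value theorem equates its values at 0 and 1. *)
Lemma ps_exp (mu : R) c e t s : ps_ok c -> ps_ok e ->
  (forall j k, Wt e j k = mu * conv2 (Wt c) e j k) ->
  e 0%N 0%N = expR (mu * c 0%N 0%N) -> `|t| < 2 -> `|s| < 2 ->
  ps e t s = expR (mu * ps c t s).
Proof.
move=> cok eok eW e0 t2 s2.
pose f r := ps e (r * t) (r ^+ 2 * s).
pose g r := ps c (r * t) (r ^+ 2 * s).
pose df r := t * ps (D1 e) (r * t) (r ^+ 2 * s) +
     2 * r * s * ps (D2 e) (r * t) (r ^+ 2 * s).
pose dg r := t * ps (D1 c) (r * t) (r ^+ 2 * s) +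
     2 * r * s * ps (D2 c) (r * t) (r ^+ 2 * s).
pose P := f * (expR \o (fun r => - mu * g r)).
pose dP r := f r * (expR (- mu * g r) * (- mu * dg r)) +
  expR (- mu * g r) * df r.
have dPE r : 0 <= r <= 1 -> is_derive r 1 P (dP r).
  move=> r01.
  have h1 : is_derive r 1 f (df r) by exact: is_derive_ps_curve.
  have h2 : is_derive r 1 g (dg r) by exact: is_derive_ps_curve.
  have h3 : is_derive r 1 (fun r => - mu * g r) (- mu * dg r).
    exact: (is_deriveZ (- mu) h2).
  have h4 := @is_derive1_comp R expR (fun r => - mu * g r) r _ _ (is_derive_expR (- mu * g r)) h3.
  exact: (is_deriveM h1 h4).
have ode r : 0 <= r <= 1 -> r * df r = mu * (r * dg r) * f r.
  move=> /andP[r0 r1].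
  have rt : `|r * t| <= 2.
    by rewrite normrM ger0_norm// (le_trans _ (ltW t2))// ler_piMl.
  have rs : `|r ^+ 2 * s| <= 2.
    rewrite normrM ger0_norm ?sqr_ge0// (le_trans _ (ltW s2))// ler_piMl//.
    exact: exprn_ile1.
  have -> : r * df r = ps (Wt e) (r * t) (r ^+ 2 * s).
    by rewrite ps_Wt// /df; ring.
  have -> : r * dg r = ps (Wt c) (r * t) (r ^+ 2 * s).
    by rewrite ps_Wt// /dg; ring.
  rewrite -mulrA -(ps_conv2 (ps_ok_Wt cok) eok rt rs).
  have -> : Wt e = fun j k => mu * conv2 (Wt c) e j k.
    by apply/funext => j; apply/funext => k.
  rewrite psZ//.
  exact: ps_ok_conv2 (ps_ok_Wt cok) eok.
have cP : {within `[0, 1], continuous P}.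
  apply: derivable_within_continuous => r; rewrite in_itv/= => r01.
  by have [] := dPE r r01.
have [z z01] := @MVT _ P dP 0 1 ltr01 (fun r r01 => dPE r (ltac:(by move: r01; rewrite in_itv/= => /andP[/ltW-> /ltW->]))) cP.
have z01' : 0 <= z <= 1 by move: z01; rewrite in_itv/= => /andP[/ltW-> /ltW->].
have z0 : z != 0 by move: z01; rewrite in_itv/= => /andP[/gt_eqF->].
have -> : dP z = 0.
  apply: (mulfI z0); rewrite mulr0 /dP.
  have -> : z * (f z * (expR (- mu * g z) * (- mu * dg z)) + expR (- mu * g z) * df z)
    = expR (- mu * g z) * (z * df z - mu * (z * dg z) * f z) by ring.
  by rewrite ode// subrr mulr0.
rewrite mul0r => /eqP; rewrite subr_eq0 => /eqP.
have PE r : P r = f r * expR (- mu * g r) by [].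
have f1 : f 1 = ps e t s by rewrite /f expr1n !mul1r.
have g1 : g 1 = ps c t s by rewrite /g expr1n !mul1r.
have f0 : f 0 = expR (mu * c 0%N 0%N).
  by rewrite /f expr0n/= !mul0r ps_at0.
have g0 : g 0 = c 0%N 0%N by rewrite /g expr0n/= !mul0r ps_at0.
rewrite !PE f1 g1 f0 g0 -expRD -mulrDl subrr mul0r expR0 => h.
rewrite -[RHS]mul1r -h -mulrA -expRD -mulrDl.
by rewrite addrC subrr mul0r expR0 mulr1.
Qed.

End ExponentialIdentity.

(** * Distance to the limit profile *)

Section ApproximateProfile.
Context {R : realType}.
Implicit Types (c e : nat -> nat -> R) (t s r delta : R).

Definition axis_coef delta j : R :=
  match j with 0%N => delta | 2%N => -1 | 3%N => 1 | _ => 0 end.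

(** These are the coefficients of [s - g t]: for [lam = 0] the equation is
    [4 s U_ss + 2 d U_s = 2 d], and this is its power series solution with [U (t, 0) = - g t]. *)
Definition limit_coef delta j k : R :=
  match k with
  | 0%N => axis_coef delta j
  | 1%N => (j == 0%N)%:R
  | _ => 0
  end.

(** A support condition that [limit_coef] meets and that [D1] and [D2] preserve, so that one formula
    evaluates all derivatives of the limit. *)
Definition poly_support c :=
  (forall j, (4 <= j)%N -> c j 0%N = 0) /\
  (forall j k, (0 < k)%N -> (0 < j)%N || (1 < k)%N -> c j k = 0).

Lemma ps_poly c t s : poly_support c ->
  ps c t s = c 0%N 0%N + c 1%N 0%N * t + c 2%N 0%N * t ^+ 2 +
    c 3%N 0%N * t ^+ 3 + c 0%N 1%N * s.
Proof.
move=> [c1 c2]; rewrite /ps /dsum (@gsum_finite _ _ 4%N); last first.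
  move=> j j4; rewrite (@gsum_finite _ _ 0%N) ?/series/= ?big_geq// => k _.
  rewrite /mono; case: k => [|k]; first by rewrite c1// !mul0r.
  by rewrite c2 ?mul0r// (leq_trans _ j4).
have H j : gsum (mono c t s j) = c j 0%N * t ^+ j + c j 1%N * t ^+ j * s.
  rewrite (@gsum_finite _ _ 2%N); last first.
    by move=> k k2; rewrite /mono c2 ?mul0r ?k2 ?orbT// (leq_trans _ k2).
  by rewrite /series/= big_nat_recr//= big_nat1 /mono expr0 expr1 mulr1.
rewrite /series/= 3?big_nat_recr//= big_nat1 !H.
rewrite !(c2 _.+1 1%N)// !expr0 !expr1; ring.
Qed.

Lemma limit_coef_support delta : poly_support (limit_coef delta).
Proof.
split; first by do 4?[case=> //].
by move=> [|j] [|[|k]].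
Qed.

Lemma poly_support_D1 c : poly_support c -> poly_support (D1 c).
Proof.
move=> [c1 c2]; split; first by move=> j j4; rewrite /D1 c1 ?mulr0// leqW.
by move=> j k k0 jk; rewrite /D1 c2 ?mulr0.
Qed.

Lemma poly_support_D2 c : poly_support c -> poly_support (D2 c).
Proof.
move=> [c1 c2]; split; first by move=> j j4; rewrite /D2 c2 ?mulr0// (leq_trans _ j4).
by move=> j k k0 jk; rewrite /D2 c2 ?mulr0// ltnS k0 orbT.
Qed.

Lemma poly_support_bounded c q A : poly_support c -> (forall j k, `|c j k| <= A) ->
  0 < q <= 1 -> bounded2 q (A / q ^+ 3) c.
Proof.
move=> [c1 c2] cA /andP[q0 q1] j k.
have A0 : 0 <= A := le_trans (normr_ge0 _) (cA 0%N 0%N).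
have q3 : 0 < q ^+ 3 by rewrite exprn_gt0.
have Q n : (n <= 3)%N -> 1 <= (q ^+ 3)^-1 * q ^+ n.
  move=> n3; rewrite mulrC ler_pdivlMr// mul1r; apply: ler_wiXn2l => //.
  exact: ltW.
have [n3|n3] := leqP (j + k)%N 3.
  apply: (le_trans (cA j k)).
  by rewrite -!mulrA -exprD ler_peMr// Q.
have -> : c j k = 0.
  case: k n3 => [|k] n3; first by rewrite c1//; rewrite addn0 in n3.
  apply: c2 => //; case: j n3 => [|j]//; rewrite add0n ltnS => h.
  by rewrite ltnS (leq_trans _ h).
by rewrite normr0 !mulr_ge0 ?invr_ge0 ?exprn_ge0// ltW.
Qed.

(** In contrast with [W1_bounded], the constant [M] is kept and only the ratio doubles. Two
    derivatives thus take the ratio from [1/16] to [1/4], still below [1/2], without weakening the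
    smallness in [lam]. *)
Lemma bounded2_D1 q M c : 0 < q -> 4 * q <= 1 -> bounded2 q M c ->
  bounded2 (2 * q) M (D1 c).
Proof.
move=> q0 q4 cM j k; have M0 := bounded2_ge0 cM.
rewrite /D1 normrM normr_nat.
apply: (@le_trans _ _ (j.+1%:R * (M * q ^+ j.+1 * q ^+ k))); first by rewrite ler_wpM2l.
have -> : j.+1%:R * (M * q ^+ j.+1 * q ^+ k) = M * (q * (j.+1%:R * q ^+ j)) * q ^+ k.
  by rewrite exprS; ring.
have qq : 0 < q < 2 * q by rewrite q0/=; lra.
have h1 : q * (j.+1%:R * q ^+ j) <= (2 * q) ^+ j.
  apply: (@le_trans _ _ (q * (2 * q / (2 * q - q) * (2 * q) ^+ j))).
    by rewrite ler_pM2l//; exact: succ_geom_le.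
  have -> : 2 * q / (2 * q - q) = 2.
    by field; rewrite gt_eqF//; lra.
  by rewrite mulrA ler_piMl ?exprn_ge0//; lra.
have h2 : q ^+ k <= (2 * q) ^+ k by rewrite lerXn2r ?nnegrE//; lra.
apply: ler_pM => //; last by rewrite ler_wpM2l.
- by apply: mulr_ge0 => //; apply: mulr_ge0; [exact: ltW|rewrite mulr_ge0// exprn_ge0// ltW].
- by rewrite exprn_ge0// ltW.
Qed.

Lemma bounded2_D2 q M c : 0 < q -> 4 * q <= 1 -> bounded2 q M c ->
  bounded2 (2 * q) M (D2 c).
Proof.
move=> q0 q4 cM j k.
have := @bounded2_D1 q M (fun k j => c j k) q0 q4 _ k j.
rewrite /D1 /D2 mulrAC; apply => k' j'.
by rewrite mulrAC; exact: cM.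
Qed.

Lemma D1D2C c : D1 (D2 c) = D2 (D1 c).
Proof. by apply/funext => j; apply/funext => k; rewrite /D1 /D2 mulrCA. Qed.

Lemma expR_le1D2 (x : R) : 0 <= x <= 2^-1 -> expR x <= 1 + 2 * x.
Proof.
move=> /andP[x0 x2]; have h := expR_ge1Dx (- x).
have h1 : 0 < 1 - x by lra.
have -> : expR x = (expR (- x))^-1 by rewrite expRN invrK.
apply: (@le_trans _ _ (1 - x)^-1); first by rewrite lef_pV2// posrE expR_gt0.
rewrite -(ler_pM2r h1) mulVf ?gt_eqF//.
rewrite -subr_ge0 (_ : _ - 1 = x * (1 - 2 * x)); last by ring.
by rewrite mulr_ge0//; lra.
Qed.

Lemma majorant_le_exp (gam : R) j k : 0 <= gam ->
  majorant gam j k <= (2 * gam) ^+ (j + k.*2).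
Proof.
move=> g0; rewrite /majorant exprMn ler_wpM2r ?exprn_ge0//.
by rewrite -natrX ler_nat; exact: bin_le_exp2.
Qed.

Lemma even_power_le (q : R) j k : 0 <= q <= 1 -> q ^+ (j + k.*2) <= q ^+ j * q ^+ k.
Proof.
move=> /andP[q0 q1]; rewrite exprD ler_wpM2l ?exprn_ge0//.
by rewrite ler_wiXn2l// -addnn leq_addr.
Qed.

Section Deviation.
Variables (d : nat) (lam delta : R) (c e : nat -> nat -> R).
Hypotheses (d0 : (0 < d)%N) (lam0 : 0 < lam) (delta0 : 0 < delta <= 1).

(** With [gam = 1/64], the cube makes [M * gam ^+ j >= 8 * d] up to [j = 3], the degree of the axis
    data. The hypothesis [lamM] is then exactly [2 * mu * M <= 1]. *)
Let M : R := 8 * d%:R * 64 ^+ 3.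
Let mu : R := lam / (2 * d%:R).

Hypothesis lamM : lam * (8 * 64 ^+ 3) <= 1.
Hypothesis sol : solves_recurrences d lam mu (expR (mu * delta)) (axis_coef delta) c e.

Let d1 : 1 <= d%:R :> R. Proof. by rewrite ler1n. Qed.
Let dn0 : d%:R != 0 :> R. Proof. by rewrite gt_eqF// (lt_le_trans ltr01). Qed.
Let mu_ge0 : 0 <= mu. Proof. by rewrite divr_ge0 ?mulr_ge0// ltW. Qed.
Let dV : d%:R^-1 <= 1 :> R.
Proof. by rewrite invf_le1// (lt_le_trans ltr01). Qed.
Let mu_le : mu <= lam / 2.
Proof.
have h : 0 <= lam / 2 by rewrite divr_ge0// ltW.
by rewrite /mu invfM mulrA ler_piMr.
Qed.
Let muM : 2 * mu * M <= 1.
Proof.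
apply: le_trans lamM; rewrite le_eqVlt; apply/orP; left; apply/eqP.
by rewrite /mu /M; field; rewrite dn0.
Qed.
Let lam_le : lam <= 2^-1.
Proof. by have := lamM; have := lam0; lra. Qed.
Let e0_le : expR (mu * delta) <= 1 + lam.
Proof.
have /andP[de0 de1] := delta0.
have h : 0 <= mu * delta <= lam / 2.
  have -> : 0 <= mu * delta by apply: mulr_ge0 => //; exact: ltW.
  by rewrite (le_trans _ mu_le)// ler_piMr.
have := @expR_le1D2 (mu * delta); move: h => /andP[h1 h2].
have := lam_le => h3.
by rewrite h1/= => /(_ ltac:(lra)); lra.
Qed.
Let e0_ge : 1 <= expR (mu * delta).
Proof.
have /andP[de0 _] := delta0.
by rewrite (le_trans _ (expR_ge1Dx _))// lerDl mulr_ge0// ltW.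
Qed.
Let M_ge : 8 * 64 ^+ 3 <= M.
Proof.
have -> : M = 8 * 64 ^+ 3 * d%:R by rewrite /M; ring.
by rewrite ler_peMr// mulr_ge0// exprn_ge0.
Qed.

Let e02 : `|expR (mu * delta)| <= 2.
Proof. by rewrite gtr0_norm ?expR_gt0//; move: e0_le lam_le; lra. Qed.
Let dM : 8 * d%:R <= M * 64^-1 ^+ 2.
Proof.
have -> : M * 64^-1 ^+ 2 = 8 * d%:R * 64 by rewrite /M; field.
by move: d1; lra.
Qed.
Let bM : forall j, `|j%:R * axis_coef delta j| <= M * 64^-1 ^+ j.
Proof.
have M0 : 0 <= M by move: M_ge; lra.
have H (a : R) j : `|a| <= 3 -> (j <= 3)%N -> `|a| <= M * 64^-1 ^+ j.
  move=> a3 j3; apply: (le_trans a3); apply: (@le_trans _ _ (M * 64^-1 ^+ 3)).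
    have -> : M * 64^-1 ^+ 3 = 8 * d%:R by rewrite /M; field.
    by move: d1; lra.
  by rewrite ler_wpM2l// ler_wiXn2l//; lra.
move=> [|[|[|[|j]]]] /=; rewrite ?mulr0 ?mul0r ?normr0.
- by rewrite expr0 mulr1.
- by rewrite mulr_ge0// exprn_ge0.
- by apply: H => //; rewrite normrM normrN normr1 mulr1 normr_nat ler_nat.
- by apply: H => //; rewrite normrM normr1 mulr1 normr_nat.
- by rewrite mulr_ge0// exprn_ge0.
Qed.

Let g64 : 0 < 64^-1 :> R. Proof. by []. Qed.
Let lam01 : 0 < lam <= 2^-1. Proof. by rewrite lam0 lam_le. Qed.

Let cB := coef_bound d0 g64 lam01 mu_ge0 muM e02 dM bM sol.
Let eB := exp_coef_bound d0 g64 lam01 mu_ge0 muM e02 dM bM sol.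
Let eS := exp_coef_small d0 g64 lam01 mu_ge0 muM e02 dM bM sol.

(** On the axis the deviation is zero. At [(0, 1)] it equals [expR (mu * delta) - 1 + lam / d].
    Elsewhere the limit coefficient vanishes, and the recurrence bounds [c j k.+1] by [e j k], small
    with [mu], plus [lam] times the contribution of [c j.+2 k]. *)
Lemma deviation_bounded :
  bounded2 (16^-1) (lam * (80 * M)) (fun j k => c j k - limit_coef delta j k).
Proof.
have [c0 cR e00 _] := sol.
have M0 : 0 <= M by move: M_ge; lra.
have q01 : 0 <= (16^-1 : R) <= 1 by lra.
have N0 j k : 0 <= lam * (80 * M) * 16^-1 ^+ j * 16^-1 ^+ k.
  by rewrite mulr_ge0 ?exprn_ge0// mulr_ge0 ?exprn_ge0// !mulr_ge0// ltW.
move=> j [|k]; first by rewrite /= c0 subrr normr0 N0.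
have [jk0|jk0] := posnP (j + k)%N.
  move: jk0 => /eqP; rewrite addn_eq0 => /andP[/eqP-> /eqP->] /=.
  have := cR 0%N 0%N; rewrite c0 e00 /= => h.
  have -> : c 0%N 1%N - 1 = expR (mu * delta) - 1 + lam / d%:R.
    apply: (mulfI (_ : 2 * d%:R != 0 :> R)); first by rewrite mulf_neq0.
    have -> : 2 * d%:R * (expR (mu * delta) - 1 + lam / d%:R) =
      2 * d%:R * expR (mu * delta) - 2 * d%:R + 2 * lam by field.
    by move: h; lra.
  have h1 : 0 <= lam / d%:R <= lam.
    by rewrite divr_ge0 ?(ltW lam0)//= ler_piMr ?(ltW lam0).
  rewrite ger0_norm; last by move: e0_ge h1; lra.
  rewrite expr0 expr1 mulr1.
  apply: (@le_trans _ _ (lam * 2)); first by move: e0_le h1; lra.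
  by rewrite -mulrA ler_pM2l//; move: M_ge; lra.
have -> : limit_coef delta j k.+1 = 0.
  by case: k jk0 => [|k]//; rewrite addn0; case: j.
rewrite subr0.
set n := (j + k.*2)%N.
have q0 : 0 <= 16^-1 ^+ n :> R by rewrite exprn_ge0.
have hE : `|e j k| <= 4 * mu * M * 16^-1 ^+ n.
  have mm : 0 <= 4 * mu * M by apply: mulr_ge0 => //; exact: mulr_ge0.
  apply: (le_trans (eS jk0)); rewrite ler_wpM2l//.
  apply: (le_trans (majorant_le_exp _ _ _)); first by lra.
  by rewrite lerXn2r ?nnegrE//; lra.
pose p : R := j.+2%:R * j.+1%:R.
have hY : p * `|c j.+2 k| <= M * 16^-1 ^+ n.
  have h1 := cB j.+2 k; rewrite /Wt normrM normr_nat in h1.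
  have h2 : p * `|c j.+2 k| <= j.+1%:R * (M * majorant 64^-1 j.+2 k).
    rewrite /p mulrAC mulrC ler_wpM2l// (le_trans _ h1)// ler_wpM2r// ler_nat.
    exact: leq_addr.
  apply: (le_trans h2).
  apply: (@le_trans _ _ (j.+1%:R * (M * (2 * 64^-1) ^+ (j.+2 + k.*2)))).
    by rewrite ler_wpM2l// ler_wpM2l// majorant_le_exp.
  have -> : (j.+2 + k.*2 = n.+2)%N by rewrite !addSn.
  (* Of the decay [1/32], the factor [1/2] is spent on [j + 1] and [1/16] remains. *)
  have -> : 2 / 64 = 2^-1 * 16^-1 :> R by field.
  rewrite exprMn.
  have -> : j.+1%:R * (M * (2^-1 ^+ n.+2 * 16^-1 ^+ n.+2)) =
    M * (j.+1%:R * 2^-1 ^+ n.+2) * 16^-1 ^+ n.+2 by ring.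
  have hj : j.+1%:R * 2^-1 ^+ n.+2 <= 1 :> R.
    rewrite exprVn ler_pdivrMr ?exprn_gt0// mul1r.
    have jn : (j.+1 <= n.+2)%N by rewrite ltnS leqW// leq_addr.
    by rewrite -natrX ler_nat (leq_trans jn)// ltnW// ltn_expl.
  have hj0 : 0 <= j.+1%:R * 2^-1 ^+ n.+2 :> R.
    by apply: mulr_ge0 => //; rewrite exprn_ge0.
  have hn : 16^-1 ^+ n.+2 <= 16^-1 ^+ n :> R.
    by rewrite ler_wiXn2l//; [lra|rewrite ltnW].
  apply: ler_pM; [exact: mulr_ge0|by rewrite exprn_ge0| |exact: hn].
  by rewrite -[leRHS]mulr1 ler_wpM2l.
have a0 : 0 <= k%:R :> R by [].
have hX : `|c j k.+1| <= `|e j k| + lam * (p * `|c j.+2 k|).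
  pose K : R := k.+1%:R * (4 * k%:R + 2 * d%:R).
  have K2 : 2 * d%:R <= K.
    rewrite /K -(natr1 k) -subr_ge0.
    have -> : (k%:R + 1) * (4 * k%:R + 2 * d%:R) - 2 * d%:R =
      k%:R * (4 * (k%:R + 1) + 2 * d%:R) :> R by ring.
    by apply: mulr_ge0 => //; move: d1; lra.
  have K0 : 0 < K by move: K2 d1; lra.
  rewrite -(ler_pM2l K0).
  have -> : K * `|c j k.+1| = `|K * c j k.+1| by rewrite normrM gtr0_norm.
  have -> : K * c j k.+1 = 2 * d%:R * e j k - lam * p * c j.+2 k.
    by rewrite /p -cR /K; ring.
  rewrite (le_trans (ler_normB _ _))// mulrDr lerD//.
    by rewrite normrM ger0_norm ?mulr_ge0// ler_wpM2r.
  rewrite normrM ger0_norm; last by rewrite /p mulr_ge0 ?(ltW lam0).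
  rewrite -mulrA ler_peMl//; last by move: K2 d1; lra.
  by rewrite mulr_ge0 ?(ltW lam0)// mulr_ge0// /p.
have h3 : lam * (p * `|c j.+2 k|) <= lam * (M * 16^-1 ^+ n) by rewrite ler_pM2l.
have h4 : 4 * mu * M * 16^-1 ^+ n <= 2 * (lam * (M * 16^-1 ^+ n)).
  have -> : 2 * (lam * (M * 16^-1 ^+ n)) = 4 * (lam / 2) * M * 16^-1 ^+ n by field.
  by rewrite ler_wpM2r// ler_wpM2r// ler_wpM2l.
have h5 := even_power_le j k q01.
have -> : lam * (80 * M) * 16^-1 ^+ j * 16^-1 ^+ k.+1 =
  5 * (lam * (M * (16^-1 ^+ j * 16^-1 ^+ k))) by rewrite exprS; field.
have h6 : lam * (M * 16^-1 ^+ n) <= lam * (M * (16^-1 ^+ j * 16^-1 ^+ k)).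
  by rewrite ler_pM2l// ler_wpM2l.
have h7 : 0 <= lam * (M * 16^-1 ^+ n) by rewrite mulr_ge0 ?(ltW lam0)// mulr_ge0.
move: hX hE h3 h4 h6 h7; lra.
Qed.

Lemma exp_coef_ps_ok : ps_ok e.
Proof.
exists 2, (32^-1); split; first lra.
move=> j k; apply: (le_trans (eB j k)); rewrite -mulrA ler_wpM2l//.
apply: (le_trans (majorant_le_exp _ _ _)); first by lra.
have -> : 2 / 64 = 32^-1 :> R by field.
by apply: even_power_le; lra.
Qed.

End Deviation.

End ApproximateProfile.

(** * Existence of a profile close to its limit *)

Section Profile.
Context {R : realType}.

Lemma profile_exists (d : nat) (delta eta : R) : (0 < d)%N ->
  0 < delta <= 1 -> 0 < eta ->
  exists lam c, [/\ 0 < lam <= 1, ps_ok c,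
    forall t s : R, `|t| < 2 -> `|s| < 2 ->
      lam * ps (D1 (D1 c)) t s +
        (2 * d%:R * ps (D2 c) t s + 4 * s * ps (D2 (D2 c)) t s) =
      2 * d%:R * expR (lam / (2 * d%:R) * ps c t s),
    forall t : R, `|t| <= 2 -> ps c t 0 = delta - t ^+ 2 + t ^+ 3 &
    forall t s : R, `|t| <= 2 -> `|s| <= 2 ->
      [/\ `|ps (D1 c) t s - (3 * t ^+ 2 - 2 * t)| <= eta,
          `|ps (D2 c) t s - 1| <= eta,
          `|ps (D1 (D1 c)) t s - (6 * t - 2)| <= eta,
          `|ps (D1 (D2 c)) t s| <= eta &
          `|ps (D2 (D2 c)) t s| <= eta]].
Proof.
move=> d0 delta0 eta0.
pose M : R := 8 * d%:R * 64 ^+ 3.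
have M0 : 0 < M by rewrite !mulr_gt0// ?ltr0n// exprn_gt0.
have MM : 0 < 320 * M := mulr_gt0 (ltr0Sn R 319) M0.
(* The first bound serves the majorant. The second makes [4 * (lam * (80 * M)) <= eta], where 4 is
   [(1 - 2 q)^-2] at [q = 1/4], the ratio left after two derivatives. *)
pose lam := Num.min (8 * 64 ^+ 3)^-1 (eta / (320 * M)).
have k0 : 0 < 8 * 64 ^+ 3 :> R by rewrite mulr_gt0// exprn_gt0.
have lam0 : 0 < lam by rewrite lt_min invr_gt0 k0 divr_gt0.
have lam1 : lam * (8 * 64 ^+ 3) <= 1.
  by rewrite -ler_pdivlMr// div1r ge_min lexx.
have lam2 : 4 * (lam * (80 * M)) <= eta.
  have -> : 4 * (lam * (80 * M)) = lam * (320 * M) by ring.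
  by rewrite -ler_pdivlMr// ge_min lexx orbT.
have [c [e sol]] := recurrences_solvable lam (lam / (2 * d%:R))
  (expR (lam / (2 * d%:R) * delta)) (axis_coef delta) d0.
have dB := deviation_bounded d0 lam0 delta0 lam1 sol.
have eok := exp_coef_ps_ok d0 lam0 delta0 lam1 sol.
have [c0 cR e00 eW] := sol.
set l0 := limit_coef delta in dB.
pose v j k : R := c j k - l0 j k.
have l0s : poly_support l0 := limit_coef_support delta.
have l0ok : ps_ok l0.
  exists (1 / (4^-1) ^+ 3), (4^-1); split; first by lra.
  apply: poly_support_bounded => //; last by lra.
  have /andP[de0 de1] := delta0.
  move=> [|[|[|[|j]]]] [|[|k]] //=; rewrite ?normr0 ?normrN ?normr1//.
  by rewrite gtr0_norm.
have vok : ps_ok v by exists (lam * (80 * M)), (16^-1); split=> //; lra.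
have cE : c = fun j k => l0 j k + v j k.
  by apply/funext => j; apply/funext => k; rewrite /v addrC subrK.
have cok : ps_ok c by rewrite cE; exact: ps_okD.
have D1E (a b : nat -> nat -> R) : D1 (fun j k => a j k + b j k) = fun j k => D1 a j k + D1 b j k.
  by apply/funext => j; apply/funext => k; rewrite /D1 mulrDr.
have D2E (a b : nat -> nat -> R) : D2 (fun j k => a j k + b j k) = fun j k => D2 a j k + D2 b j k.
  by apply/funext => j; apply/funext => k; rewrite /D2 mulrDr.
have small (a : nat -> nat -> R) t s : bounded2 (4^-1) (lam * (80 * M)) a ->
    `|t| <= 2 -> `|s| <= 2 -> `|ps a t s| <= eta.
  move=> aB t2 s2; apply: (le_trans _ lam2).
  apply: le_trans (ps_bound _ aB t2 s2) _; first by lra.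
  by rewrite le_eqVlt; apply/orP; left; apply/eqP; field; lra.
have p16 : 0 < 16^-1 :> R by [].
have p8 : 2 * 16^-1 = 8^-1 :> R by field.
have p4 : 2 * 8^-1 = 4^-1 :> R by field.
have v1 : bounded2 (8^-1) (lam * (80 * M)) (D1 v).
  by rewrite -p8; apply: bounded2_D1 => //; lra.
have v2 : bounded2 (8^-1) (lam * (80 * M)) (D2 v).
  by rewrite -p8; apply: bounded2_D2 => //; lra.
have v11 : bounded2 (4^-1) (lam * (80 * M)) (D1 (D1 v)).
  by rewrite -p4; apply: bounded2_D1 => //; lra.
have v12 : bounded2 (4^-1) (lam * (80 * M)) (D1 (D2 v)).
  by rewrite -p4; apply: bounded2_D1 => //; lra.
have v22 : bounded2 (4^-1) (lam * (80 * M)) (D2 (D2 v)).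
  by rewrite -p4; apply: bounded2_D2 => //; lra.
have p84 : 0 < (8^-1 : R) <= 4^-1 by lra.
exists lam, c; split=> //.
{ rewrite lam0/=; move: lam1 lam0; lra.
}
{ move=> t s t2 s2.
  have := ps_exp cok eok eW _ t2 s2; rewrite e00 c0 => /(_ erefl) <-.
  have [t2' s2'] := (ltW t2, ltW s2).
  have ok11 := ps_ok_D1 (ps_ok_D1 cok); have ok2 := ps_ok_D2 cok.
  have okw := ps_ok_W2 ok2.
  have -> : 4 * s * ps (D2 (D2 c)) t s = 4 * ps (W2 (D2 c)) t s.
    by rewrite ps_W2// mulrA.
  rewrite -!psZ//.
  rewrite -[X in _ + X]psD//; try exact: ps_okZ.
  rewrite -psD//; try exact: ps_okZ; last by apply: ps_okD; exact: ps_okZ.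
  congr (ps _ t s); apply/funext => j; apply/funext => k.
  have := cR j k; rewrite /D1 /W2 /D2 -(natr1 k) => <-.
  by ring.
}
{ move=> t t2.
  have s2 : `|0 : R| <= 2 by rewrite normr0.
  rewrite cE psD// ps_poly// (_ : ps v t 0 = 0).
    by rewrite /l0/=; ring.
  rewrite /ps /dsum (@gsum_finite _ _ 0%N) ?/series/= ?big_geq// => j _.
  rewrite (@gsum_finite _ _ 0%N) ?/series/= ?big_geq// => k _.
  rewrite /mono; case: k => [|k]; last by rewrite expr0n mulr0.
  by rewrite /v c0 /l0/= subrr !mul0r.
}
{ move=> t s t2 s2.
  have q1 := bounded2_le p84 v1; have q2 := bounded2_le p84 v2.
  split.
  { rewrite cE D1E psD//; [|exact: ps_ok_D1|exact: ps_ok_D1].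
    rewrite ps_poly; last exact: poly_support_D1.
    set w := ps (D1 v) t s.
    rewrite (_ : _ + _ - _ = w); first exact: small.
    by rewrite /D1 /l0/=; ring.
  }
  { rewrite cE D2E psD//; [|exact: ps_ok_D2|exact: ps_ok_D2].
    rewrite ps_poly; last exact: poly_support_D2.
    set w := ps (D2 v) t s.
    rewrite (_ : _ + _ - _ = w); first exact: small.
    by rewrite /D2 /l0/=; ring.
  }
  { rewrite cE (D1E l0 v) (D1E (D1 l0) (D1 v)) psD//; [|exact: ps_ok_D1 (ps_ok_D1 l0ok)|exact: ps_ok_D1 (ps_ok_D1 vok)].
    rewrite ps_poly; last exact: poly_support_D1 (poly_support_D1 l0s).
    set w := ps (D1 (D1 v)) t s.
    rewrite (_ : _ + _ - _ = w); first exact: small.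
    by rewrite /D1 /l0/=; ring.
  }
  { rewrite cE (D2E l0 v) (D1E (D2 l0) (D2 v)) psD//; [|exact: ps_ok_D1 (ps_ok_D2 l0ok)|exact: ps_ok_D1 (ps_ok_D2 vok)].
    rewrite ps_poly; last exact: poly_support_D1 (poly_support_D2 l0s).
    set w := ps (D1 (D2 v)) t s.
    rewrite (_ : _ + _ = w); first exact: small.
    by rewrite /D1 /D2 /l0/=; ring.
  }
  { rewrite cE (D2E l0 v) (D2E (D2 l0) (D2 v)) psD//; [|exact: ps_ok_D2 (ps_ok_D2 l0ok)|exact: ps_ok_D2 (ps_ok_D2 vok)].
    rewrite ps_poly; last exact: poly_support_D2 (poly_support_D2 l0s).
    set w := ps (D2 (D2 v)) t s.
    rewrite (_ : _ + _ = w); first exact: small.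
    by rewrite /D2 /l0/=; ring.
  }
}
Qed.

End Profile.

(** * Maximum principle and uniqueness *)

Section MaximumPrinciple.
Context {R : realType}.

Lemma bounded_closure (V : normedModType R) (A : set V) :
  bounded_set A -> bounded_set (closure A).
Proof.
move=> [M [Mr HM]]; exists M; split=> // x Mx y cy.
have cB : closed [set z : V | `|z| <= x].
  apply: (@preimage_closed _ _ (fun z : V => `|z|) [set t | t <= x]).
    by move=> z _; exact: norm_continuous.
  exact: closed_le.
have AB : A `<=` [set z : V | `|z| <= x] by move=> z Az; exact: HM.
by have := closure_subset AB cy; rewrite -(closure_id _).1.
Qed.

Lemma is_derive_line (V : normedModType R) (f : V -> R) (c v : V) (r : R) :
  derivable f (r *: v + c) v ->
  is_derive r 1 (fun h : R => f (h *: v + c)) ('D_v f (r *: v + c)).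
Proof.
have E : (fun h : R => h^-1 *: (((fun k : R => f (k *: v + c)) \o shift r) (h *: 1)
      - f (r *: v + c))) =
    (fun h : R => h^-1 *: ((f \o shift (r *: v + c)) (h *: v) - f (r *: v + c))).
  by apply/funext => h /=; rewrite [h *: 1]mulr1 scalerDl addrA.
by move=> df; apply: DeriveDef; rewrite /derivable /derive E.
Qed.

(** At the maximum the first derivative vanishes. Were the second one positive, the first would be
    positive just after 0, and the mean value theorem would raise the function above its maximum; no
    continuity of the second derivative is involved. *)
Lemma second_derivative_max (V : normedModType R) (f : V -> R) (A : set V) (c v : V) :
  open A -> A c -> (forall y, A y -> derivable f y v) ->
  derivable ('D_v f) c v -> (forall y, A y -> f y <= f c) ->
  'D_v ('D_v f) c <= 0.
Proof.
move=> oA Ac df ddf fmax; rewrite leNgt; apply/negP => L0.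
pose line (h : R) := h *: v + c.
have line0 : line 0 = c by rewrite /line scale0r add0r.
have nA : \forall h \near (0 : R), A (line h).
  have cl : line h @[h --> (0 : R)] --> line 0.
    by apply: cvgD; [apply: cvgZr_tmp; exact: cvg_id|exact: cvg_cst].
  by apply: cl; rewrite line0; apply: open_nbhs_nbhs.
have /nbhs_ballP[e /= e0 He] := nA.
have inA (h : R) : `|h| < e -> A (line h).
  by move=> he; apply: He; rewrite /ball/= sub0r normrN.
pose phi h := f (line h).
pose psi h := 'D_v f (line h).
have dphi (h : R) : `|h| < e -> is_derive h 1 phi (psi h).
  by move=> he; apply: is_derive_line; apply: df; exact: inA.
have psi0 : psi 0 = 0.
  have h0 : `|0 : R| < e by rewrite normr0.
  have [_ <-] := dphi 0 h0.
  suff [_ ->] : is_derive (0 : R) (1 : R) phi 0 by [].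
  apply: (@derive1_at_max _ phi (- e) e 0).
  - by rewrite ge0_cp// ltW.
  - move=> t; rewrite in_itv/= -ltr_norml => te.
    by have [] := dphi t te.
  - by rewrite in_itv/= oppr_lt0 e0.
  - move=> t; rewrite in_itv/= -ltr_norml => te.
    by rewrite /phi line0; apply: fmax; exact: inA.
have q0 : \forall h \near (0 : R)^', 0 < h^-1 * psi h.
  have cq : h^-1 *: (('D_v f \o shift c) (h *: v) - 'D_v f c) @[h --> (0 : R)^']
      --> 'D_v ('D_v f) c by exact: ddf.
  apply: filterS (cvgr_gt _ cq 0 L0) => h /=.
  by rewrite -[X in _ - X]/('D_v f c) -{2}line0 -/(psi 0) psi0 subr0.
have /nbhs_ballP[e' /= e'0 He'] := q0.
pose h := Num.min e e' / 2.
have m0 : 0 < Num.min e e' by rewrite lt_min e0.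
have h0 : 0 < h by rewrite divr_gt0.
have hm : h < Num.min e e' by rewrite /h; lra.
have he : h < e by rewrite (lt_le_trans hm)// ge_min lexx.
have he' : h < e' by rewrite (lt_le_trans hm)// ge_min lexx orbT.
have cphi : {within `[0, h], continuous phi}.
  apply: derivable_within_continuous => t; rewrite in_itv/= => /andP[t0 th].
  have te : `|t| < e by rewrite ger0_norm// (le_lt_trans th).
  by have [] := dphi t te.
have dphi' t : t \in `]0, h[ -> is_derive t 1 phi (psi t).
  rewrite in_itv/= => /andP[t0 th]; apply: dphi.
  by rewrite gtr0_norm// (lt_trans th).
have [z] := MVT h0 dphi' cphi; rewrite in_itv/= => /andP[z0 zh] E.
have pz : 0 < psi z.
  have : 0 < z^-1 * psi z.
    apply: He'; last by rewrite /= gt_eqF.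
    by rewrite /ball/= sub0r normrN gtr0_norm// (lt_trans zh).
  by rewrite pmulr_rgt0// invr_gt0.
have : phi h <= phi 0.
  rewrite /phi line0; apply: fmax; apply: inA.
  by rewrite gtr0_norm.
by rewrite -subr_le0 E subr0 leNgt mulr_gt0.
Qed.

(** A positive maximum of [a - b] on the compact closure is interior, as both functions vanish on
    the boundary. There the Laplacian of [a] is at most that of [b], while
    [expR (a c) > expR (b c)]. *)
Lemma classical_solution_le (N : nat) (Omega : set 'rV[R]_N) (a b : 'rV[R]_N -> R) :
  open Omega -> bounded_set Omega -> classical_solution Omega a ->
  classical_solution Omega b -> forall x, closure Omega x -> a x <= b x.
Proof.
move=> oO bO [[_ a2] ca la ba] [[_ b2] cb lb bb] x cx; rewrite leNgt; apply/negP => ab.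
have cO : compact (closure Omega).
  apply: bounded_closed_compact; last exact: closed_closure.
  exact: bounded_closure.
have cab : {within closure Omega, continuous (fun y => a y - b y)}.
  by move=> y; apply: cvgB; [exact: ca|exact: cb].
have [c] := EVT_max_rV (ex_intro _ x cx) cO cab; rewrite inE => cc cmax.
have abc : b c < a c.
  rewrite -subr_gt0 (lt_le_trans _ (cmax x _)) ?subr_gt0//; first by rewrite inE.
have Oc : Omega c.
  apply: contrapT => nOc.
  have bc : boundary Omega c.
    by split=> //; rewrite (iffLR (interior_id Omega) oO).
  by move: abc; rewrite (ba _ bc) (bb _ bc) ltxx.
have : laplacian a c <= laplacian b c.
  apply: ler_sum => i _; rewrite -subr_le0.
  have [da [_ da2]] := a2 i; have [db [_ db2]] := b2 i.
  have [dda _] := da2 i; have [ddb _] := db2 i.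
  pose e_i : 'rV[R]_N := delta_mx 0 i.
  have E : partial i (partial i a) c - partial i (partial i b) c =
     'D_e_i ('D_e_i (a - b)) c.
    rewrite [LHS](esym (deriveB (dda c Oc) (ddb c Oc))).
    apply: near_eq_derive.
    apply: filterS (open_nbhs_nbhs (conj oO Oc)) => y Oy.
    by rewrite (deriveB (da y Oy) (db y Oy)).
  rewrite E; apply: (@second_derivative_max _ _ Omega).
  - exact: oO.
  - exact: Oc.
  - by move=> y Oy; apply: derivableB; [exact: da|exact: db].
  - apply: (near_eq_derivable (f := partial i a - partial i b)).
      apply: filterS (open_nbhs_nbhs (conj oO Oc)) => y Oy.
      by rewrite /partial (deriveB (da y Oy) (db y Oy)).
    by apply: derivableB; [exact: dda|exact: ddb].
  - by move=> y Oy; apply: cmax; rewrite inE; exact: subset_closure.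
by rewrite la// lb// ler_expR leNgt abc.
Qed.

Lemma classical_solution_unique (N : nat) (Omega : set 'rV[R]_N)
    (u : 'rV[R]_N -> R) :
  open Omega -> bounded_set Omega -> classical_solution Omega u ->
  unique_classical_solution Omega u.
Proof.
move=> oO bO su; split=> // u' su' x; rewrite inE => cx.
by apply/eqP; rewrite eq_le !(classical_solution_le oO bO).
Qed.

End MaximumPrinciple.

(** * Curvature estimates for the level set *)

Section Curvature.
Context {R : realType}.
Implicit Types (t s a f h k l tau Z w delta eta : R).

(** The quantity is [g'^2 - 2 g g''], at least [t^3 + 4 delta - 12 delta t]. For [t <= 1/6] the last
    term is at most [2 delta]; beyond, [t^3 >= t / 36] dominates it as [432 = 12 * 36]. *)
Lemma limit_discriminant_ge t delta :
  0 < delta -> delta <= 432^-1 -> 0 <= t -> t <= 1 ->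
  2 * delta <= 2 * ((t ^+ 2 - t ^+ 3 - delta) * (6 * t - 2)) + (3 * t ^+ 2 - 2 * t) ^+ 2.
Proof.
move=> de0 de1 t0 t1.
have -> : 2 * ((t ^+ 2 - t ^+ 3 - delta) * (6 * t - 2)) + (3 * t ^+ 2 - 2 * t) ^+ 2 =
  4 * t ^+ 3 - 3 * t ^+ 4 + 4 * delta - 12 * (delta * t) by ring.
have t3 : 0 <= t ^+ 3 by rewrite exprn_ge0.
have t4 : t ^+ 4 <= t ^+ 3 by rewrite [t ^+ 4]exprS ler_piMl.
have [t6|t6] := leP t 6^-1.
  have : delta * t <= delta * 6^-1 by rewrite ler_pM2l.
  lra.
have : 36^-1 * t <= t ^+ 3.
  rewrite exprSr ler_wpM2r// (_ : 36^-1 = 6^-1 ^+ 2 :> R); last by field.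
  by rewrite lerXn2r ?nnegrE ?ltW//; lra.
have : delta * t <= 432^-1 * t by rewrite ler_wpM2r.
lra.
Qed.

(* For the limit profile [s - t^2 + t^3 + delta], which vanishes at
   [s = t^2 - t^3 - delta], the quantity below is the one just estimated. *)
Lemma curvature_discriminant_ge t s a f h k l delta eta :
  0 < delta -> delta <= 432^-1 -> eta = delta / 100 ->
  0 <= t -> t <= 1 -> 0 <= s -> s <= 1 ->
  `|s - (t ^+ 2 - t ^+ 3 - delta)| <= eta ->
  `|a - (3 * t ^+ 2 - 2 * t)| <= eta -> `|f - 1| <= eta ->
  `|h - (6 * t - 2)| <= eta -> `|k| <= eta -> `|l| <= eta ->
  delta <= 2 * s * (h * f ^+ 2 - 2 * k * a * f + l * a ^+ 2) + a ^+ 2 * f.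
Proof.
move=> de0 de1 etaE t0 t1 s0 s1 Hs Ha Hf Hh Hk Hl.
have eta0 : 0 < eta by lra.
have eta1 : eta <= 1 by lra.
set g := t ^+ 2 - t ^+ 3 - delta in Hs.
set a0 := 3 * t ^+ 2 - 2 * t in Ha.
set h0 := 6 * t - 2 in Hh.
(* Errors are propagated through products. They add up to [71 * eta], less than [delta = 100 * eta],
   so the limit bound [2 * delta] leaves at least [delta]. *)
have prod (x x0 y y0 X Y ex ey : R) : `|x - x0| <= ex -> `|y - y0| <= ey ->
    `|x| <= X -> `|y0| <= Y -> `|x * y - x0 * y0| <= X * ey + ex * Y.
  move=> h1 h2 h3 h4.
  have -> : x * y - x0 * y0 = x * (y - y0) + (x - x0) * y0 by ring.
  by rewrite (le_trans (ler_normD _ _))// !normrM lerD// ler_pM.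
have t2 : 0 <= t ^+ 2 <= t by rewrite exprn_ge0//= expr2 ler_piMl.
have t2' : 2 * t - 1 <= t ^+ 2.
  by have := sqr_ge0 (1 - t); lra.
have A0 : `|a0| <= 1 by rewrite ler_norml /a0; lra.
have A1 : `|a| <= 2 by move: Ha A0; rewrite !ler_norml; lra.
have F1 : `|f| <= 2 by move: Hf; rewrite !ler_norml; lra.
have H0 : `|h0| <= 4 by rewrite ler_norml /h0; lra.
have H1 : `|h| <= 5 by move: Hh H0; rewrite !ler_norml; lra.
have S1 : `|s| <= 1 by rewrite ger0_norm.
have one : `|1 : R| <= 1 by rewrite normr1.
have ff := prod f 1 f 1 2 1 eta eta Hf Hf F1 one.
have hff := prod h h0 (f * f) (1 * 1) 5 1 eta _ Hh ff H1 (ltac:(by rewrite mulr1)).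
have shff := prod s g _ _ 1 4 eta _ Hs hff S1 (ltac:(by rewrite !mulr1)).
have aa := prod a a0 a a0 2 1 eta eta Ha Ha A1 A0.
have aa4 : `|a * a| <= 4.
  by rewrite normrM (_ : 4 = 2 * 2) ?ler_pM//; ring.
have aaf := prod (a * a) (a0 * a0) f 1 4 1 _ eta aa Hf aa4 one.
have kaf : `|s * (k * a * f)| <= 4 * eta.
  rewrite !normrM (_ : 4 * eta = 1 * (eta * 2 * 2)); last by ring.
  by rewrite !ler_pM// mulr_ge0.
have laa : `|s * (l * (a * a))| <= 4 * eta.
  rewrite !(normrM s, normrM l) (_ : 4 * eta = 1 * (eta * 4)); last by ring.
  by rewrite !ler_pM// mulr_ge0.
have main : 2 * delta <= 2 * (g * (h0 * (1 * 1))) + a0 * a0 * 1.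
  by rewrite !mulr1 -expr2; exact: limit_discriminant_ge.
have -> : 2 * s * (h * f ^+ 2 - 2 * k * a * f + l * a ^+ 2) + a ^+ 2 * f =
  2 * (s * (h * (f * f))) - 4 * (s * (k * a * f)) + 2 * (s * (l * (a * a))) + a * a * f.
  by ring.
move: shff aaf kaf laa; rewrite !ler_norml => /andP[x1 _] /andP[x2 _] /andP[_ x3] /andP[x4 _].
lra.
Qed.

(** The right-hand side is the Hessian of the profile on a vector [v], with [tau = v_0],
    [w = x'.v' / lam] and [Z = |v'|^2 / lam]. The hypotheses on these are tangency and
    Cauchy-Schwarz. Tangency eliminates [w]; multiplying by [s] brings in Cauchy-Schwarz and leaves
    the discriminant as coefficient of [tau ^+ 2]. *)
Lemma curvature_form_ge t s a f h k l delta eta tau Z w :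
  0 < delta -> delta <= 432^-1 -> eta = delta / 100 ->
  0 <= t -> t <= 1 -> 0 <= s -> s <= 1 ->
  `|s - (t ^+ 2 - t ^+ 3 - delta)| <= eta ->
  `|a - (3 * t ^+ 2 - 2 * t)| <= eta -> `|f - 1| <= eta ->
  `|h - (6 * t - 2)| <= eta -> `|k| <= eta -> `|l| <= eta ->
  a * tau + 2 * w * f = 0 -> w ^+ 2 <= s * Z -> 0 <= Z ->
  delta / (8 * (delta + 44)) * (tau ^+ 2 + Z) <=
    h * tau ^+ 2 + 4 * k * tau * w + 4 * l * w ^+ 2 + 2 * f * Z.
Proof.
move=> de0 de1 etaE t0 t1 s0 s1 Hs Ha Hf Hh Hk Hl tang wZ Z0.
have E := curvature_discriminant_ge de0 de1 etaE t0 t1 s0 s1 Hs Ha Hf Hh Hk Hl.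
have eta1 : eta <= 100^-1 by lra.
move: Hf; rewrite ler_norml => /andP[f1 f2].
have f0 : 2^-1 <= f by lra.
have f3 : f <= 5 / 4 by lra.
have fp : 0 < f by lra.
set Q := (X in _ <= X).
set G := h * f ^+ 2 - 2 * k * a * f + l * a ^+ 2 in E.
have QE : f ^+ 2 * Q = tau ^+ 2 * G + 2 * f ^+ 3 * Z.
  have wf : 2 * w * f = - (a * tau) by apply/eqP; rewrite -addr_eq0 addrC tang.
  have -> : f ^+ 2 * Q = f ^+ 2 * h * tau ^+ 2 + 2 * k * tau * f * (2 * w * f) +
     l * (2 * w * f) ^+ 2 + 2 * f ^+ 3 * Z by rewrite /Q; ring.
  by rewrite wf /G; ring.
have sQ : delta / 2 * tau ^+ 2 <= s * (f ^+ 2 * Q).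
  have h1 : a ^+ 2 * tau ^+ 2 <= 4 * f ^+ 2 * (s * Z).
    have -> : a ^+ 2 * tau ^+ 2 = 4 * f ^+ 2 * w ^+ 2.
      have -> : 4 * f ^+ 2 * w ^+ 2 = (2 * w * f) ^+ 2 by ring.
      have -> : 2 * w * f = - (a * tau) by apply/eqP; rewrite -addr_eq0 addrC tang.
      by ring.
    by rewrite ler_pM2l// mulr_gt0// exprn_gt0.
  have h2 : f * (a ^+ 2 * tau ^+ 2) <= f * (4 * f ^+ 2 * (s * Z)) by rewrite ler_pM2l.
  have h3 : delta * tau ^+ 2 <= (2 * s * G + a ^+ 2 * f) * tau ^+ 2.
    by rewrite ler_wpM2r// sqr_ge0.
  rewrite QE.
  have -> : s * (tau ^+ 2 * G + 2 * f ^+ 3 * Z) =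
    2^-1 * ((2 * s * G + a ^+ 2 * f) * tau ^+ 2) +
    2^-1 * (f * (4 * f ^+ 2 * (s * Z)) - f * (a ^+ 2 * tau ^+ 2)) by field.
  lra.
have tau0 : 0 <= tau ^+ 2 := sqr_ge0 tau.
have ff0 : 0 < f ^+ 2 by rewrite exprn_gt0.
have fff0 : 0 < f ^+ 3 by rewrite exprn_gt0.
have Q0 : 0 <= Q.
  rewrite leNgt; apply/negP => Qn.
  have h1 : s * (f ^+ 2 * Q) <= 0.
    by rewrite mulr_ge0_le0// mulr_ge0_le0// ltW.
  have : tau ^+ 2 <= 0.
    by rewrite -(pmulr_rle0 _ (_ : 0 < delta / 2)) ?(le_trans sQ)// divr_gt0.
  move=> tn; have tz : tau ^+ 2 = 0 by apply/eqP; rewrite eq_le tn.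
  have : 0 <= f ^+ 2 * Q.
    by rewrite QE tz mul0r add0r mulr_ge0// mulr_ge0// ltW.
  by rewrite pmulr_rge0// leNgt Qn.
have ff2 : f ^+ 2 <= 2.
  by rewrite expr2 (le_trans (ler_pM _ _ f3 f3)) ?ltW//; lra.
have fQ : f ^+ 2 * Q <= 2 * Q by rewrite ler_wpM2r.
have Q1 : delta / 4 * tau ^+ 2 <= Q.
  have : s * (f ^+ 2 * Q) <= f ^+ 2 * Q by rewrite ler_piMl// mulr_ge0// ltW.
  by move: sQ fQ; lra.
have GB : - 20 <= G.
  have t2 : 0 <= t ^+ 2 <= t by rewrite exprn_ge0//= expr2 ler_piMl.
  have t2' : 2 * t - 1 <= t ^+ 2 by have := sqr_ge0 (1 - t); lra.
  move: Ha Hh Hk Hl; rewrite !ler_norml => /andP[a1 a2] /andP[h1 h2] /andP[k1 k2] /andP[l1 l2].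
  have A : `|a| <= 2 by rewrite ler_norml; lra.
  have K : `|k| <= 2^-1 by rewrite ler_norml; lra.
  have F : `|f| <= 2 by rewrite ler_norml; lra.
  have L : `|l| <= 1 by rewrite ler_norml; lra.
  have hh : - 5 * f ^+ 2 <= h * f ^+ 2 by rewrite ler_wpM2r ?(ltW ff0)//; lra.
  have kaf : `|k * a * f| <= 2^-1 * 2 * 2.
    by rewrite !normrM !ler_pM// mulr_ge0.
  have laa : `|l * (a * a)| <= 1 * (2 * 2).
    by rewrite !normrM !ler_pM// mulr_ge0.
  move: kaf laa; rewrite !ler_norml => /andP[_ x3] /andP[x4 _].
  have -> : G = h * f ^+ 2 - 2 * (k * a * f) + l * (a * a) by rewrite /G; ring.
  move: hh x3 x4 ff2; clear; lra.
have Q2 : 8^-1 * Z - 10 * tau ^+ 2 <= Q.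
  have h1 : tau ^+ 2 * (-20) <= tau ^+ 2 * G by rewrite ler_wpM2l.
  have h2 : 8^-1 * Z <= f ^+ 3 * Z.
    rewrite ler_wpM2r// (_ : 8^-1 = 2^-1 ^+ 3 :> R); last by field.
    by rewrite lerXn2r ?nnegrE//; lra.
  by move: QE fQ; lra.
(* [44 * Q1 + delta * Q2] gives [11 * delta * tau ^+ 2] against a loss of [10 * delta * tau ^+ 2],
   and keeps [delta * Z / 8]. *)
have D44 : 0 < 8 * (delta + 44) by lra.
rewrite mulrAC ler_pdivrMr//.
have : 44 * (delta / 4 * tau ^+ 2) <= 44 * Q by rewrite ler_pM2l.
have : delta * (8^-1 * Z - 10 * tau ^+ 2) <= delta * Q by rewrite ler_pM2l.
have : 0 <= delta * tau ^+ 2 by rewrite mulr_ge0// ltW.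
lra.
Qed.

End Curvature.

(** * The domain, its closure and its boundary *)

Section ProfileDomain.
Context {R : realType}.
Variables (d : nat) (delta lam : R) (c : nat -> nat -> R).
Hypotheses (de0 : 0 < delta) (de1 : delta <= 432^-1).
Hypotheses (lam01 : 0 < lam <= 1) (cok : ps_ok c).
Hypothesis c_axis : forall t : R, `|t| <= 2 -> ps c t 0 = delta - t ^+ 2 + t ^+ 3.
Hypothesis c_close : forall t s : R, `|t| <= 2 -> `|s| <= 2 ->
  [/\ `|ps (D1 c) t s - (3 * t ^+ 2 - 2 * t)| <= delta / 100,
      `|ps (D2 c) t s - 1| <= delta / 100,
      `|ps (D1 (D1 c)) t s - (6 * t - 2)| <= delta / 100,
      `|ps (D1 (D2 c)) t s| <= delta / 100 &
      `|ps (D2 (D2 c)) t s| <= delta / 100].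

Implicit Types (x y v : 'rV[R]_d.+1) (t s : R).

Let lam0 : 0 < lam. Proof. by case/andP: lam01. Qed.

Let unit_le t : 0 <= t <= 1 -> `|t| <= 2.
Proof. by move=> /andP[t0 t1]; rewrite ger0_norm//; lra. Qed.

Lemma profile_increase t s s' : 0 <= t <= 1 -> 0 <= s -> s <= s' -> s' <= 1 ->
  (1 - delta / 100) * (s' - s) <= ps c t s' - ps c t s
    <= (1 + delta / 100) * (s' - s).
Proof.
move=> t01 s0 ss' s1.
have t2 := unit_le t01.
have dF (r : R) : 0 <= r <= 1 -> is_derive r 1 (ps c t) (ps (D2 c) t r).
  move=> r01; have [K K0 T] := ps_taylor2 cok.
  apply: (@is_derive_quadratic _ _ _ _ _ _ K); near=> h.
  have h1 : `|h| <= 1 by near: h; exact: (@nbhs0_le _ R 1 ltr01).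
  have := T t r (h *: 1 + r) t2 (unit_le r01).
  rewrite [h *: 1]mulr1 addrK; apply.
  rewrite (le_trans (ler_normD _ _))// [`|r|]ger0_norm; last by case/andP: r01.
  by move: h1 r01; lra.
have cF : {within `[s, s'], continuous (ps c t)}.
  apply: derivable_within_continuous => r; rewrite in_itv/= => /andP[r0 r1].
  have r01 : 0 <= r <= 1 by rewrite (le_trans s0 r0) (le_trans r1 s1).
  by have [] := dF r r01.
have [z] := @MVT_segment _ (ps c t) (ps (D2 c) t) s s' ss'
  (fun r r01 => dF r (ltac:(move: r01; rewrite in_itv/= => /andP[r0 r1];
     by rewrite (ltW (le_lt_trans s0 r0))/= (ltW (lt_le_trans r1 s1))))) cF.
rewrite in_itv/= => /andP[z0 z1] ->.
have z01 : 0 <= z <= 1 by rewrite (le_trans s0)//= (le_trans z1).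
have [_ h _ _ _] := c_close t2 (unit_le z01).
move: h; rewrite ler_norml => /andP[h1 h2].
by rewrite !ler_wpM2r ?subr_ge0//; lra.
Unshelve. all: by end_near. Qed.

Lemma profile_lt0_down t s s' : 0 <= t <= 1 -> 0 <= s' -> s' <= s -> s <= 1 ->
  ps c t s < 0 -> ps c t s' < 0.
Proof.
move=> t01 s0 ss' s1 Fs; apply: le_lt_trans Fs; rewrite -subr_ge0.
have /andP[h _] := profile_increase t01 s0 ss' s1; apply: le_trans h.
by apply: mulr_ge0; move: de1 ss'; lra.
Qed.

(** The sublevel set stays off the faces of the box: for [t = 0] and [t = 1] the axis value is
    already [delta], and [s] is at most [2 g], where [g < 1/4]. Hence truncating to the box creates
    no extra boundary. *)
Lemma profile_le0_inside t s : 0 <= t <= 1 -> 0 <= s <= 1 -> ps c t s <= 0 ->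
  0 < t < 1 /\ s < 1.
Proof.
move=> t01 /andP[s0 s1] Fs; have Dle := de1; have Dgt := de0.
have /andP[h _] := profile_increase t01 (lexx 0) s0 s1.
have /andP[t0 t1] := t01.
rewrite subr0 (c_axis (unit_le t01)) in h.
have h1 : 2^-1 * s <= (1 - delta / 100) * s by rewrite ler_wpM2r//; lra.
split; last first.
  have : t ^+ 2 - t ^+ 3 <= 4^-1.
    have q : 0 <= t * (1 - t) by rewrite mulr_ge0// subr_ge0.
    have q1 : t * (1 - t) <= 4^-1 by have := sqr_ge0 (2^-1 - t); lra.
    have -> : t ^+ 2 - t ^+ 3 = t * (t * (1 - t)) by ring.
    by rewrite (le_trans _ q1)// ler_piMl.
  by lra.
rewrite !lt_neqAle t0 t1 !andbT; apply/andP; split; apply/eqP => tE.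
  have tp : t ^+ 2 - t ^+ 3 = 0 by rewrite -tE !expr0n subrr.
  lra.
have tp : t ^+ 2 - t ^+ 3 = 0 by rewrite tE !expr1n subrr.
lra.
Qed.

Lemma profile_zero_close t s : 0 <= t <= 1 -> 0 <= s <= 1 -> ps c t s = 0 ->
  `|s - (t ^+ 2 - t ^+ 3 - delta)| <= delta / 100.
Proof.
move=> t01 /andP[s0 s1] Fs; have Dle := de1; have Dgt := de0.
have /andP[h1 h2] := profile_increase t01 (lexx 0) s0 s1.
rewrite Fs subr0 (c_axis (unit_le t01)) in h1 h2.
have h3 : delta / 100 * s <= delta / 100 by rewrite ler_piMr//; lra.
by rewrite ler_norml; lra.
Qed.

Local Notation rd := (rad lam).
Local Notation fd := (field lam c).

Definition profile_domain : set 'rV[R]_d.+1 :=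
  [set x : 'rV[R]_d.+1 | 0 < x 0 ord0 < 1 /\ rd x < 1 /\ fd x < 0].

Definition profile_box : set 'rV[R]_d.+1 :=
  [set x : 'rV[R]_d.+1 | 0 < x 0 ord0 < 1 /\ rd x < 1].

Lemma profile_box_cyl x : profile_box x -> cyl lam x.
Proof.
move=> [/andP[h1 h2] h3]; split; last by lra.
by rewrite gtr0_norm//; lra.
Qed.

Lemma open_profile_box : open profile_box.
Proof.
have -> : profile_box = (fun x : 'rV[R]_d.+1 => x 0 ord0) @^-1` [set t | 0 < t]
  `&` (fun x : 'rV[R]_d.+1 => x 0 ord0) @^-1` [set t | t < 1]
  `&` rd @^-1` [set t | t < 1].
  apply/seteqP; split=> x /=; first by move=> [/andP[? ?] ?].
  by move=> [[? ?] ?]; split=> //; apply/andP.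
apply: openI; first apply: openI; apply: open_comp; try exact: open_lt; try exact: open_gt.
- by move=> x _; exact: (@continuous_coord _ _ ord0 x).
- by move=> x _; exact: (@continuous_coord _ _ ord0 x).
- by move=> x _; exact: (@continuous_rad _ _ lam x).
Qed.

Lemma open_profile_domain : open profile_domain.
Proof.
rewrite openE => x [x1 [x2 x3]].
have xB : profile_box x by [].
have cx := cvg_field lam0 cok (profile_box_cyl xB).
have n1 : nbhs x profile_box by apply: open_nbhs_nbhs; split=> //; exact: open_profile_box.
have n2 : \forall y \near x, fd y < 0 by exact: (cvgr_lt _ cx).
near=> y; have [y1 y2] : profile_box y by near: y.
by split=> //; split=> //; near: y.
Unshelve. all: by end_near. Qed.

Lemma closure_profile_domain x : closure profile_domain x ->
  [/\ profile_box x & fd x <= 0].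
Proof.
move=> cx.
have cl (A : set 'rV[R]_d.+1) : closed A -> profile_domain `<=` A -> A x.
  by move=> cA sA; have := closure_subset sA cx; rewrite -(iffLR (closure_id A) cA).
have h1 : 0 <= x 0 ord0.
  apply: (cl [set y : 'rV[R]_d.+1 | 0 <= y 0 ord0]).
    apply: (@preimage_closed _ _ (fun y : 'rV[R]_d.+1 => y 0 ord0) [set t | 0 <= t]).
      by move=> y _; exact: (@continuous_coord _ _ ord0 y).
    exact: closed_ge.
  by move=> y [/andP[/ltW ? _] _].
have h2 : x 0 ord0 <= 1.
  apply: (cl [set y : 'rV[R]_d.+1 | y 0 ord0 <= 1]).
    apply: (@preimage_closed _ _ (fun y : 'rV[R]_d.+1 => y 0 ord0) [set t | t <= 1]).
      by move=> y _; exact: (@continuous_coord _ _ ord0 y).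
    exact: closed_le.
  by move=> y [/andP[_ /ltW ?] _].
have h3 : rd x <= 1.
  apply: (cl [set y : 'rV[R]_d.+1 | rd y <= 1]).
    apply: (@preimage_closed _ _ rd [set t | t <= 1]).
      by move=> y _; exact: (@continuous_rad _ _ lam y).
    exact: closed_le.
  by move=> y [_ [/ltW ? _]].
have r0 := rad_ge0 lam0 x.
have cy : cyl lam x by split; [rewrite ger0_norm//; lra|lra].
have F0 : fd x <= 0.
  rewrite leNgt; apply/negP => Fx.
  have n2 : \forall y \near x, 0 < fd y.
    by exact: (cvgr_gt _ (cvg_field lam0 cok cy)).
  have [y [[_ [_ y1]] y2]] := cx _ n2.
  by move: y1; rewrite ltNge ltW.
have t01 : 0 <= x 0 ord0 <= 1 by rewrite h1.
have s01 : 0 <= rd x <= 1 by rewrite r0.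
by have [] := profile_le0_inside t01 s01 F0.
Qed.

Lemma boundary_profile_domain x : boundary profile_domain x ->
  profile_box x /\ fd x = 0.
Proof.
rewrite /boundary (iffLR (interior_id _) open_profile_domain) => -[cx nx].
have [[x1 x2] x3] := closure_profile_domain cx; split=> //.
apply/eqP; rewrite eq_le x3 /= leNgt; apply/negP => x4.
exact: nx.
Qed.

Lemma bounded_profile_domain : bounded_set profile_domain.
Proof.
have /andP[_ lam1] := lam01.
exists 1; split; first exact: num_real.
move=> M M1 x [/andP[x0 x1] [x2 _]]; apply: (le_trans _ (ltW M1)).
rewrite [leLHS]/Num.Def.normr/= mx_normrE.
apply: bigmax_le => //= -[i j] _ /=; rewrite (ord1 i).
case: (unliftP ord0 j) => [k|] -> ; last by rewrite gtr0_norm// ltW.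
have h : (x 0 (lift ord0 k)) ^+ 2 <= 1.
  apply: (@le_trans _ _ (rdot x x)).
    rewrite /rdot (bigD1 k)//= -expr2 lerDl sumr_ge0// => l _.
    by rewrite -expr2 sqr_ge0.
  move: x2; rewrite /rad mulrC ltr_pdivrMr// mul1r => /ltW h.
  exact: le_trans h lam1.
by rewrite -(@ler_sqr _ `|_| 1) ?nnegrE// real_normK ?num_real// expr1n.
Qed.

End ProfileDomain.

(** * Connectedness of the domain *)

Section Segments.
Context {R : realType} {V : normedModType R}.
Implicit Types p q : V.

Definition segment_path p q (r : R) : V := r *: p + (1 - r) *: q.

Lemma connected_segment_path p q :
  connected (segment_path p q @` `[0, 1]%classic).
Proof.
apply: connected_continuous_connected; first exact: segment_connected.
apply: continuous_subspaceT => r; apply: cvgD; apply: cvgZr_tmp.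
  exact: cvg_id.
by apply: cvgB; [exact: cvg_cst|exact: cvg_id].
Qed.

Lemma connected_by_two_segments (A : set V) p (m : V -> V) : A p ->
  (forall x, A x -> forall r, 0 <= r <= 1 -> A (segment_path x (m x) r)) ->
  (forall x, A x -> forall r, 0 <= r <= 1 -> A (segment_path (m x) p r)) ->
  connected A.
Proof.
move=> Ap H1 H2.
pose C x := segment_path x (m x) @` `[0, 1]%classic `|`
  segment_path (m x) p @` `[0, 1]%classic.
have i0 : `[0, 1]%classic (0 : R) by rewrite /= in_itv/= lexx ler01.
have i1 : `[0, 1]%classic (1 : R) by rewrite /= in_itv/= lexx ler01.
have e0 u v : segment_path u v 0 = v by rewrite /segment_path scale0r add0r subr0 scale1r.
have e1 u v : segment_path u v 1 = u by rewrite /segment_path subrr scale0r addr0 scale1r.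
have -> : A = \bigcup_(x in A) C x.
  apply/seteqP; split=> [x Ax|y [x Ax]].
    by exists x => //; left; exists 1 => //; exact: e1.
  by case=> [] [r]; rewrite /= in_itv/= => r01 <-; [exact: H1|exact: H2].
apply: bigcup_connected.
  by exists p => x Ax; right; exists 0 => //; exact: e0.
move=> x Ax; apply: connectedU; try exact: connected_segment_path.
by exists (m x); split; [exists 0 => //; exact: e0|exists 1 => //; exact: e1].
Qed.

End Segments.

Lemma segment_pathE (R : realType) n (p q : 'rV[R]_n) (r : R) i :
  segment_path p q r 0 i = r * p 0 i + (1 - r) * q 0 i.
Proof. by rewrite !mxE. Qed.

Lemma Ck_subset (R : realType) N k (A B : set 'rV[R]_N) (f : 'rV[R]_N -> R) :
  A `<=` B -> Ck k B f -> Ck k A f.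
Proof.
move=> AB; elim: k f => [|k IH] f [cf df]; split=> //.
- by move=> x; rewrite inE => Ax; apply: cf; rewrite inE; exact: AB.
- by move=> x; rewrite inE => Ax; apply: cf; rewrite inE; exact: AB.
move=> i; have [h1 h2] := df i; split; last exact: IH.
by move=> x /AB; exact: h1.
Qed.

Section ProfileTopology.
Context {R : realType}.
Variables (d : nat) (delta lam : R) (c : nat -> nat -> R).
Hypotheses (de0 : 0 < delta) (de1 : delta <= 432^-1).
Hypotheses (lam01 : 0 < lam <= 1) (cok : ps_ok c).
Hypothesis c_axis : forall t : R, `|t| <= 2 -> ps c t 0 = delta - t ^+ 2 + t ^+ 3.
Hypothesis c_close : forall t s : R, `|t| <= 2 -> `|s| <= 2 ->
  [/\ `|ps (D1 c) t s - (3 * t ^+ 2 - 2 * t)| <= delta / 100,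
      `|ps (D2 c) t s - 1| <= delta / 100,
      `|ps (D1 (D1 c)) t s - (6 * t - 2)| <= delta / 100,
      `|ps (D1 (D2 c)) t s| <= delta / 100 &
      `|ps (D2 (D2 c)) t s| <= delta / 100].

Implicit Types (x y v : 'rV[R]_d.+1) (t s : R).

Let lam0 : 0 < lam. Proof. by case/andP: lam01. Qed.

Definition axis_point t : 'rV[R]_d.+1 := t *: delta_mx 0 ord0.

Lemma axis_point0 t : axis_point t 0 ord0 = t.
Proof. by rewrite !mxE !eqxx mulr1. Qed.

Lemma axis_point_lift t i : axis_point t 0 (lift ord0 i) = 0.
Proof. by rewrite !mxE eqxx/= mulr0. Qed.

Lemma rad_axis_point t : rad lam (axis_point t) = 0.
Proof.
rewrite /rad /rdot big1 ?mulr0// => i _.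
by rewrite axis_point_lift mulr0.
Qed.

Lemma axis_point_domain t : 0 < t < 1 -> delta < t ^+ 2 - t ^+ 3 ->
  profile_domain lam c (axis_point t).
Proof.
move=> t01 tg; split; first by rewrite axis_point0.
rewrite /field rad_axis_point axis_point0 ltr01; split=> //.
rewrite c_axis; first lra.
by rewrite gtr0_norm; lra.
Qed.

Lemma axis_domain_gt x : profile_domain lam c x ->
  delta < x 0 ord0 ^+ 2 - x 0 ord0 ^+ 3.
Proof.
move=> [x1 [x2 x3]].
have t01 : 0 <= x 0 ord0 <= 1 by case/andP: x1 => h1 h2; rewrite !ltW.
have := profile_lt0_down de1 cok c_close t01 (lexx 0) (rad_ge0 lam0 x) (ltW x2) x3.
rewrite c_axis; first lra.
by rewrite gtr0_norm; lra.
Qed.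

(** A point first slides to the axis at constant [x_0], which lowers the profile as it increases in
    [s]. It then moves along the axis to [2/3], the maximum point of [t^2 - t^3], and [g] grows on
    the way. *)
Lemma connected_profile_domain : connected (@profile_domain R d lam c).
Proof.
apply: (@connected_by_two_segments _ _ _ (axis_point (2 / 3))
  (fun x => axis_point (x 0 ord0))).
- have Dle := de1; apply: axis_point_domain; first lra.
  have -> : (2 / 3) ^+ 2 - (2 / 3) ^+ 3 = 4 / 27 :> R by field.
  lra.
- move=> x Ax r r01; have [x1 [x2 x3]] := Ax.
  set y := segment_path _ _ _.
  have y0 : y 0 ord0 = x 0 ord0.
    by rewrite /y segment_pathE axis_point0; ring.
  have yi i : y 0 (lift ord0 i) = r * x 0 (lift ord0 i).
    by rewrite /y segment_pathE axis_point_lift; ring.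
  have ry : rad lam y = r ^+ 2 * rad lam x.
    rewrite /rad /rdot mulrCA; congr (_ * _); rewrite mulr_sumr.
    by apply: eq_bigr => i _; rewrite yi; ring.
  have ryx : rad lam y <= rad lam x.
    by rewrite ry ler_piMl ?rad_ge0// exprn_ile1//; case/andP: r01.
  split; first by rewrite y0.
  split; first exact: le_lt_trans ryx x2.
  rewrite /field y0.
  have t01 : 0 <= x 0 ord0 <= 1 by case/andP: x1 => h1 h2; rewrite !ltW.
  exact: (profile_lt0_down de1 cok c_close t01 (rad_ge0 lam0 y) ryx (ltW x2) x3).
- move=> x Ax r /andP[r0 r1]; have gx := axis_domain_gt Ax.
  have [/andP[t0 t1] _] := Ax.
  set t := x 0 ord0 in gx t0 t1 *.
  pose u := r * t + (1 - r) * (2 / 3).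
  have -> : segment_path (axis_point t) (axis_point (2 / 3)) r = axis_point u.
    by rewrite /segment_path /axis_point !scalerA -scalerDl.
  have [t2|t2] := leP t (2 / 3).
    have tu : t <= u.
      rewrite -subr_ge0 (_ : u - t = (1 - r) * (2 / 3 - t)); last by rewrite /u; ring.
      by rewrite mulr_ge0// subr_ge0.
    have u2 : u <= 2 / 3.
      rewrite -subr_ge0 (_ : _ - u = r * (2 / 3 - t)); last by rewrite /u; ring.
      by rewrite mulr_ge0// subr_ge0.
    have u0 : 0 < u by exact: lt_le_trans tu.
    apply: axis_point_domain; first by rewrite u0/=; lra.
    apply: (lt_le_trans gx); rewrite -subr_ge0.
    (* The cofactor [u + t - u^2 - u t - t^2] of [u - t] is split into four terms, each nonnegative
       on [[0, 2/3]]. *)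
    have -> : u ^+ 2 - u ^+ 3 - (t ^+ 2 - t ^+ 3) =
      (u - t) * (u * (2 / 3 - u) + t * (2 / 3 - t) + u * (3^-1 - t / 2) + t * (3^-1 - u / 2)).
      by field.
    apply: mulr_ge0; first by rewrite subr_ge0.
    have k1 : 0 <= u * (2 / 3 - u) by apply: mulr_ge0; lra.
    have k2 : 0 <= t * (2 / 3 - t) by apply: mulr_ge0; lra.
    have k3 : 0 <= u * (3^-1 - t / 2) by apply: mulr_ge0; lra.
    have k4 : 0 <= t * (3^-1 - u / 2) by apply: mulr_ge0; lra.
    lra.
  have ut : u <= t.
    rewrite -subr_ge0 (_ : t - u = (1 - r) * (t - 2 / 3)); last by rewrite /u; ring.
    by rewrite mulr_ge0// subr_ge0// ltW.
  have u2 : 2 / 3 <= u.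
    rewrite -subr_ge0 (_ : u - _ = r * (t - 2 / 3)); last by rewrite /u; ring.
    by rewrite mulr_ge0// subr_ge0 ltW.
  apply: axis_point_domain; first by rewrite (le_lt_trans ut t1) andbT; lra.
  apply: (lt_le_trans gx); rewrite -subr_ge0.
  have -> : u ^+ 2 - u ^+ 3 - (t ^+ 2 - t ^+ 3) =
    (t - u) * (u * (u - 2 / 3) + t * (t - 2 / 3) + u * (t / 2 - 3^-1) + t * (u / 2 - 3^-1)).
    by field.
  apply: mulr_ge0; first by rewrite subr_ge0.
  have k1 : 0 <= u * (u - 2 / 3) by apply: mulr_ge0; lra.
  have k2 : 0 <= t * (t - 2 / 3) by apply: mulr_ge0; lra.
  have k3 : 0 <= u * (t / 2 - 3^-1) by apply: mulr_ge0; lra.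
  have k4 : 0 <= t * (u / 2 - 3^-1) by apply: mulr_ge0; lra.
  lra.
Qed.

Lemma profile_domain_is_domain : domain (@profile_domain R d lam c).
Proof.
split; [exact: open_profile_domain| |exact: connected_profile_domain].
exists (axis_point (2 / 3)); have Dle := de1; apply: axis_point_domain; first lra.
have -> : (2 / 3) ^+ 2 - (2 / 3) ^+ 3 = 4 / 27 :> R by field.
lra.
Qed.

End ProfileTopology.

(** * Second fundamental form of a level set *)

Section NormalDerivative.
Context {R : realType} {N : nat}.
Implicit Types (x v w : 'rV[R]_N) (rho : 'rV[R]_N -> R).

Lemma dot_ge0 v : 0 <= dot v v.
Proof. by apply: sumr_ge0 => i _; rewrite -expr2 sqr_ge0. Qed.

Lemma dot_gt0 v : v != 0 -> 0 < dot v v.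
Proof.
move=> v0; rewrite lt_def dot_ge0 andbT; apply: contra v0 => /eqP dv.
have h j : true -> 0 <= v 0 j * v 0 j by rewrite -expr2 sqr_ge0.
apply/eqP/rowP => i; rewrite mxE; apply/eqP; rewrite -sqrf_eq0 expr2.
by have := psumr_eq0P h dv; move=> ->.
Qed.

Lemma derivable_sqrt (f : 'rV[R]_N -> R) x v : 0 < f x -> derivable f x v ->
  derivable (fun y => Num.sqrt (f y)) x v.
Proof.
move=> f0 /derivable1P df; apply/derivable1P.
have e0 : f (0 *: v + x) = f x by rewrite scale0r add0r.
have f0' : 0 < f (0 *: v + x) by rewrite e0.
have h1 := is_derive1_sqrt f0'.
have h2 := derivableP df.
have h3 := @is_derive1_comp R Num.sqrt (fun h => f (h *: v + x)) 0 _ _ h1 h2.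
by have [] := h3.
Qed.

(** Differentiating the normalizing factor gives a multiple of the gradient, orthogonal to the
    tangent vector [v]; what remains is the Hessian divided by the length of the gradient. *)
Lemma second_fundamental_form_tangent rho x v :
  (forall j, derivable (partial j rho) x v) -> grad rho x != 0 ->
  dot v (unit_normal rho x) = 0 ->
  second_fundamental_form rho x v v =
    (Num.sqrt (dot (grad rho x) (grad rho x)))^-1 *
    \sum_(j < N) 'D_v (partial j rho) x * v 0 j.
Proof.
move=> dp g0 vn.
pose n2 y := dot (grad rho y) (grad rho y).
pose m y := (Num.sqrt (n2 y))^-1.
have n20 : 0 < n2 x by exact: dot_gt0.
have s0 : 0 < Num.sqrt (n2 x) by rewrite sqrtr_gt0.
have m0 : m x != 0 by rewrite invr_eq0 gt_eqF.
have dn2 : derivable n2 x v.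
  have -> : n2 = \sum_(j < N) (partial j rho * partial j rho).
    apply/funext => y; rewrite /n2 /dot fct_sumE; apply: eq_bigr => j _.
    by rewrite !mxE.
  by apply: derivable_sum => j; exact: derivableM.
have dm : derivable m x v.
  by apply: derivableV; [rewrite gt_eqF|exact: derivable_sqrt].
have entry j : (fun y => unit_normal rho y 0 j) = (fun y => m y * partial j rho y).
  by apply/funext => y; rewrite !mxE.
have de j : is_derive x v (fun y => m y * partial j rho y)
    (m x * 'D_v (partial j rho) x + partial j rho x * 'D_v m x).
  exact: (is_deriveM (derivableP dm) (derivableP (dp j))).
have dn : derivable (unit_normal rho) x v.
  apply/derivable_mxP => i j; rewrite (ord1 i) entry.
  by have [] := de j.
rewrite /second_fundamental_form derive_mx// /dot.
have vg : \sum_(j < N) partial j rho x * v 0 j = 0.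
  apply: (mulfI m0); rewrite mulr0 mulr_sumr; transitivity (dot v (unit_normal rho x)) => //.
  apply: eq_bigr => j _; rewrite !mxE -/(n2 x) -/(m x); ring.
rewrite -/(n2 x) -/(m x).
transitivity (\sum_(j < N) (m x * ('D_v (partial j rho) x * v 0 j) +
    'D_v m x * (partial j rho x * v 0 j))).
  apply: eq_bigr => j _; rewrite mxE entry; have [_ ->] := de j.
  by ring.
by rewrite big_split/= -!mulr_sumr vg mulr0 addr0.
Qed.

End NormalDerivative.

Lemma axial_slope_le (R : realType) (t a eps : R) : 0 <= t -> t <= 1 ->
  `|a - (3 * t ^+ 2 - 2 * t)| <= eps -> eps <= 1 -> `|a| <= 2.
Proof.
move=> t0 t1; rewrite !ler_norml => /andP[a1 a2] e1.
have t2 : 0 <= t ^+ 2 <= t by rewrite exprn_ge0//= expr2 ler_piMl.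
have t3 : 2 * t - 1 <= t ^+ 2 by have := sqr_ge0 (1 - t); lra.
lra.
Qed.

(** * Smoothness and uniform convexity of the boundary *)

Section ProfileBoundary.
Context {R : realType}.
Variables (d : nat) (delta lam : R) (c : nat -> nat -> R).
Hypotheses (de0 : 0 < delta) (de1 : delta <= 432^-1).
Hypotheses (lam01 : 0 < lam <= 1) (cok : ps_ok c).
Hypothesis c_axis : forall t : R, `|t| <= 2 -> ps c t 0 = delta - t ^+ 2 + t ^+ 3.
Hypothesis c_close : forall t s : R, `|t| <= 2 -> `|s| <= 2 ->
  [/\ `|ps (D1 c) t s - (3 * t ^+ 2 - 2 * t)| <= delta / 100,
      `|ps (D2 c) t s - 1| <= delta / 100,
      `|ps (D1 (D1 c)) t s - (6 * t - 2)| <= delta / 100,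
      `|ps (D1 (D2 c)) t s| <= delta / 100 &
      `|ps (D2 (D2 c)) t s| <= delta / 100].

Implicit Types (x y v : 'rV[R]_d.+1) (t s : R).

Let lam0 : 0 < lam. Proof. by case/andP: lam01. Qed.

Local Notation Om := (@profile_domain R d lam c).
Local Notation rho := (@field R d lam c).

(** A defining function may have no critical point in its neighbourhood, and [field] can have some
    on the axis. Its transverse gradient is a positive multiple of [x'], so this inequality removes
    exactly the critical points in the box; the same open set then serves every boundary point. *)
Definition regular_box : set 'rV[R]_d.+1 :=
  [set x | @profile_box R d lam x /\ 0 < field lam (D1 c) x ^+ 2 + rdot x x].

Lemma regular_box_cyl x : regular_box x -> cyl lam x.
Proof. by move=> [h _]; exact: (profile_box_cyl h). Qed.

Lemma open_regular_box : open regular_box.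
Proof.
rewrite openE => x [x1 x2].
have cy : cyl lam x := profile_box_cyl x1.
have n1 : nbhs x (@profile_box R d lam).
  by apply: open_nbhs_nbhs; split=> //; exact: open_profile_box.
have cf := cvg_field lam0 (ps_ok_D1 cok) cy.
have F := nbhs_filter x.
have cG : (fun y => field lam (D1 c) y * field lam (D1 c) y + rdot y y) @ x -->
    field lam (D1 c) x * field lam (D1 c) x + rdot x x.
  exact: (@cvgD _ _ _ _ F _ _ _ _ (@cvgM _ _ _ F _ _ _ _ cf cf) (@continuous_rdot R d x)).
have n2 : \forall y \near x, 0 < field lam (D1 c) y * field lam (D1 c) y + rdot y y.
  by apply: (cvgr_gt _ cG); rewrite -expr2.
near=> y; split; first by near: y.
by rewrite expr2; near: y.
Unshelve. all: by end_near. Qed.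

Lemma gradE0 x : cyl lam x -> grad rho x 0 ord0 = field lam (D1 c) x.
Proof. by move=> cx; rewrite mxE partial_field0. Qed.

Lemma gradE_lift x i : cyl lam x -> grad rho x 0 (lift ord0 i) =
  2 * lam^-1 * x 0 (lift ord0 i) * field lam (D2 c) x.
Proof. by move=> cx; rewrite mxE partial_field_lift. Qed.

Let box_range x : @profile_box R d lam x ->
  [/\ 0 <= x 0 ord0 , x 0 ord0 <= 1, 0 <= rad lam x & rad lam x <= 1].
Proof.
by move=> [/andP[/ltW x0 /ltW x1] /ltW x2]; split=> //; exact: rad_ge0.
Qed.

Let box_le2 x : @profile_box R d lam x -> `|x 0 ord0| <= 2 /\ `|rad lam x| <= 2.
Proof. by move=> bx; apply: (cyl_le lam0 (profile_box_cyl bx)). Qed.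

Let D2_gt0 x : @profile_box R d lam x -> 0 < field lam (D2 c) x.
Proof.
move=> bx; have [h1 h2] := box_le2 bx.
have [_ h _ _ _] := c_close h1 h2; move: h; rewrite -/(field lam (D2 c) x) ler_norml.
by have := de1; lra.
Qed.

Lemma grad_regular_neq0 x : regular_box x -> grad rho x != 0.
Proof.
move=> rx; have cx := regular_box_cyl rx; have [bx x2] := rx.
apply/eqP => g0; move: x2.
have := gradE0 cx; rewrite g0 mxE => <-.
have -> : rdot x x = 0.
  apply: big1 => i _; have := gradE_lift i cx; rewrite g0 mxE => /esym/eqP.
  rewrite !mulf_eq0 invr_eq0 pnatr_eq0 (gt_eqF lam0) (gt_eqF (D2_gt0 bx)) /= orbF.
  by move=> /eqP ->; rewrite mul0r.
by rewrite expr0n addr0 ltxx.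
Qed.

Let zero_close x : @profile_box R d lam x -> rho x = 0 ->
  `|rad lam x - (x 0 ord0 ^+ 2 - x 0 ord0 ^+ 3 - delta)| <= delta / 100.
Proof.
move=> bx fx; have [x0 x1 s0 s1] := box_range bx.
by apply: (profile_zero_close de0 de1 cok c_axis c_close) => //; apply/andP.
Qed.

(** Only boundary points on the axis are in doubt. There [s = 0], and the discriminant bound becomes
    [delta <= a ^+ 2 * f], so the axial derivative [a] is nonzero. *)
Lemma boundary_regular x : boundary Om x -> regular_box x.
Proof.
move=> bdx.
have [bx fx] := boundary_profile_domain de0 de1 lam01 cok c_axis c_close bdx.
split=> //.
have [x0 x1 s0 s1] := box_range bx.
have [h1 h2] := box_le2 bx.
have [k1 k2 k3 k4 k5] := c_close h1 h2.
have := curvature_discriminant_ge de0 de1 erefl x0 x1 s0 s1 (zero_close bx fx) k1 k2 k3 k4 k5.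
rewrite -/(field lam (D1 c) x).
have [r0|r0] := eqVneq (rdot x x) 0; last first.
  by move=> _; rewrite ltr_wpDl ?sqr_ge0// lt_def r0 rdot_ge0.
have -> : rad lam x = 0 by rewrite /rad r0 mulr0.
rewrite mulr0 mul0r add0r r0 addr0 => E.
rewrite lt_def sqr_ge0 andbT; apply/eqP => a0.
by move: E; rewrite a0 mul0r leNgt de0.
Qed.

Lemma profile_local_defining x : boundary Om x ->
  local_defining_function Om x regular_box rho.
Proof.
move=> bdx; split.
- exact: open_regular_box.
- exact: boundary_regular.
- by move=> k; apply: (Ck_subset regular_box_cyl); exact: smooth_field.
- by move=> y [[y1 y2] _]; split=> [[_ []]//|y3]; split.
- exact: grad_regular_neq0.
Qed.

Lemma profile_smooth_boundary : smooth_boundary Om.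
Proof. by move=> x bdx; exists regular_box, rho; exact: profile_local_defining. Qed.

Lemma is_derive_partial0 x v : cyl lam x ->
  is_derive x v (partial ord0 rho)
    (v 0 ord0 * field lam (D1 (D1 c)) x +
     2 * lam^-1 * rdot x v * field lam (D1 (D2 c)) x).
Proof.
move=> cx; rewrite D1D2C.
apply: (near_eq_is_derive (f := field lam (D1 c))).
  apply: filterS (open_nbhs_nbhs (conj (@open_cyl R d lam) cx)) => y cy.
  by rewrite partial_field0.
exact (is_derive_field lam0 v (ps_ok_D1 cok) cx).
Qed.

Lemma is_derive_partial_lift x v i : cyl lam x ->
  is_derive x v (partial (lift ord0 i) rho)
    (2 * lam^-1 * (x 0 (lift ord0 i) *
      (v 0 ord0 * field lam (D1 (D2 c)) x +
        2 * lam^-1 * rdot x v * field lam (D2 (D2 c)) x) +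
      v 0 (lift ord0 i) * field lam (D2 c) x)).
Proof.
move=> cx.
apply: (near_eq_is_derive (f := fun y => 2 * lam^-1 *
    (y 0 (lift ord0 i) * field lam (D2 c) y))).
  apply: filterS (open_nbhs_nbhs (conj (@open_cyl R d lam) cx)) => y cy.
  by rewrite partial_field_lift// mulrA.
have h1 := is_derive_coord (lift ord0 i) x v.
have h2 := is_derive_field lam0 v (ps_ok_D2 cok) cx.
have h3 := is_deriveZ (2 * lam^-1) (is_deriveM h1 h2).
apply: (is_derive_eq h3).
rewrite -[RHS]/((2 * lam^-1) *: _); congr (_ *: (_ + _)).
by rewrite mulrC.
Qed.

Lemma profile_uniformly_strictly_convex : uniformly_strictly_convex Om.
Proof.
have D44 : 0 < 8 * (delta + 44) by rewrite mulr_gt0// addr_gt0.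
pose c0 := delta / (8 * (delta + 44)).
have c00 : 0 < c0 by rewrite divr_gt0.
(* [12 / lam] bounds the squared length of the gradient: at most 4 from the axial part and [8 / lam]
   from the transverse part [4 f^2 s / lam]. *)
have b0 : 0 < 12 / lam by rewrite divr_gt0.
have s0 : 0 < Num.sqrt (12 / lam) by rewrite sqrtr_gt0.
exists ((Num.sqrt (12 / lam))^-1 * c0); first by rewrite mulr_gt0 ?invr_gt0.
move=> x bdx; exists regular_box, rho; split; first exact: profile_local_defining.
move=> v vn.
have rx := boundary_regular bdx; have cx := regular_box_cyl rx.
have [bx fx] := boundary_profile_domain de0 de1 lam01 cok c_axis c_close bdx.
have [x0 x1 r0 r1] := box_range bx.
have [h1 h2] := box_le2 bx.
have [k1 k2 k3 k4 k5] := c_close h1 h2.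
have g0 := grad_regular_neq0 rx.
set a := ps (D1 c) _ _ in k1; set f := ps (D2 c) _ _ in k2.
set h := ps (D1 (D1 c)) _ _ in k3; set k := ps (D1 (D2 c)) _ _ in k4.
set l := ps (D2 (D2 c)) _ _ in k5.
have dp j : derivable (partial j rho) x v.
  case: (unliftP ord0 j) => [i|] ->; first by have [] := is_derive_partial_lift v i cx.
  by have [] := is_derive_partial0 v cx.
rewrite (second_fundamental_form_tangent dp g0 vn).
set n2 := dot (grad rho x) (grad rho x).
have n20 : 0 < n2 by exact: dot_gt0.
pose tau := v 0 ord0; pose w := lam^-1 * rdot x v; pose Z := lam^-1 * rdot v v.
have il0 : 0 < lam^-1 by rewrite invr_gt0.
have tang : a * tau + 2 * w * f = 0.
  have : dot v (grad rho x) = 0.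
    apply: (mulfI (_ : (Num.sqrt n2)^-1 != 0)).
      by rewrite invr_eq0 gt_eqF// sqrtr_gt0.
    rewrite mulr0 /dot mulr_sumr; transitivity (dot v (unit_normal rho x)) => //.
    apply: eq_bigr => j _; rewrite [in RHS]mxE -/n2; ring.
  rewrite dotE gradE0// -/tau => <-; rewrite mulrC; congr (_ + _).
  rewrite /w /rdot mulr_sumr mulr_sumr mulr_suml; apply: eq_bigr => i _.
  by rewrite gradE_lift// -[field lam (D2 c) x]/f; ring.
have sumE : \sum_(j < d.+1) 'D_v (partial j rho) x * v 0 j =
    h * tau ^+ 2 + 4 * k * tau * w + 4 * l * w ^+ 2 + 2 * f * Z.
  have [_ E0] := is_derive_partial0 v cx.
  have EL i : 'D_v (partial (lift ord0 i) rho) x * v 0 (lift ord0 i) =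
      2 * lam^-1 * (tau * k + 2 * w * l) * (x 0 (lift ord0 i) * v 0 (lift ord0 i)) +
      2 * lam^-1 * f * (v 0 (lift ord0 i) * v 0 (lift ord0 i)).
    have [_ E] := is_derive_partial_lift v i cx.
    apply: (etrans (congr1 (fun z => z * v 0 (lift ord0 i)) E)).
    rewrite -[field lam (D1 (D2 c)) x]/k -[field lam (D2 (D2 c)) x]/l.
    by rewrite -[field lam (D2 c) x]/f -/tau /w; ring.
  transitivity ((v 0 ord0 * h + 2 * lam^-1 * rdot x v * k) * v 0 ord0 +
    (2 * lam^-1 * (tau * k + 2 * w * l) * rdot x v + 2 * lam^-1 * f * rdot v v)).
    rewrite big_ord_recl; congr (_ + _).
      exact: (congr1 (fun z => z * v 0 ord0) E0).
    apply: (etrans (eq_bigr _ (fun i _ => EL i))).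
    by rewrite big_split/= -!mulr_sumr.
  by rewrite -/tau /w /Z; ring.
have wZ : w ^+ 2 <= rad lam x * Z.
  have -> : w ^+ 2 = lam^-1 ^+ 2 * rdot x v ^+ 2 by rewrite /w exprMn.
  have -> : rad lam x * Z = lam^-1 ^+ 2 * (rdot x x * rdot v v).
    by rewrite /rad /Z; ring.
  by rewrite ler_pM2l ?exprn_gt0// rdot_CauchySchwarz.
have Z0 : 0 <= Z by rewrite mulr_ge0 ?rdot_ge0// ltW.
have Q := curvature_form_ge de0 de1 erefl x0 x1 r0 r1 (zero_close bx fx)
  k1 k2 k3 k4 k5 tang wZ Z0.
rewrite sumE.
have dvv : dot v v <= tau ^+ 2 + Z.
  rewrite dotE -expr2 -/tau lerD2l /Z ler_peMl ?rdot_ge0//.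
  by rewrite invf_ge1//; case/andP: lam01.
have n2le : n2 <= 12 / lam.
  have -> : n2 = a ^+ 2 + 4 * f ^+ 2 * rad lam x / lam.
    rewrite /n2 dotE gradE0// -expr2 -/a; congr (_ + _).
    rewrite /rad /rdot !(mulr_sumr, mulr_suml); apply: eq_bigr => i _.
    rewrite gradE_lift// -[field lam (D2 c) x]/f; ring.
  have lam1 : 1 <= lam^-1 by rewrite invf_ge1//; case/andP: lam01.
  have a2 : a ^+ 2 <= 4.
    have a1 : `|a| <= 2 ^+ 1.
      by rewrite expr1; apply: (axial_slope_le x0 x1 k1); have := de1; lra.
    rewrite -(real_normK (num_real a)) (_ : 4 = 2 ^+ 2); last by ring.
    by rewrite lerXn2r ?nnegrE.
  have f2 : f ^+ 2 * rad lam x <= 2.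
    have f1 : f ^+ 2 <= 2.
      have f0 : 0 <= f <= 5 / 4 by move: k2; rewrite ler_norml; have := de1; lra.
      have /andP[f00 f01] := f0.
      by rewrite expr2 (le_trans (ler_pM f00 f00 f01 f01))//; lra.
    by rewrite (le_trans _ f1)// ler_piMr// sqr_ge0.
  apply: (@le_trans _ _ (4 * lam^-1 + 8 * lam^-1)); last by rewrite -mulrDl; lra.
  apply: lerD; first by rewrite (le_trans a2)// ler_peMr.
  by rewrite ler_pM2r//; lra.
apply: (@le_trans _ _ ((Num.sqrt (12 / lam))^-1 * (c0 * (tau ^+ 2 + Z)))).
  rewrite -mulrA; apply: ler_wpM2l; first by rewrite invr_ge0 ltW.
  by apply: ler_wpM2l => //; exact: ltW.
apply: ler_pM; [| |  |exact: Q].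
- by rewrite invr_ge0 ltW.
- by rewrite mulr_ge0 ?(ltW c00)// addr_ge0// sqr_ge0.
- by rewrite lef_pV2 ?posrE ?sqrtr_gt0// ler_wsqrtr.
Qed.

End ProfileBoundary.

(** * The classical solution and the failure of concavity *)

Section ProfileSolution.
Context {R : realType}.
Variables (d : nat) (delta lam : R) (c : nat -> nat -> R).
Hypotheses (de0 : 0 < delta) (de1 : delta <= 432^-1).
Hypotheses (lam01 : 0 < lam <= 1) (cok : ps_ok c).
Hypothesis c_axis : forall t : R, `|t| <= 2 -> ps c t 0 = delta - t ^+ 2 + t ^+ 3.
Hypothesis c_close : forall t s : R, `|t| <= 2 -> `|s| <= 2 ->
  [/\ `|ps (D1 c) t s - (3 * t ^+ 2 - 2 * t)| <= delta / 100,
      `|ps (D2 c) t s - 1| <= delta / 100,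
      `|ps (D1 (D1 c)) t s - (6 * t - 2)| <= delta / 100,
      `|ps (D1 (D2 c)) t s| <= delta / 100 &
      `|ps (D2 (D2 c)) t s| <= delta / 100].
Variable k : R.
Hypothesis c_eq : forall t s : R, `|t| < 2 -> `|s| < 2 ->
  lam * ps (D1 (D1 c)) t s +
    (2 * d%:R * ps (D2 c) t s + 4 * s * ps (D2 (D2 c)) t s) =
  lam * k^-1 * expR (k * ps c t s).
Hypothesis k0 : k != 0.

Definition profile_solution : 'rV[R]_d.+1 -> R :=
  field lam (fun i j => k * c i j).

Let lam0 : 0 < lam. Proof. by case/andP: lam01. Qed.

Lemma field_scale (b : nat -> nat -> R) (x : 'rV[R]_d.+1) : ps_ok b -> cyl lam x ->
  field lam (fun i j => k * b i j) x = k * field lam b x.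
Proof.
move=> bok [/ltW x1 x2]; rewrite /field psZ//.
by rewrite ger0_norm ?rad_ge0// ltW.
Qed.

Lemma profile_solution_laplacian x : cyl lam x ->
  laplacian profile_solution x = expR (profile_solution x).
Proof.
move=> cx; have l0 : lam != 0 by rewrite gt_eqF.
rewrite laplacian_field//; last exact: ps_okZ.
have -> : D1 (D1 (fun i j => k * c i j)) = fun i j => k * D1 (D1 c) i j.
  by apply/funext => i; apply/funext => j; rewrite /D1; ring.
have -> : D2 (D2 (fun i j => k * c i j)) = fun i j => k * D2 (D2 c) i j.
  by apply/funext => i; apply/funext => j; rewrite /D2; ring.
have -> : D2 (fun i j => k * c i j) = fun i j => k * D2 c i j.
  by apply/funext => i; apply/funext => j; rewrite /D2; ring.
rewrite /profile_solution !field_scale//; try by repeat (apply: ps_ok_D1 || apply: ps_ok_D2).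
have [x1 x2] := cx.
have x2' : `|rad lam x| < 2 by rewrite ger0_norm// rad_ge0.
have h := c_eq x1 x2'.
rewrite -[field lam c x]/(ps c (x 0 ord0) (rad lam x)).
have -> : expR (k * ps c (x 0 ord0) (rad lam x)) = k / lam *
   (lam * k^-1 * expR (k * ps c (x 0 ord0) (rad lam x))).
  by field; rewrite l0 k0.
rewrite -h /field; field.
exact: l0.
Qed.

Lemma profile_solution_classical :
  classical_solution (@profile_domain R d lam c) profile_solution.
Proof.
have kok := ps_okZ k cok.
have subC x : profile_domain lam c x -> @cyl R d lam x.
  by move=> [x1 [x2 _]]; apply: profile_box_cyl.
split.
- by apply: (Ck_subset subC); exact: smooth_field.
- apply: continuous_in_subspaceT => x; rewrite inE => clx.
  apply: cvg_field => //; apply: profile_box_cyl.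
  by have [] := closure_profile_domain de0 de1 lam01 cok c_axis c_close clx.
- by move=> x /subC; exact: profile_solution_laplacian.
- move=> x bdx.
  have [bx fx] := boundary_profile_domain de0 de1 lam01 cok c_axis c_close bdx.
  by rewrite /profile_solution field_scale ?fx ?mulr0//; exact: profile_box_cyl.
Qed.

Lemma profile_solution_axis t : `|t| <= 2 ->
  profile_solution (axis_point d t) = - k * (t ^+ 2 - t ^+ 3 - delta).
Proof.
move=> t2; rewrite /profile_solution /field rad_axis_point axis_point0 psZ//.
  by rewrite c_axis//; ring.
by rewrite normr0.
Qed.

End ProfileSolution.

Lemma concave_midpoint (R : realType) N (D : set 'rV[R]_N) (f : 'rV[R]_N -> R) x y :
  concave_function D f -> D x -> D y ->
  2^-1 * f x + 2^-1 * f y <= f (2^-1 *: x + 2^-1 *: y).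
Proof.
move=> cf Dx Dy.
have h0 : 0 <= 2^-1 :> R by lra.
have h1 : 2^-1 <= 1 :> R by lra.
have := cf (Itv01 h0 h1) x y.
rewrite !inE => /(_ Dx Dy).
rewrite convRE /= => h.
have : - f (2^-1 *: x + (1 - 2^-1) *: y) <= 2^-1 * - f x + (1 - 2^-1) * - f y by exact: h.
have -> : 1 - 2^-1 = 2^-1 :> R by field.
by lra.
Qed.

(** Here [theta = 2^(-1/alpha)], and [theta > 1/4] says exactly that [alpha > 1/2]. The number [1/4]
    is the limiting ratio of [t^2] at the midpoint of [[0, e]] to its value at [e]. *)
Lemma half_powR_exponent (R : realType) (alpha : R) : 2^-1 < alpha ->
  exists theta : R, [/\ 4^-1 < theta, theta < 1 & theta `^ alpha = 2^-1].
Proof.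
move=> ha; have a0 : 0 < alpha by lra.
have h0 : 0 < 2^-1 :> R by lra.
have e1 : (2^-1 `^ alpha^-1) `^ alpha = 2^-1 :> R.
  by rewrite -powRrM mulVf ?gt_eqF// powRr1// ltW.
have p0 : 0 < 2^-1 `^ alpha^-1 :> R by exact: powR_gt0.
exists (2^-1 `^ alpha^-1); split=> //.
- have l0 : ln 2^-1 < 0 :> R by apply: ln_lt0; lra.
  rewrite -ltr_ln ?posrE ?invr_gt0// ln_powR.
  have -> : 4^-1 = 2^-1 ^+ 2 :> R by field.
  rewrite lnXn// -(mulr_natl (ln _)) ltr_nM2r// invf_plt ?posrE//.
- rewrite ltNge; apply/negP => h.
  have : 1 `^ alpha <= (2^-1 `^ alpha^-1) `^ alpha :> R.
    by apply: ge0_ler_powR => //; rewrite ?nnegrE ltW//; lra.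
  by rewrite e1 powR1; lra.
Qed.

(** The midpoint value is [(1/4 + O(e))] times [g e], and [theta = 1/4 + 4 e] leaves room for the
    error. The condition [theta < 1] gives [e < 3/16], which settles all smallness requirements.
    Taking [delta = e^4 / 4] keeps [g] positive already at [e^2]. *)
Lemma thin_profile_values (R : realType) (theta e : R) :
  4^-1 < theta -> theta < 1 -> e = (theta - 4^-1) / 4 ->
  let g t := t ^+ 2 - t ^+ 3 - e ^+ 4 / 4 in
  [/\ e ^+ 4 / 4 <= 432^-1, 0 < e ^+ 2 < 1, 0 < e < 1 &
     [/\ 0 < g (e ^+ 2), 0 < g e, 0 < g ((e + e ^+ 2) / 2) &
      g ((e + e ^+ 2) / 2) < theta * g e]].
Proof.
move=> h1 h2 he g.
have e0 : 0 < e by lra.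
have e1 : e < 3 / 16 by lra.
have th : theta = 4^-1 + 4 * e by lra.
have s1 : e ^+ 2 < 3 / 16 * e by rewrite expr2 ltr_pM2r.
have s0 : 0 < e ^+ 2 by rewrite exprn_gt0.
have c1 : e ^+ 4 <= (3 / 16) ^+ 4 by rewrite lerXn2r ?nnegrE ?ltW//; lra.
have ab : g (e ^+ 2) = e ^+ 4 * (3 / 4 - e ^+ 2) by rewrite /g; field.
have b : g e = e ^+ 2 * (1 - e - e ^+ 2 / 4) by rewrite /g; field.
have bb : g ((e + e ^+ 2) / 2) =
  e ^+ 2 / 4 * ((1 + e) ^+ 2 * (1 - (e + e ^+ 2) / 2) - e ^+ 2) by rewrite /g; field.
split; [|by lra|by lra|split].
- by apply: (le_trans (y := (3 / 16) ^+ 4 / 4)); [lra|lra].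
- by rewrite ab mulr_gt0 ?exprn_gt0//; lra.
- by rewrite b mulr_gt0//; lra.
- rewrite bb mulr_gt0 ?divr_gt0// subr_gt0.
  by nra.
- rewrite bb b th -subr_gt0.
  have -> : (4^-1 + 4 * e) * (e ^+ 2 * (1 - e - e ^+ 2 / 4)) -
    e ^+ 2 / 4 * ((1 + e) ^+ 2 * (1 - (e + e ^+ 2) / 2) - e ^+ 2) =
    e ^+ 2 * (e * (27 / 8 - 59 / 16 * e - 5 / 8 * e ^+ 2 + e ^+ 3 / 8)) by field.
  have c0 : 0 < e ^+ 3 by rewrite exprn_gt0.
  by rewrite !mulr_gt0//; lra.
Qed.

(* The values of [- u] must be positive since [a `^ r] is 1 for [a < 0]. *)
Lemma not_concave_powR (R : realType) N (D : set 'rV[R]_N) (u : 'rV[R]_N -> R)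
    x y (alpha theta : R) :
  0 < alpha -> 0 <= theta -> theta `^ alpha = 2^-1 -> D x -> D y ->
  0 < - u (2^-1 *: x + 2^-1 *: y) -> 0 < - u y ->
  - u (2^-1 *: x + 2^-1 *: y) < theta * - u y ->
  ~ concave_function D (fun z => (- u z) `^ alpha).
Proof.
move=> a0 t0 ta Dx Dy um uy lt cf.
have := concave_midpoint cf Dx Dy; apply/negP; rewrite -ltNge.
apply: (lt_le_trans (y := 2^-1 * (- u y) `^ alpha)).
  have -> : 2^-1 * (- u y) `^ alpha = (theta * - u y) `^ alpha.
    by rewrite powRM ?(ltW uy)// ta.
  have m0 : - u (2^-1 *: x + 2^-1 *: y) \is Num.nneg by rewrite nnegrE ltW.
  have y0 : theta * - u y \is Num.nneg by rewrite nnegrE mulr_ge0// ltW.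
  exact: (gt0_ltr_powR a0 m0 y0 lt).
by rewrite lerDr mulr_ge0 ?powR_ge0 ?invr_ge0.
Qed.

Theorem mainTheorem5 (R : realType) (N : nat) (hN : (2 <= N)%N)
    (alpha : R) (halpha : 2^-1 < alpha) :
  exists Omega : set 'rV[R]_N,
    [/\ domain Omega,
        bounded_set Omega,
        smooth_boundary Omega,
        uniformly_strictly_convex Omega &
        exists u : 'rV[R]_N -> R,
          unique_classical_solution Omega u /\
          ~ concave_function Omega (fun x => (- u x) `^ alpha)].
Proof.
case: N hN => [//|d] hN; have d0 : (0 < d)%N by [].
have [theta [th1 th2 thalpha]] := half_powR_exponent halpha.
pose e := (theta - 4^-1) / 4; pose delta := e ^+ 4 / 4.
have [de1 a01 b01 [ga gb gm gmb]] := thin_profile_values th1 th2 (erefl e).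
have de0 : 0 < delta by case/andP: b01 => e0 _; rewrite divr_gt0 ?exprn_gt0.
have de01 : 0 < delta <= 1 by rewrite de0/=; apply: (le_trans de1); lra.
have eta0 : 0 < delta / 100 by rewrite divr_gt0.
(* The tolerance is the [eta = delta / 100] of the curvature estimates; [delta] depends on [alpha]
   alone, so [lam] may be chosen after it. *)
have [lam [c [lam01 cok c_eq c_axis c_close]]] := profile_exists d0 de01 eta0.
have /andP[lam0 lam1] := lam01.
have d0' : 0 < 2 * d%:R :> R by rewrite mulr_gt0 ?ltr0n.
pose k := lam / (2 * d%:R).
have kgt0 : 0 < k by rewrite divr_gt0.
have k0 : k != 0 by rewrite gt_eqF.
have c_eq' (t s : R) : `|t| < 2 -> `|s| < 2 ->
  lam * ps (D1 (D1 c)) t s +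
    (2 * d%:R * ps (D2 c) t s + 4 * s * ps (D2 (D2 c)) t s) =
  lam * k^-1 * expR (k * ps c t s).
  have -> : lam * k^-1 = 2 * d%:R by rewrite /k invf_div mulrC divfK ?gt_eqF.
  exact: c_eq.
have oOm := open_profile_domain (d := d) lam01 cok.
have bOm := @bounded_profile_domain R d lam c lam01.
exists (profile_domain lam c); split.
- exact: (profile_domain_is_domain d de1 lam01 cok c_axis c_close).
- exact: bOm.
- exact: (profile_smooth_boundary de0 de1 lam01 cok c_axis c_close).
- exact: (profile_uniformly_strictly_convex d de0 de1 lam01 cok c_axis c_close).
exists (profile_solution (d := d) lam c k); split.
  apply: classical_solution_unique oOm bOm _.
  exact: (profile_solution_classical de0 de1 lam01 cok c_axis c_close c_eq' k0).
have uE (t : R) : 0 < t < 1 ->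
  - profile_solution lam c k (axis_point d t) = k * (t ^+ 2 - t ^+ 3 - delta).
  move=> /andP[t0 t1]; rewrite (profile_solution_axis d lam cok c_axis); last first.
    by rewrite gtr0_norm//; lra.
  by rewrite mulNr opprK.
have mE : 2^-1 *: axis_point d (e ^+ 2) + 2^-1 *: axis_point d e =
    axis_point d ((e + e ^+ 2) / 2).
  by rewrite /axis_point !scalerA -scalerDl; congr (_ *: _); field.
have m01 : 0 < (e + e ^+ 2) / 2 < 1 by lra.
apply: (@not_concave_powR _ _ _ _ (axis_point d (e ^+ 2)) (axis_point d e) _ theta).
- by lra.
- by lra.
- exact: thalpha.
- by apply: (axis_point_domain d lam c_axis a01); rewrite -subr_gt0.
- by apply: (axis_point_domain d lam c_axis b01); rewrite -subr_gt0.
- by rewrite mE uE// mulr_gt0.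
- by rewrite uE// mulr_gt0.
- by rewrite mE !uE// mulrCA ltr_pM2l.
Qed.
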